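(* If one of the following holds, then the separable geometry $(g_\beta,J_\beta)$ (with functions $A_{pq}$) associated to the factorization structure $$\sum_{i=1}^{k-1}\mathrm{ins}_i\big(S^{d_i}W_i^*\otimes\langle(1,0)^{\otimes(m-d_i)}\rangle\big)+\langle(\pi_1,\pi_2)^{\otimes d_1}\otimes(1,0)^{\otimes(m-d_1-d_k)}\rangle\otimes S^{d_k}W_k^*,\qquad k\ge3,\ \pi_1,\pi_2\in\mathbb R,\ \pi_2\ne0,$$ is extremal: (1) $\varphi(\beta)\in\mathrm{span}\{(1,0)^{\otimes m}\}$, i.e. $\langle\mu,\beta\rangle$ is constant, and $$A_{1q}(x_{1q})=\frac1{(\pi_1+\pi_2x_{1q})^{d_k}}\int\!\!\int\Upsilon_1(x_{1q})(\pi_1+\pi_2x_{1q})^{d_k-1}dx_{1q}dx_{1q},\quad q=1,\ldots,d_1,$$ and for $p=2,\ldots,k$, $A_{pq}(x_{pq})=\int\!\int\Upsilon_p(x_{pq})dx_{pq}dx_{pq}$, $q=1,\ldots,d_p$, where $\deg\Upsilon_1\le d_1+1$, $\deg\Upsilon_p\le d_p$ for $p=2,\ldots,k-1$, $\deg\Upsilon_k\le d_k-1$, and $\gamma_k^{d_k-1}=-(-\pi_2)^{d_1-1}\Upsilon_1(-\pi_1/\pi_2)$. (2) $\varphi(\beta)\in\mathrm{span}\{(\pi_1,\pi_2)^{\otimes d_1}\otimes(1,0)^{\otimes(m-d_1)}\}$, i.e. $\langle\mu,\beta\rangle=t\prod_{q=1}^{d_1}(\pi_1+\pi_2x_{1q})$,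 $t\in\mathbb R\setminus\{0\}$, and for $q=1,\ldots,d_1$ $$A_{1q}(x_{1q})=(\pi_1+\pi_2x_{1q})^{m+1-d_k}\int\!\!\int\Upsilon_1(x_{1q})(\pi_1+\pi_2x_{1q})^{-m+d_k-4}dx_{1q}dx_{1q},$$ and for $p=2,\ldots,k$, $A_{pq}(x_{pq})=\int\!\int\Upsilon_p(x_{pq})dx_{pq}dx_{pq}$, $q=1,\ldots,d_p$, where $\deg\Upsilon_1\le d_1+2$, $\deg\Upsilon_p\le d_p-1$ for $p=2,\ldots,k$, $\Upsilon_1(-\pi_1/\pi_2)=0$, and $\frac{\gamma_1^{d_1+2}}{\pi_2^3}+\sum_{i=2}^{k-1}\gamma_i^{d_i-1}=0$. (3) $\varphi(\beta)\in\mathrm{span}\{(a,b)^{\otimes d_1}\otimes(1,0)^{\otimes(m-d_1)}\}$ is such that $b\ne0$ and $\langle(a,b)\rangle\ne\langle(\pi_1,\pi_2)\rangle$, hence $\langle\mu,\beta\rangle=t\prod_{q=1}^{d_1}(a+bx_{1q})$, $t\in\mathbb R\setminus\{0\}$, and $$A_{1q}(x_{1q})=\frac{(a+bx_{1q})^{m+1}}{(\pi_1+\pi_2x_{1q})^{d_k}}\int\!\!\int\Upsilon_1(x_{1q})\frac{(\pi_1+\pi_2x_{1q})^{d_k-1}}{(a+bx_{1q})^{m+3}}dx_{1q}dx_{1q},\quad q=1,\ldots,d_1,$$ and for $p=2,\ldots,k$, $A_{pq}(x_{pq})=\int\!\int\Upsilon_p(x_{pq})dx_{pq}dx_{pq}$,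 $q=1,\ldots,d_p$, where $\deg\Upsilon_1\le d_1+2$, $\deg\Upsilon_p\le d_p-1$ for $p=2,\ldots,k$, are such that $\gamma_k^{d_k-1}(a-b\pi_1/\pi_2)^2=-(-\pi_2)^{d_1-1}\Upsilon_1(-\pi_1/\pi_2)$ and $\gamma_1^{d_1+2}/(\pi_2b^2)+\sum_{i=2}^{k-1}\gamma_i^{d_i-1}=0$.
   Context: Let $m=d_1+\cdots+d_k$, $d_j\ge1$, $k\ge3$, $W_1=\dots=W_k=\mathbb R^2$, $V^*=\bigotimes_{i=1}^k(W_i^* )^{\otimes d_i}$ with slots labelled $(i,r)$, $1\le r\le d_i$; $\mathrm{ins}_i$ reorders tensor factors so that the first $d_i$ factors are put into the slots $(i,1),\dots,(i,d_i)$. Let $\mathfrak h\subset V^*$ be the displayed $(m+1)$-dimensional subspace and $\varphi:\mathfrak h\hookrightarrow V^*$ the inclusion. Its defining tensors are $\Gamma_i=(1,0)^{\otimes(m-d_i)}$ for $i<k$ and $\Gamma_k=(\pi_1,\pi_2)^{\otimes d_1}\otimes(1,0)^{\otimes(m-d_1-d_k)}$. With real variables $x_{ir}$ and the pairing $\langle(u,v),(a,b)\rangle=ua+vb$ put $\langle\mu,\alpha\rangle=\langle\bigotimes_{i,r}(1,x_{ir}),\varphi(\alpha)\rangle$, $\alpha\in\mathfrak h$; $c_i:=1$ for $i<k$ and $c_k:=\prod_{q=1}^{d_1}(\pi_1+\pi_2x_{1q})$; $\Delta_{ir}=\prod_{s\ne r}(x_{ir}-x_{is})$ ($=1$ if $d_i=1$);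 $\mu_\beta=\mu/\langle\mu,\beta\rangle$; $\psi_{ir}(x)\in\mathfrak h$ with $\varphi(\psi_{ir}(x))=\mathrm{ins}_i((x,-1)^{\otimes d_i}\otimes\Gamma_i)$. Given $0\ne\beta\in\mathfrak h$ and smooth non-vanishing functions $A_{ir}$ on open intervals $I_{ir}$ such that $\Delta_{ir}$, $c_i$ and $\langle\mu,\beta\rangle$ do not vanish on $\prod I_{ir}$, the separable geometry is the (local) toric Kähler structure in coordinates $(x_{ir},t)$, $t\in\mathfrak t=\mathfrak h/\langle\beta\rangle$, $$g_\beta=\sum_{i,r}\Big(\tfrac{\Delta_{ir}c_i}{A_{ir}(x_{ir})\langle\mu,\beta\rangle}dx_{ir}^2+\tfrac{A_{ir}(x_{ir})\langle\mu,\beta\rangle}{\Delta_{ir}c_i}\langle\partial_{x_{ir}}\mu_\beta,dt\rangle^2\Big),\quad\omega_\beta=\sum_{i,r}dx_{ir}\wedge\langle\partial_{x_{ir}}\mu_\beta,dt\rangle,$$ $$J_\beta dx_{ir}=\tfrac{A_{ir}(x_{ir})\langle\mu,\beta\rangle}{\Delta_{ir}c_i}\langle\partial_{x_{ir}}\mu_\beta,dt\rangle,\quad J_\beta dt=\sum_{i,r}\tfrac{\psi_{ir}(x_{ir})\ \mathrm{mod}\ \beta}{A_{ir}(x_{ir})}dx_{ir}$$ ($A_{ir}$ such that $g_\beta$ is positive definite). It is extremal if its scalar curvature is a Killing potential; for this geometry this amounts to the existence of $\alpha\in\mathfrak h$ with $$\sum_{r=1}^{d_1}\frac{\langle\mu,\beta\rangle^{m+3}}{\Delta_{1r}(\pi_1+\pi_2x_{1r})^{d_k}}\partial_{x_{1r}}^2\Big(\frac{A_{1r}(x_{1r})}{\langle\mu,\beta\rangle^{m+1}}(\pi_1+\pi_2x_{1r})^{d_k}\Big)+\sum_{i=2}^{k-1}\sum_{r=1}^{d_i}\frac{\langle\mu,\beta\rangle^{m+3}}{\Delta_{ir}}\partial_{x_{ir}}^2\Big(\frac{A_{ir}(x_{ir})}{\langle\mu,\beta\rangle^{m+1}}\Big)$$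 $$+\sum_{r=1}^{d_k}\frac{\langle\mu,\beta\rangle^{m+3}}{\Delta_{kr}\prod_{q=1}^{d_1}(\pi_1+\pi_2x_{1q})}\partial_{x_{kr}}^2\Big(\frac{A_{kr}(x_{kr})}{\langle\mu,\beta\rangle^{m+1}}\Big)=\langle\mu,\alpha\rangle .$$ Conventions: $\Upsilon_p(x)=\sum_j\gamma_p^jx^j$ are polynomials depending on $p$ only, not on $q$ ($\gamma_p^j$ is the coefficient at $x^j$); $\int\!\int F\,dx\,dx$ denotes any second antiderivative of $F$ (determined up to adding an affine function, whose choice may depend on $(p,q)$). *)

(* Defs.v *)
From HB Require Import structures.
From mathcomp Require Import all_boot all_order all_algebra all_fingroup.
From mathcomp Require Import all_classical all_reals all_analysis.

Set Implicit Arguments.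
Unset Strict Implicit.
Unset Printing Implicit Defensive.

Import Order.TTheory GRing.Theory Num.Theory.
Import numFieldNormedType.Exports.
Local Open Scope ring_scope.

(* A chart has a finite type [C] of coordinates and points [y : C -> R].
  Tensor fields are given by their components; the domain of the chart is a
  set of points, and all functions are total with irrelevant values outside. *)

Definition partial (R : realType) (C : finType) (c : C) (f : (C -> R) -> R)
    (y : C -> R) : R :=
  derive1 (fun u : R => f (@dfwith C (fun=> R) y c u)) (y c).

Section Chart.
Context {R : realType} {C : finType}.
Local Notation point := (C -> R).
Local Notation scalar_field := (point -> R).
Local Notation vector_field := (C -> point -> R).
Local Notation field2 := (C -> C -> point -> R).

Definition posdef_at (g : field2) (y : point) : Prop :=
  forall v : C -> R, (exists c, v c != 0) ->
    0 < \sum_a \sum_b g a b y * v a * v b.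

Definition inverse_metric (g : field2) : field2 := fun a b y =>
  invmx (\matrix_(i < #|C|, j < #|C|) g (enum_val i) (enum_val j) y)
    (enum_rank a) (enum_rank b).

(* [christoffel g c a b] is Gamma^c_{ab} of the Levi-Civita connection. *)
Definition christoffel (g : field2) (c a b : C) (y : point) : R :=
  2^-1 * \sum_e inverse_metric g c e y *
    (partial a (g e b) y + partial b (g e a) y - partial e (g a b) y).

(* Sign convention: the round sphere has positive Ricci curvature. *)
Definition ricci (g : field2) : field2 := fun a b y =>
  \sum_c (partial c (christoffel g c a b) y - partial b (christoffel g c a c) y)
  + \sum_c \sum_e (christoffel g c c e y * christoffel g e a b y
                   - christoffel g c b e y * christoffel g e a c y).

Definition scalar_curvature (g : field2) : scalar_field := fun y =>
  \sum_a \sum_b inverse_metric g a b y * ricci g a b y.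

Definition gradient (g : field2) (f : scalar_field) : vector_field := fun c y =>
  \sum_e inverse_metric g c e y * partial e f y.

Definition lie_derivative (X : vector_field) (g : field2) : field2 :=
  fun a b y => \sum_c (X c y * partial c (g a b) y
                       + g c b y * partial a (X c) y
                       + g a c y * partial b (X c) y).

Definition killing_field (U : set point) (g : field2) (X : vector_field) : Prop :=
  forall y, U y -> forall a b, lie_derivative X g a b y = 0.

(* An almost complex structure is given by its action on coordinate 1-forms,
   J dy_a = \sum_b J a b dy_b; on vectors, dy_a (J X) = - (J dy_a)(X). The
   opposite sign here would not affect the notions below. *)
Definition complex_rotate (J : field2) (X : vector_field) : vector_field :=
  fun a y => - \sum_b J a b y * X b y.

Definition killing_potential (U : set point) (g J : field2) (f : scalar_field) :
    Prop :=
  killing_field U g (complex_rotate J (gradient g f)).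

Definition extremal (U : set point) (g J : field2) : Prop :=
  killing_potential U g J (scalar_curvature g).

End Chart.

(* Covectors on R^2, and vectors of R^2, are elements of ['rV[R]_2]. *)

Definition vec2 {R : realType} (a b : R) : 'rV[R]_2 :=
  \row_(j < 2) (if j == ord0 then a else b).

(* Elements of the tensor product of copies of (R^2)^* indexed by [T], as arrays
   of components. *)
Notation tensors R T := {ffun {ffun T -> 'I_2} -> R^o}.

Definition decomposable {R : realType} {T : finType} (w : T -> 'rV[R]_2) :
    tensors R T :=
  [ffun sigma : {ffun T -> 'I_2} => \prod_t w t 0 (sigma t)].

Definition tensor_pairing {R : realType} {T : finType} (v : T -> 'rV[R]_2)
    (alpha : tensors R T) : R :=
  \sum_(sigma : {ffun T -> 'I_2}) (\prod_t v t 0 (sigma t)) * alpha sigma.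

Definition permute_factors (R : realType) (p : nat) (s : 'S_p)
    (S : tensors R 'I_p) : tensors R 'I_p :=
  [ffun sigma : {ffun 'I_p -> 'I_2} => S [ffun r => sigma (s r)]].

Fact permute_factors_is_linear (R : realType) (p : nat) (s : 'S_p) : linear (@permute_factors R p s).
Proof. by move=> a S T; apply/ffunP => sigma; rewrite !ffunE. Qed.

HB.instance Definition _ (R : realType) (p : nat) (s : 'S_p) :=
  GRing.isLinear.Build R (tensors R 'I_p) (tensors R 'I_p) _
    (@permute_factors R p s) (@permute_factors_is_linear R p s).

Definition sym_tensors (R : realType) (p : nat) : {vspace tensors R 'I_p} :=
  (\bigcap_(s : 'S_p) fixedSpace (linfun (@permute_factors R p s)))%VS.

(* The number of factors is n.+3, so that it ranges over all k >= 3; the first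
  factor has index [ord0] and the k-th one [ord_max]. *)

Definition slot (n : nat) (d : 'I_n.+3 -> nat) : finType :=
  {i : 'I_n.+3 & 'I_(d i)}.

Definition Slot (n : nat) (d : 'I_n.+3 -> nat) (i : 'I_n.+3) (r : 'I_(d i)) :
    slot d :=
  Tagged (fun j => 'I_(d j)) r.

Definition order_of (n : nat) (d : 'I_n.+3 -> nat) : nat := (\sum_i d i)%N.

Section Structure.
Context {R : realType} {n : nat} (d : 'I_n.+3 -> nat) (pi1 pi2 : R).
Local Notation tensor := (tensors R (slot d)).

(* The factor of Gamma_i in the slot [s], for [s] outside the i-th group. *)
Definition Gamma (i : 'I_n.+3) (s : slot d) : 'rV[R]_2 :=
  if (i == ord_max) && (tag s == ord0) then vec2 pi1 pi2 else vec2 1 0.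

(* S |-> ins_i (S \otimes Gamma_i) *)
Definition ins (i : 'I_n.+3) (S : tensors R 'I_(d i)) : tensor :=
  [ffun sigma : {ffun slot d -> 'I_2} =>
    S [ffun r => sigma (Slot r)]
    * \prod_(s : slot d | tag s != i) Gamma i s 0 (sigma s)].

Fact ins_is_linear (i : 'I_n.+3) : linear (@ins i).
Proof.
move=> a S T; apply/ffunP => sigma; rewrite !ffunE.
by rewrite mulrDl /GRing.scale /= mulrA.
Qed.

HB.instance Definition _ (i : 'I_n.+3) :=
  GRing.isLinear.Build R (tensors R 'I_(d i)) tensor _ (@ins i)
    (@ins_is_linear i).

(* The subspace h of V^*; the inclusion phi is left implicit. *)
Definition factorization_space : {vspace tensor} :=
  (\sum_(i < n.+3) linfun (@ins i) @: sym_tensors R (d i))%VS.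

Definition mu (alpha : tensor) (x : slot d -> R) : R :=
  tensor_pairing (fun s => vec2 1 (x s)) alpha.

Definition mu_normalized (beta alpha : tensor) (x : slot d -> R) : R :=
  mu alpha x / mu beta x.

Definition cfactor (i : 'I_n.+3) (x : slot d -> R) : R :=
  if i == ord_max then \prod_(q < d ord0) (pi1 + pi2 * x (Slot q)) else 1.

Definition Delta (s : slot d) (x : slot d -> R) : R :=
  \prod_(u : slot d | (tag u == tag s) && (u != s)) (x s - x u).

Definition psi (s : slot d) (z : R) : tensor :=
  ins (decomposable (fun _ : 'I_(d (tag s)) => vec2 z (-1))).

Definition profile (A : slot d -> R -> R) (beta : tensor) (s : slot d)
    (x : slot d -> R) : R :=
  A s (x s) * mu beta x / (Delta s x * cfactor (tag s) x).

(* Coordinates (x, t): [inl s] is x_s and [inr a] is the a-th coordinate of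
   t \in h / <beta> in the basis (e_a mod beta), for [e] such that
   [beta :: e] is a basis of h. *)
Definition coordinate : finType := (slot d + 'I_(order_of d))%type.

Definition xpart (y : coordinate -> R) : slot d -> R := fun s => y (inl s).

(* The components of <d/dx_s mu_beta, dt> with respect to the dt_a. *)
Definition dmu (beta : tensor) (e : (order_of d).-tuple tensor) (s : slot d)
    (a : 'I_(order_of d)) (x : slot d -> R) : R :=
  partial s (mu_normalized beta (tnth e a)) x.

(* The coordinates of [alpha mod beta] in the basis (e_a mod beta). *)
Definition mod_coord (beta : tensor) (e : (order_of d).-tuple tensor)
    (a : 'I_(order_of d)) (alpha : tensor) : R :=
  coord [tuple of beta :: e] (lift ord0 a) alpha.

Definition g_metric (A : slot d -> R -> R) (beta : tensor)
    (e : (order_of d).-tuple tensor) (a b : coordinate) (y : coordinate -> R) :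
    R :=
  let x := xpart y in
  match a, b with
  | inl s, inl u => if s == u then (profile A beta s x)^-1 else 0
  | inr i, inr j =>
      \sum_s profile A beta s x * dmu beta e s i x * dmu beta e s j x
  | _, _ => 0
  end.

(* [J_complex A beta e a b] is the dy_b-component of J dy_a. *)
Definition J_complex (A : slot d -> R -> R) (beta : tensor)
    (e : (order_of d).-tuple tensor) (a b : coordinate) (y : coordinate -> R) :
    R :=
  let x := xpart y in
  match a, b with
  | inl s, inr j => profile A beta s x * dmu beta e s j x
  | inr i, inl s => mod_coord beta e i (psi s (x s)) / A s (x s)
  | _, _ => 0
  end.

Definition box (I : slot d -> set R) : set (slot d -> R) :=
  [set x | forall s, I s (x s)]%classic.

Definition chart_domain (I : slot d -> set R) : set (coordinate -> R) :=
  [set y | box I (xpart y)]%classic.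

End Structure.

Definition open_interval (R : realType) (I : set R) : Prop :=
  open I /\ is_interval I.

Definition smooth_on (R : realType) (I : set R) (f : R -> R) : Prop :=
  forall (j : nat) z, I z -> derivable (derive1n j f) z 1.

Definition second_antiderivative (R : realType) (I : set R) (F G : R -> R) :
    Prop :=
  forall z, I z ->
    [/\ derivable G z 1, derivable (derive1 G) z 1 & derive1 (derive1 G) z = F z].

(* [beta :: e] being a basis of h says that
   beta is a nonzero element of h and that [e] is a basis of h modulo beta. *)
Definition separable_geometry (R : realType) (n : nat) (d : 'I_n.+3 -> nat)
    (pi1 pi2 : R) (beta : tensors R (slot d))
    (e : (order_of d).-tuple (tensors R (slot d)))
    (I : slot d -> set R) (A : slot d -> R -> R) : Prop :=
  [/\ basis_of (factorization_space d pi1 pi2) (beta :: e),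
      (forall s, open_interval (I s)),
      (forall s, smooth_on (I s) (A s) /\ (forall z, I s z -> A s z != 0)),
      (forall x, box I x ->
         [/\ forall s, Delta s x != 0,
             forall i, cfactor pi1 pi2 i x != 0
           & mu beta x != 0])
    & (forall y, chart_domain I y ->
         posdef_at (g_metric pi1 pi2 A beta e) y)].

(* Main.v *)
(* In the frame of the 1-forms [<d mu_beta/d x_s, dt>] the metric is diagonal,
   and the identity [alpha_su = lam s u * alpha_u + lam u s * alpha_s] for the
   second derivatives of the multi-affine functions [mu alpha], [alpha \in h],
   makes the derivatives of that frame explicit in terms of the logarithmic
   derivatives of the profiles. A direct Levi-Civita computation then gives the
   scalar curvature as [- \sum_s P_s (d_s K_s + K_s^2 + 2 b_s K_s)], where
   [b_s = d_s log <mu, beta>] and [K_s = 2 d_s log (vol of the torus fibre)].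
   The potentials [<mu, alpha> / <mu, beta>] have constant-coefficient
   Hamiltonian fields, hence are Killing potentials, so it suffices that the
   scalar curvature is of this form. All three cases have
   [<mu, beta> = t \prod_q E(x_1q)] and
   [A_1q = E^(m+1) / L^(d_k) \int\int Upsilon_1 L^(d_k-1) / E^(m+3)] with [E]
   affine, so the curvature is a sum over the groups of divided differences of
   [Upsilon_1 / (E^2 L)] and of the polynomials [Upsilon_p]; partial fractions
   evaluate them, and the conditions on the coefficients cancel exactly the
   terms which are not of the form [<mu, alpha>]. *)
Require Import Defs.
From HB Require Import structures.
From mathcomp Require Import all_boot all_order all_algebra all_fingroup.
From mathcomp Require Import all_classical all_reals all_analysis.
From mathcomp Require Import ring.
Set Implicit Arguments.
Unset Strict Implicit.
Unset Printing Implicit Defensive.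
Import Order.TTheory GRing.Theory Num.Theory.
Import numFieldNormedType.Exports.
Local Open Scope ring_scope.

(** * Partial derivatives *)

(** The obstacle is the torus block [G] of the metric, a full matrix depending on the arbitrary
    basis [e]. It is never expanded in coordinates: [G^-1 * d_s G] is conjugate, through the frame,
    to an explicit matrix, and the curvature sees it only through the trace and the trace of the
    square; the latter either cancels or is evaluated in the frame. What closes the computation is a
    Riccati law. For [s != u] the derivative of [log P_u] along [s] is [b_s - lam s u], and both
    terms solve [y' = - y ^ 2] in [x_s], being logarithmic derivatives of affine functions, or zero.
    Hence no unknown second derivative survives off the diagonal, and the rest is absorbed in
    [d_s K_s]. A second constraint shapes the final sums: [alpha] is one tensor, so every
    coefficient produced by partial fractions has to be independent of the point. The tensors
    realising the result are powers [w^d] in one group and their first polarizations, whose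
    functions are a product of affine factors and that product times the sum of the inverse factors,
    or, for the power of [(1,0)], the sum of the coordinates. *)

(** [partial] is total, so an equation on it does not say that the derivative exists; this relation
    records existence and value together. *)
Definition is_partial (R : realType) (C : finType) (c : C) (f : (C -> R) -> R)
    (y : C -> R) (l : R) : Prop :=
  is_derive (y c) 1 (fun u : R => f (@dfwith C (fun=> R) y c u)) l.

Section PartialCalculus.
Context {R : realType} {C : finType}.
Implicit Types (c a : C) (f g : (C -> R) -> R) (y : C -> R) (l k : R).
Local Notation upd := (@dfwith C (fun=> R)).

Lemma upd_id y c : upd y c (y c) = y.
Proof. by apply/funext => a; case: dfwithP. Qed.

Lemma is_partialE c f y l : is_partial c f y l -> partial c f y = l.
Proof. by move=> H; rewrite /partial derive1E; apply: derive_val. Qed.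

Lemma is_partial_eq c f y l k : is_partial c f y l -> l = k -> is_partial c f y k.
Proof. by move=> H <-. Qed.

Lemma is_partial_near c f g y l :
  (\forall z \near y c, g (upd y c z) = f (upd y c z)) ->
  is_partial c f y l -> is_partial c g y l.
Proof.
rewrite /is_partial => E; apply: near_eq_is_derive.
by apply: filterS E => z /esym.
Qed.

Lemma is_partial_ext c f g y l :
  (forall x, g x = f x) -> is_partial c f y l -> is_partial c g y l.
Proof. by move=> E; have -> : g = f by apply/funext. Qed.

Lemma partial_near c f g y :
  (\forall z \near y c, g (upd y c z) = f (upd y c z)) ->
  partial c g y = partial c f y.
Proof. by move=> E; rewrite /partial !derive1E; apply: near_eq_derive. Qed.

Lemma is_partial_indep c f y : (forall z, f (upd y c z) = f y) ->
  is_partial c f y 0.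
Proof.
move=> E; rewrite /is_partial.
have -> : (fun u => f (upd y c u)) = cst (f y) by apply/funext.
exact: is_derive_cst.
Qed.

Lemma is_partial_cst c l y : is_partial c (fun=> l) y 0.
Proof. exact: is_partial_indep. Qed.

Lemma is_partialD c f g y l k : is_partial c f y l -> is_partial c g y k ->
  is_partial c (fun x => f x + g x) y (l + k).
Proof. exact: is_deriveD. Qed.

Lemma is_partialN c f y l : is_partial c f y l ->
  is_partial c (fun x => - f x) y (- l).
Proof. exact: is_deriveN. Qed.

Lemma is_partialB c f g y l k : is_partial c f y l -> is_partial c g y k ->
  is_partial c (fun x => f x - g x) y (l - k).
Proof. exact: is_deriveB. Qed.

Lemma is_partialM c f g y l k : is_partial c f y l -> is_partial c g y k ->
  is_partial c (fun x => f x * g x) y (l * g y + f y * k).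
Proof.
move=> Hf Hg; have := is_deriveM Hf Hg; rewrite !upd_id => H.
by apply: is_derive_eq H _; rewrite addrC /GRing.scale /= mulrC.
Qed.

Lemma is_partialV c f y l : f y != 0 -> is_partial c f y l ->
  is_partial c (fun x => (f x)^-1) y (- l / f y ^+ 2).
Proof.
move=> f0 Hf; have := @is_deriveV R (fun u => f (upd y c u)) (y c) l 1.
rewrite upd_id => /(_ f0 Hf) H.
by apply: is_derive_eq H _; rewrite /GRing.scale /= mulrC mulrN mulNr.
Qed.

Lemma is_partial_sum (J : Type) (s : seq J) (Q : pred J) c (f : J -> (C -> R) -> R) y
    (l : J -> R) :
  (forall j, Q j -> is_partial c (f j) y (l j)) ->
  is_partial c (fun x => \sum_(j <- s | Q j) f j x) y (\sum_(j <- s | Q j) l j).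
Proof.
move=> H; elim: s => [|j s IH].
  by rewrite big_nil; apply: is_partial_ext (is_partial_cst c 0 y) => x; rewrite big_nil.
rewrite big_cons; case: ifP => [Qj|nQj].
  by apply: is_partial_ext (is_partialD (H j Qj) IH) => x; rewrite big_cons Qj.
by apply: is_partial_ext IH => x; rewrite big_cons nQj.
Qed.

Lemma is_partial_coord c (h : R -> R) y l : is_derive (y c) 1 h l ->
  is_partial c (fun x => h (x c)) y l.
Proof.
rewrite /is_partial => H.
suff -> : (fun u => h (upd y c u c)) = h by [].
by apply/funext => u; rewrite dfwithin.
Qed.

Lemma is_partial_other c a (h : R -> R) y : a != c ->
  is_partial c (fun x => h (x a)) y 0.
Proof.
by move=> ac; apply: is_partial_indep => z; rewrite dfwithout // eq_sym.
Qed.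

End PartialCalculus.

(** * Linear algebra over finite index types *)

Section InverseMetric.
Context {R : realType} {C : finType}.

(** A right inverse of a square matrix is its inverse, so [invmx] is identified from a single
    product, transported along the enumeration of the index type. *)
Lemma inverse_metricE (g h : C -> C -> (C -> R) -> R) (y : C -> R) :
  (forall a b, \sum_c g a c y * h c b y = (a == b)%:R) ->
  forall a b, inverse_metric g a b y = h a b y.
Proof.
move=> gh a b; rewrite /inverse_metric.
set G := \matrix_(i, j) _.
pose H := \matrix_(i < #|C|, j < #|C|) h (enum_val i) (enum_val j) y.
have GH : G *m H = 1%:M.
  apply/matrixP => i j; rewrite !mxE -(inj_eq enum_val_inj) -gh.
  rewrite (big_enum_val (fun c => g (enum_val i) c y * h c (enum_val j) y)).
  by apply: eq_bigr => k _; rewrite !mxE.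
have [Gu _] := mulmx1_unit GH.
have -> : invmx G = H by rewrite -[RHS](mulKmx Gu) GH mulmx1.
by rewrite mxE !enum_rankK.
Qed.

End InverseMetric.

Section FinIndexed.
Context {R : comNzRingType}.

(* Matrices indexed by finite types, as plain functions. *)
Definition fmul {A B C : finType} (F : A -> B -> R) (G : B -> C -> R) a c :=
  \sum_b F a b * G b c.
Definition ftr {A : finType} (F : A -> A -> R) := \sum_a F a a.

Lemma fmulA (A B C D : finType) (F : A -> B -> R) (G : B -> C -> R) (H : C -> D -> R) :
  fmul F (fmul G H) = fmul (fmul F G) H.
Proof.
apply/funext => a; apply/funext => d; rewrite /fmul.
under eq_bigr do rewrite mulr_sumr.
rewrite exchange_big; apply: eq_bigr => c _.
by rewrite mulr_suml; apply: eq_bigr => b _; rewrite mulrA.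
Qed.

Lemma ftrC (A B : finType) (F : A -> B -> R) (G : B -> A -> R) :
  ftr (fmul F G) = ftr (fmul G F).
Proof.
rewrite /ftr /fmul exchange_big; apply: eq_bigr => b _.
by apply: eq_bigr => a _; rewrite mulrC.
Qed.

Lemma sum_delta (A : finType) (a : A) (F : A -> R) : \sum_b (a == b)%:R * F b = F a.
Proof.
rewrite (bigD1 a) //= eqxx mul1r big1 ?addr0 // => b /negPf ba.
by rewrite eq_sym ba mul0r.
Qed.

Lemma fmul1l (A B : finType) (I : A -> A -> R) (F : A -> B -> R) :
  (forall a b, I a b = (a == b)%:R) -> fmul I F = F.
Proof.
move=> I1; apply/funext => a; apply/funext => b; rewrite /fmul.
by under eq_bigr do rewrite I1; rewrite sum_delta.
Qed.

Lemma fmul1r (A B : finType) (I : A -> A -> R) (F : B -> A -> R) :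
  (forall a b, I a b = (a == b)%:R) -> fmul F I = F.
Proof.
move=> I1; apply/funext => b; apply/funext => a; rewrite /fmul.
under eq_bigr do rewrite I1 mulrC eq_sym.
by rewrite (sum_delta a (F b)).
Qed.

(** One-sided inverses are two-sided between index types of equal cardinality. This serves the
    frame, whose rows are slots and whose columns are torus coordinates. *)
Lemma fmul_1C (A B : finType) (F : A -> B -> R) (G : B -> A -> R) : #|A| = #|B| ->
  (forall a a', fmul F G a a' = (a == a')%:R) ->
  forall b b', fmul G F b b' = (b == b')%:R.
Proof.
move=> AB FG.
pose f (i : 'I_#|A|) := enum_val (cast_ord AB i) : B.
have fK (b : B) : f (cast_ord (esym AB) (enum_rank b)) = b.
  by rewrite /f cast_ord_comp cast_ord_id enum_rankK.
have f_inj : injective f by move=> i j /enum_val_inj /cast_ord_inj.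
pose M := \matrix_(i, j < #|A|) F (enum_val i) (f j).
pose N := \matrix_(i, j < #|A|) G (f i) (enum_val j).
have MN : M *m N = 1%:M.
  apply/matrixP => i j; rewrite !mxE -(inj_eq enum_val_inj) -FG /fmul.
  rewrite (reindex f) /=; first by apply: eq_bigr => k _; rewrite !mxE.
  exists (fun b => cast_ord (esym AB) (enum_rank b)) => [k _|b _]; last exact: fK.
  by apply: f_inj; rewrite fK.
have /matrixP NM := mulmx1C MN.
move=> b b'; rewrite -(fK b) -(fK b') (inj_eq f_inj).
move: (NM (cast_ord (esym AB) (enum_rank b)) (cast_ord (esym AB) (enum_rank b'))).
rewrite !mxE /fmul => <-.
rewrite (big_enum_val (fun a => G (f _) a * F a (f _))).
by apply: eq_bigr => k _; rewrite !mxE.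
Qed.

End FinIndexed.

(** * Differentiability along one coordinate, without a value *)

Definition pdiff (R : realType) (C : finType) (c : C) (f : (C -> R) -> R)
    (y : C -> R) : Prop := exists l, is_partial c f y l.

Section Pdiff.
Context {R : realType} {C : finType}.
Implicit Types (c : C) (f g : (C -> R) -> R) (y : C -> R).

Lemma pdiffP c f y : pdiff c f y -> is_partial c f y (partial c f y).
Proof. by move=> [l H]; rewrite (is_partialE H). Qed.

Lemma is_partial_pdiff c f y l : is_partial c f y l -> pdiff c f y.
Proof. by exists l. Qed.

Lemma pdiff_ext c f g y : (forall x, g x = f x) -> pdiff c f y -> pdiff c g y.
Proof. by move=> E [l H]; exists l; apply: is_partial_ext H. Qed.

Lemma pdiff_cst c (l : R) y : pdiff c (fun=> l) y.
Proof. by exists 0; exact: is_partial_cst. Qed.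

Lemma pdiffD c f g y : pdiff c f y -> pdiff c g y -> pdiff c (fun x => f x + g x) y.
Proof. by move=> [l Hf] [k Hg]; exists (l + k); exact: is_partialD. Qed.

Lemma pdiffN c f y : pdiff c f y -> pdiff c (fun x => - f x) y.
Proof. by move=> [l Hf]; exists (- l); exact: is_partialN. Qed.

Lemma pdiffB c f g y : pdiff c f y -> pdiff c g y -> pdiff c (fun x => f x - g x) y.
Proof. by move=> [l Hf] [k Hg]; exists (l - k); exact: is_partialB. Qed.

Lemma pdiffM c f g y : pdiff c f y -> pdiff c g y -> pdiff c (fun x => f x * g x) y.
Proof. by move=> [l Hf] [k Hg]; eexists; exact: (is_partialM Hf Hg). Qed.

Lemma pdiffV c f y : f y != 0 -> pdiff c f y -> pdiff c (fun x => (f x)^-1) y.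
Proof. by move=> f0 [l Hf]; eexists; exact: (is_partialV f0 Hf). Qed.

Lemma pdiff_sum (J : Type) (s : seq J) (Q : pred J) c (f : J -> (C -> R) -> R) y :
  (forall j, Q j -> pdiff c (f j) y) ->
  pdiff c (fun x => \sum_(j <- s | Q j) f j x) y.
Proof.
move=> H; exists (\sum_(j <- s | Q j) partial c (f j) y).
by apply: is_partial_sum => j Qj; apply/pdiffP/H.
Qed.

End Pdiff.

(** * Curvature of a torus-invariant metric diagonal in a frame *)

Section OrthogonalToric.
Context {R : realType} {S T : finType}.
Local Notation upd := (@dfwith S (fun=> R)).
Variables (U : set (S -> R)).
(** [P s] is the profile of the coordinate [s], the row [D s] is the matching 1-form in the torus
    coordinates, [N] inverts [D], [q s u] is the derivative of [log P_u] along [s], and [b s] is the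
    function with [d_s D_s = - 2 b_s D_s]. *)
Variables (P : S -> (S -> R) -> R) (D : S -> T -> (S -> R) -> R)
  (N : T -> S -> (S -> R) -> R) (q : S -> S -> (S -> R) -> R)
  (b : S -> (S -> R) -> R).

Definition base (y : (S + T)%type -> R) : S -> R := fun s => y (inl s).

Definition toric_metric (a c : (S + T)%type) (y : (S + T)%type -> R) : R :=
  match a, c with
  | inl s, inl u => if s == u then (P s (base y))^-1 else 0
  | inr i, inr j => \sum_s P s (base y) * D s i (base y) * D s j (base y)
  | _, _ => 0
  end.

(* The matrix of [d_s D], expressed in the frame [D] itself. *)
Definition frame_conn (s u v : S) (x : S -> R) : R :=
  if u == s then (if v == s then - 2 * b s x else 0)
  else if v == s then - q u s x
  else if v == u then - q s u x else 0.

(* The matrix [K] such that [d_s G = D^T P K D], for the torus block [G = D^T P D]. *)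
Definition frame_dG (s u v : S) (x : S -> R) : R :=
  frame_conn s v u x * P v x / P u x + (u == v)%:R * q s u x + frame_conn s u v x.

(** The derivative of [log (det G)] along [s] for the torus block [G], that is, the [K_s] of the
    scalar curvature formula. *)
Definition trace_dG (s : S) (x : S -> R) : R :=
  q s s x - \sum_(u | u != s) q s u x - 4 * b s x.

Hypothesis U_open : forall x s, U x -> \forall z \near x s, U (upd x s z).
Hypothesis P_neq0 : forall s x, U x -> P s x != 0.
Hypothesis dP : forall s u x, U x -> is_partial s (P u) x (q s u x * P u x).
(** The Riccati law: it makes explicit the off-diagonal second derivatives that occur in the Ricci
    tensor of the base. *)
Hypothesis dq : forall s u x, U x -> s != u ->
  is_partial s (q s u) x (q s u x ^+ 2 - 2 * b s x * q s u x).
Hypothesis q_diff : forall s u v x, U x -> pdiff s (q u v) x.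
Hypothesis b_diff : forall s x, U x -> pdiff s (b s) x.
Hypothesis dD : forall s u j x, U x ->
  is_partial s (D u j) x (\sum_v frame_conn s u v x * D v j x).
Hypothesis N_diff : forall s j u x, U x -> pdiff s (N j u) x.
Hypothesis DN : forall s u x, U x -> \sum_j D s j x * N j u x = (s == u)%:R.
Hypothesis ND : forall j k x, U x -> \sum_s N j s x * D s k x = (j == k)%:R.

Local Notation E := frame_conn.
Local Notation K := frame_dG.
Local Notation Kt := trace_dG.
Local Notation g := toric_metric.
Local Notation Dx x := (fun s j => D s j x).
Local Notation Dt x := (fun j s => D s j x).
Local Notation Nx x := (fun j s => N j s x).
Local Notation Nt x := (fun s j => N j s x).
Local Notation Kx s x := (fun u v => K s u v x).
Local Notation Pd x := (fun s u : S => (s == u)%:R * P s x).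
Local Notation Pi x := (fun s u : S => (s == u)%:R * (P s x)^-1).

(** * Matrix algebra of the torus block *)

(** [tG] is the torus block, [tH] its inverse and [tGd s] its derivative along [s], all factored
    through the frame. *)
Definition tG x := fmul (Dt x) (fmul (Pd x) (Dx x)).
Definition tH x := fmul (Nx x) (fmul (Pi x) (Nt x)).
Definition tGd s x := fmul (Dt x) (fmul (Pd x) (fmul (Kx s x) (Dx x))).
(* [G^-1 * d_s G], see [tHGd]. *)
Definition tX s x := fmul (Nx x) (fmul (Kx s x) (Dx x)).

Lemma PdM (A : finType) x (F : S -> A -> R) s a : fmul (Pd x) F s a = P s x * F s a.
Proof. by rewrite /fmul; under eq_bigr do rewrite -mulrA; rewrite (sum_delta s (fun u => P s x * F u a)). Qed.

Lemma PiM (A : finType) x (F : S -> A -> R) s a : fmul (Pi x) F s a = (P s x)^-1 * F s a.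
Proof. by rewrite /fmul; under eq_bigr do rewrite -mulrA; rewrite (sum_delta s (fun u => (P s x)^-1 * F u a)). Qed.

Lemma DNt x : U x -> forall s u, fmul (Nt x) (Dt x) s u = (s == u)%:R.
Proof.
by move=> Ux s u; rewrite /fmul eq_sym -(DN u s Ux); apply: eq_bigr => j _; rewrite mulrC.
Qed.

Lemma PiPd x : U x -> forall s u, fmul (Pi x) (Pd x) s u = (s == u)%:R.
Proof. by move=> Ux s u; rewrite PiM mulrCA mulVf ?mulr1 ?P_neq0. Qed.

Lemma tHG x : U x -> forall j k, fmul (tH x) (tG x) j k = (j == k)%:R.
Proof.
move=> Ux j k; rewrite /tH /tG -!fmulA (fmulA (Nt x)) (fmul1l _ (DNt Ux)).
by rewrite (fmulA (Pi x)) (fmul1l _ (PiPd Ux)) /fmul ND.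
Qed.

Lemma tH_sym x j k : tH x j k = tH x k j.
Proof.
rewrite /tH; apply: eq_bigr => s _.
by rewrite !PiM mulrCA [RHS]mulrCA (mulrC (N j s x)).
Qed.

Lemma tG_entry x j k : tG x j k = \sum_s P s x * D s j x * D s k x.
Proof. by apply: eq_bigr => s _; rewrite PdM mulrCA mulrA. Qed.

Lemma tHGd s x : U x -> fmul (tH x) (tGd s x) = tX s x.
Proof.
move=> Ux; rewrite /tH /tGd -!fmulA (fmulA (Nt x)) (fmul1l _ (DNt Ux)).
by rewrite (fmulA (Pi x)) (fmul1l _ (PiPd Ux)).
Qed.

Lemma tGX s x : U x -> fmul (tG x) (tX s x) = tGd s x.
Proof.
move=> Ux; rewrite /tG /tX -!fmulA (fmulA (Dx x)).
by rewrite (fmul1l (I := fmul (Dx x) (Nx x))) // => a c; rewrite /fmul DN.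
Qed.

(** [D * N = 1] makes [tX s] conjugate to [frame_dG s], so its traces can be computed in the
    frame. *)
Lemma tr_tX s x : U x -> ftr (tX s x) = ftr (Kx s x).
Proof.
move=> Ux; rewrite /tX ftrC -fmulA (fmul1r (I := fmul (Dx x) (Nx x))) //.
by move=> a c; rewrite /fmul DN.
Qed.

Lemma tr_tX2 s x : U x ->
  ftr (fmul (tX s x) (tX s x)) = ftr (fmul (Kx s x) (Kx s x)).
Proof.
move=> Ux; rewrite /tX -!fmulA (fmulA (Dx x)).
rewrite (fmul1l (I := fmul (Dx x) (Nx x))); last by move=> a c; rewrite /fmul DN.
rewrite ftrC -!fmulA (fmul1r (I := fmul (Dx x) (Nx x))) //.
by move=> a c; rewrite /fmul DN.
Qed.

Lemma frame_dG_diag s x : U x -> K s s s x = q s s x - 4 * b s x.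
Proof. by move=> Ux; rewrite /K /E !eqxx mulfK ?P_neq0 //=; ring. Qed.

Lemma frame_dG_ud s u x : U x -> u != s -> K s u u x = - q s u x.
Proof. by move=> Ux us; rewrite /K /E !eqxx (negPf us) mulfK ?P_neq0 //=; ring. Qed.

Lemma frame_dG_us s u x : U x -> u != s -> K s u s x = - q u s x.
Proof. by move=> Ux us; rewrite /K /E !eqxx (negPf us) /=; ring. Qed.

Lemma frame_dG_su s u x : U x -> u != s -> K s s u x = - q u s x * P u x / P s x.
Proof.
move=> Ux us; have su : (s == u) = false by rewrite eq_sym (negPf us).
by rewrite /K /E !eqxx (negPf us) su /=; ring.
Qed.

Lemma frame_dG_off s u v x : u != s -> v != s -> u != v -> K s u v x = 0.
Proof.
move=> us vs uv; have vu : (v == u) = false by rewrite eq_sym (negPf uv).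
by rewrite /K /E (negPf us) (negPf vs) (negPf uv) vu /=; ring.
Qed.

Lemma tr_frame_dG s x : U x -> ftr (Kx s x) = Kt s x.
Proof.
move=> Ux; rewrite /ftr (bigD1 s) //= frame_dG_diag // /Kt.
rewrite (eq_bigr (fun u => - q s u x)) => [|u us]; last exact: frame_dG_ud.
by rewrite sumrN; ring.
Qed.

(** Off the diagonal [frame_dG s] lives in the row and the column of [s]; the entries [(s, u)] and
    [(u, s)] pair up and are counted twice. *)
Lemma tr_frame_dG2 s x : U x -> ftr (fmul (Kx s x) (Kx s x)) =
  \sum_(u | u != s) (q s u x ^+ 2 + 2 * q u s x ^+ 2 * P u x / P s x)
  + (q s s x - 4 * b s x) ^+ 2.
Proof.
move=> Ux; have Ps := P_neq0 s Ux; rewrite /ftr /fmul (bigD1 s) //= (bigD1 s) //=.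
rewrite frame_dG_diag // -addrA addrC -expr2; congr (_ + _).
rewrite -big_split; apply: eq_bigr => u us /=.
rewrite (bigD1 s) //= (bigD1 u) //= big1 => [|v /andP[vs vu]].
  by rewrite frame_dG_ud // frame_dG_us // frame_dG_su //; field.
by rewrite (frame_dG_off _ us vs) ?mul0r // eq_sym.
Qed.

(** * Christoffel symbols of the torus-invariant metric *)

Definition dmetric (a c e : (S + T)%type) (x : S -> R) : R :=
  match a, c, e with
  | inl s, inl u, inl v => if u == v then - q s u x / P u x else 0
  | inl s, inr j, inr k => tGd s x j k
  | _, _, _ => 0
  end.

Definition toric_chr (c a e : (S + T)%type) (x : S -> R) : R :=
  match c, a, e with
  | inl w, inl s, inl u =>
     2^-1 * (- (w == u)%:R * q s w x - (w == s)%:R * q u w x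
             + (s == u)%:R * (P w x * q w s x / P s x))
  | inl w, inr j, inr k => - 2^-1 * P w x * tGd w x j k
  | inr j, inl s, inr k => 2^-1 * tX s x j k
  | inr j, inr k, inl s => 2^-1 * tX s x j k
  | _, _, _ => 0
  end.

Definition inv_toric (a c : (S + T)%type) (x : S -> R) : R :=
  match a, c with
  | inl s, inl u => (s == u)%:R * P s x
  | inr i, inr j => tH x i j
  | _, _ => 0
  end.

Local Notation V y := (U (base y)).

Lemma base_updl y s (z : R) : base (@dfwith _ (fun=> R) y (inl s) z) = upd (base y) s z.
Proof.
apply/funext => u; rewrite /base; have [<-|us] := eqVneq s u; first by rewrite !dfwithin.
by rewrite !dfwithout //; apply: contra us => /eqP[->].
Qed.

Lemma base_updr y j (z : R) : base (@dfwith _ (fun=> R) y (inr j) z) = base y.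
Proof. by apply/funext => u; rewrite /base dfwithout. Qed.

Lemma is_partial_base s f y l : is_partial s f (base y) l ->
  is_partial (inl s) (fun y => f (base y)) y l.
Proof.
rewrite /is_partial.
suff -> : (fun u => f (base (@dfwith _ (fun=> R) y (inl s) u))) =
   fun u => f (upd (base y) s u) by [].
by apply/funext => u; rewrite base_updl.
Qed.

Lemma partial_onl F f y s : V y -> (forall y, V y -> F y = f (base y)) ->
  partial (inl s) F y = partial s f (base y).
Proof.
move=> Vy H; rewrite (@partial_near _ _ _ (fun y => f (base y))).
  by rewrite /partial; congr (derive1 _ _); apply/funext => u; rewrite base_updl.
by apply: filterS (U_open s Vy) => z Uz; apply: H; rewrite base_updl.
Qed.

Lemma partial_onr F f y j : V y -> (forall y, V y -> F y = f (base y)) ->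
  partial (inr j) F y = 0.
Proof.
move=> Vy H; apply: is_partialE; apply: is_partial_indep => z.
by rewrite !H ?base_updr.
Qed.

Lemma is_partial_fmul (A B C : finType) s (F : (S -> R) -> A -> B -> R)
    (G : (S -> R) -> B -> C -> R) F' G' x :
  (forall a c, is_partial s (fun x => F x a c) x (F' a c)) ->
  (forall a c, is_partial s (fun x => G x a c) x (G' a c)) ->
  forall a c, is_partial s (fun x => fmul (F x) (G x) a c) x
     (fmul F' (G x) a c + fmul (F x) G' a c).
Proof.
move=> HF HG a c; rewrite /fmul -big_split; apply: is_partial_sum => e _.
exact: is_partialM.
Qed.

Lemma pdiff_fmul (A B C : finType) s (F : (S -> R) -> A -> B -> R)
    (G : (S -> R) -> B -> C -> R) x :
  (forall a c, pdiff s (fun x => F x a c) x) ->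
  (forall a c, pdiff s (fun x => G x a c) x) ->
  forall a c, pdiff s (fun x => fmul (F x) (G x) a c) x.
Proof.
by move=> HF HG a c; rewrite /fmul; apply: pdiff_sum => e _; apply: pdiffM.
Qed.

Lemma is_partial_tG s j k x : U x -> is_partial s (fun x => tG x j k) x (tGd s x j k).
Proof.
move=> Ux; apply: is_partial_ext (fun x => tG_entry x j k) _.
apply: is_partial_eq.
  apply: is_partial_sum => u _; apply: is_partialM; last exact: dD.
  apply: is_partialM; [exact: dP|exact: dD].
transitivity (\sum_u (\sum_v (u == v)%:R * (q s u x * P u x * D u j x * D v k x)
  + \sum_v P v x * E s v u x * D u j x * D v k x
  + \sum_v P u x * D u j x * E s u v x * D v k x)).
  rewrite !big_split /=; congr (_ + _); last first.
    by apply: eq_bigr => u _; rewrite mulr_sumr; apply: eq_bigr => v _; rewrite !mulrA.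
  under eq_bigr do rewrite mulrDl.
  rewrite big_split /=; congr (_ + _).
    by apply: eq_bigr => u _; rewrite (sum_delta u (fun v => q s u x * P u x * D u j x * D v k x)).
  rewrite exchange_big /=; apply: eq_bigr => u _; rewrite mulr_sumr mulr_suml.
  by apply: eq_bigr => v _; rewrite !mulrA.
apply: eq_bigr => u _; rewrite PdM /fmul -!big_split /= !mulr_sumr.
apply: eq_bigr => v _; by rewrite /K; have Pu := P_neq0 u Ux; field.
Qed.

Lemma toric_inverse a c y : V y -> inverse_metric g a c y = inv_toric a c (base y).
Proof.
move=> Vy; apply: (@inverse_metricE _ _ g (fun a c y => inv_toric a c (base y))).
move=> {a c} [s|j] [u|k]; rewrite big_sumType /=.
- rewrite (eq_bigr (fun v => (s == v)%:R * ((P s (base y))^-1 *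
     ((v == u)%:R * P v (base y))))); last first.
    by move=> v _; case: eqP => _; rewrite ?mul0r ?mul1r.
  rewrite (sum_delta s (fun v => (P s (base y))^-1 * ((v == u)%:R * P v (base y)))).
  rewrite big1 => [|j _]; last by rewrite mul0r.
  by rewrite addr0 mulrCA mulVf ?P_neq0 ?mulr1.
- rewrite !big1 ?addr0 // => [l _|v _]; first by rewrite mul0r.
  by rewrite mulr0.
- rewrite !big1 ?addr0 // => [l _|v _]; first by rewrite mulr0.
  by rewrite mul0r.
- rewrite big1 ?add0r => [|v _]; last by rewrite mul0r.
  rewrite (_ : (inr j == inr k) = (j == k)) //.
  rewrite -(fmul_1C (erefl #|T|) (tHG Vy) j k) /fmul.
  by apply: eq_bigr => l _; rewrite [tG _ _ _]tG_entry.
Qed.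

Lemma toric_dmetric a c e y : V y -> partial a (g c e) y = dmetric a c e (base y).
Proof.
move=> Vy; have zero a' : partial a' (fun=> 0 : R) y = 0.
  by apply/is_partialE/is_partial_cst.
case: a => [s|i]; last first.
  (* The components depend on the base part alone, so the witness extends a base point by zero torus
     coordinates. *)
  by rewrite (@partial_onr _ (fun x => g c e (fun v => if v is inl s then x s else 0))).
case: c e => [u|j] [v|k]; rewrite /g /=.
- case: eqP => [_|_]; last exact: zero.
  apply: is_partialE; apply: (is_partial_base (f := fun x => (P u x)^-1)).
  apply: is_partial_eq (is_partialV (P_neq0 u Vy) (dP s u Vy)) _.
  by have := P_neq0 u Vy => Pu; field.
- exact: zero.
- exact: zero.
- apply: is_partialE.
  apply: (is_partial_base (f := fun x => \sum_s P s x * D s j x * D s k x)).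
  apply: is_partial_ext (is_partial_tG s j k Vy) => x.
  by rewrite tG_entry.
Qed.

Lemma toric_christoffel c a e y : V y ->
  christoffel g c a e y = toric_chr c a e (base y).
Proof.
move=> Vy; rewrite /christoffel.
under eq_bigr do rewrite toric_inverse // !toric_dmetric //.
rewrite big_sumType; set x := base y.
have Px s : P s x != 0 by exact: P_neq0.
case: c => [w|j] /=.
  rewrite [X in _ + X]big1 ?addr0 => [|l _]; last by rewrite mul0r.
  pose F v := P w x * (dmetric a (inl v) e x + dmetric e (inl v) a x - dmetric (inl v) a e x).
  rewrite (eq_bigr (fun v => (w == v)%:R * F v)) => [|v _]; last by rewrite /F mulrA.
  rewrite (sum_delta w F) /F.
  case: a e {F} => [s|i] [u|k] /=.
  - case: (eqVneq w u) => [<-|wu]; case: (eqVneq w s) => [<-|ws];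
      rewrite ?eqxx //=.
    + by field; rewrite Px.
    + by field; rewrite !Px.
    + by rewrite (negPf wu) /=; field; rewrite !Px.
    + by case: eqP => [->|_] /=; field; rewrite !Px.
  - by ring.
  - by ring.
  - by ring.
rewrite big1 ?add0r => [|v _]; last by rewrite mul0r.
case: a e => [s|i] [u|k] /=.
- by rewrite big1 ?mulr0 // => l _; ring.
- rewrite -(tHGd s Vy) /fmul; congr (_ * _).
  by apply: eq_bigr => l _; rewrite addr0 subr0.
- rewrite -(tHGd u Vy) /fmul; congr (_ * _).
  by apply: eq_bigr => l _; rewrite add0r subr0.
- by rewrite big1 ?mulr0 // => l _; ring.
Qed.

Lemma partial_chrl s c a e y : V y ->
  partial (inl s) (christoffel g c a e) y = partial s (toric_chr c a e) (base y).
Proof. by move=> Vy; apply: partial_onl => // z Vz; exact: toric_christoffel. Qed.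

Lemma partial_chrr j c a e y : V y -> partial (inr j) (christoffel g c a e) y = 0.
Proof.
by move=> Vy; apply: (@partial_onr _ (toric_chr c a e)) => // z Vz; exact: toric_christoffel.
Qed.

(** * Ricci and scalar curvature *)

(** The derivative along [s] of the logarithm of the full Riemannian density, the square root of
    [det G] over the product of the [P u]; it is the contracted Christoffel symbol. *)
Definition log_vol (s : S) (x : S -> R) : R :=
  2^-1 * (Kt s x - (q s s x + \sum_(u | u != s) q s u x)).

Lemma chr_tracel s x : U x -> \sum_c toric_chr c c (inl s) x = log_vol s x.
Proof.
move=> Ux; rewrite big_sumType /= -!mulr_sumr -[X in _ + _ * X]/(ftr (tX s x)).
rewrite tr_tX // tr_frame_dG // (bigD1 s) //= eqxx.
rewrite (eq_bigr (fun u => - q s u x)) => [|u us]; last first.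
  by rewrite eqxx (negPf us) /=; ring.
by rewrite sumrN /log_vol /=; field; rewrite P_neq0.
Qed.

Lemma frame_conn_diff s u v x : U x -> pdiff s (E s u v) x.
Proof.
move=> Ux; rewrite /E; case: eqP => _; case: eqP => _; try exact: pdiff_cst.
- by apply: pdiffM; [exact: pdiff_cst|exact: b_diff].
- by apply: pdiffN; exact: q_diff.
- by case: eqP => _; [apply: pdiffN; exact: q_diff|exact: pdiff_cst].
Qed.

Lemma frame_dG_diff s u v x : U x -> pdiff s (K s u v) x.
Proof.
move=> Ux; have PD w : pdiff s (P w) x by exact: is_partial_pdiff (dP s w Ux).
rewrite /K; apply: pdiffD; last exact: frame_conn_diff.
apply: pdiffD; last by apply: pdiffM; [exact: pdiff_cst|exact: q_diff].
apply: pdiffM; last by apply: pdiffV; rewrite ?P_neq0.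
by apply: pdiffM => //; exact: frame_conn_diff.
Qed.

Lemma tX_diff s j k x : U x -> pdiff s (fun x => tX s x j k) x.
Proof.
move=> Ux; apply: pdiff_fmul => [a c|]; first exact: N_diff.
apply: pdiff_fmul => a c; first exact: frame_dG_diff.
exact: is_partial_pdiff (dD s a c Ux).
Qed.

(** The entries of [tX s] are only known to be differentiable; their sum is known near [x], because
    the trace of [tX s] is [Kt s] there. *)
Lemma trace_dX s x : U x ->
  \sum_j partial s (fun x => tX s x j j) x = partial s (Kt s) x.
Proof.
move=> Ux; apply/esym/is_partialE.
apply: is_partial_near; last first.
  by apply: is_partial_sum => j _; apply/pdiffP/tX_diff.
apply: filterS (U_open s Ux) => z Uz.
by rewrite -[RHS]/(ftr (tX s _)) tr_tX // tr_frame_dG.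
Qed.

(** Differentiating [d_s G = G * X_s] once more keeps [G] as a left factor, which the inverse block
    removes under the trace. *)
Lemma is_partial_tGd s j k x : U x -> is_partial s (fun x => tGd s x j k) x
  (fmul (tGd s x) (tX s x) j k
   + fmul (tG x) (fun j k => partial s (fun x => tX s x j k) x) j k).
Proof.
move=> Ux; apply: is_partial_near; last first.
  apply: (@is_partial_fmul _ _ _ s tG (tX s)) => a c; first exact: is_partial_tG.
  exact/pdiffP/tX_diff.
by apply: filterS (U_open s Ux) => z Uz; rewrite tGX.
Qed.

Lemma sum_tH x M : \sum_j \sum_k tH x j k * M j k = ftr (fmul (tH x) M).
Proof.
rewrite exchange_big; apply: eq_bigr => j _; apply: eq_bigr => k _.
by rewrite tH_sym.
Qed.

(** The trace of [X_s ^ 2] drops out: the derivative of the Christoffel symbols gives it the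
    coefficient [- 1/2], and each of the two quadratic terms gives [1/4]. *)
Lemma sum_ricci_tt y : V y -> let x := base y in
  \sum_j \sum_k tH x j k * ricci g (inr j) (inr k) y =
  \sum_s P s x * - (2^-1 * (q s s x * Kt s x + partial s (Kt s) x + log_vol s x * Kt s x)).
Proof.
move=> Vy x.
pose DX s j k := partial s (fun x => tX s x j k) x.
have R1 j k : ricci g (inr j) (inr k) y = \sum_s P s x *
   (- 2^-1 * (q s s x * tGd s x j k + fmul (tGd s x) (tX s x) j k + fmul (tG x) (DX s) j k
              + log_vol s x * tGd s x j k)
    + 2^-1 ^+ 2 * (\sum_l tGd s x k l * tX s x l j + \sum_l tX s x l k * tGd s x j l)).
  rewrite /ricci big_split /= [X in _ + X](_ : _ =
    \sum_e (\sum_c toric_chr c c e x) * toric_chr e (inr j) (inr k) x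
     - \sum_c \sum_e toric_chr c (inr k) e x * toric_chr e (inr j) c x); last first.
    under eq_bigr do under eq_bigr do rewrite !toric_christoffel //.
    under eq_bigr do rewrite sumrB.
    rewrite sumrB exchange_big; congr (_ - _); apply: eq_bigr => e _.
    by rewrite mulr_suml.
  rewrite [X in _ + X + _]big1 ?addr0 => [|c _]; last by rewrite partial_chrr // oppr0.
  rewrite !big_sumType /= [X in _ + X + _]big1 ?addr0 => [|l _]; last exact: partial_chrr.
  rewrite [X in _ + (_ + X - _)]big1 ?addr0 => [|l _]; last by rewrite mulr0.
  under [X in X + _]eq_bigr do rewrite partial_chrl //.
  under [X in _ + (X - _)]eq_bigr do rewrite chr_tracel //.
  rewrite [X in _ + (_ - (X + _))](eq_bigr (fun s => - \sum_l 2^-1 * P s x * tGd s x k l * (2^-1 * tX s x l j))); last first.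
    move=> s _; rewrite big_sumType /= big1 ?add0r => [|u _]; last by rewrite mulr0.
    by rewrite -sumrN; apply: eq_bigr => l _; ring.
  rewrite [X in _ + (_ - (_ + X))](eq_bigr (fun l => - \sum_s 2^-1 * P s x * tGd s x j l * (2^-1 * tX s x l k))); last first.
    move=> l _; rewrite big_sumType /= [X in _ + X]big1 ?addr0 => [|u _]; last by rewrite mulr0.
    by rewrite -sumrN; apply: eq_bigr => s _; ring.
  rewrite !sumrN [X in _ - (_ - X)]exchange_big /= opprD !opprK -!big_split /=.
  apply: eq_bigr => s _.
  rewrite [partial _ _ _](_ : _ = - 2^-1 * (q s s x * P s x * tGd s x j k
     + P s x * (fmul (tGd s x) (tX s x) j k + fmul (tG x) (DX s) j k))); last first.
    apply: is_partialE; apply: is_partial_eq.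
      apply: is_partialM (is_partial_tGd s j k Vy).
      exact: is_partialM (is_partial_cst _ _ _) (dP s s Vy).
    by rewrite /DX; ring.
  rewrite (_ : \sum_l 2^-1 * P s x * tGd s x k l * _ =
    2^-1 ^+ 2 * P s x * \sum_l tGd s x k l * tX s x l j); last first.
    by rewrite mulr_sumr; apply: eq_bigr => l _; ring.
  rewrite (_ : \sum_l 2^-1 * P s x * tGd s x j l * _ =
    2^-1 ^+ 2 * P s x * \sum_l tX s x l k * tGd s x j l); last first.
    by rewrite mulr_sumr; apply: eq_bigr => l _; ring.
  by ring.
under eq_bigr do under eq_bigr do rewrite R1 mulr_sumr.
under eq_bigr do rewrite exchange_big /=.
rewrite exchange_big /=; apply: eq_bigr => s _.
have S1 : \sum_j \sum_k tH x j k * tGd s x j k = Kt s x.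
  by rewrite sum_tH tHGd // tr_tX // tr_frame_dG.
have S2 : \sum_j \sum_k tH x j k * fmul (tGd s x) (tX s x) j k = ftr (fmul (tX s x) (tX s x)).
  by rewrite sum_tH fmulA tHGd.
have S3 : \sum_j \sum_k tH x j k * fmul (tG x) (DX s) j k = partial s (Kt s) x.
  by rewrite sum_tH fmulA (fmul1l _ (tHG Vy)) -trace_dX.
have S4 : \sum_j \sum_k tH x j k * (\sum_l tGd s x k l * tX s x l j)
   = ftr (fmul (tX s x) (tX s x)).
  rewrite -S2 exchange_big; apply: eq_bigr => j _; apply: eq_bigr => k _.
  by rewrite tH_sym.
have S5 : \sum_j \sum_k tH x j k * (\sum_l tX s x l k * tGd s x j l)
   = ftr (fmul (tX s x) (tX s x)).
  rewrite -S2; apply: eq_bigr => j _; apply: eq_bigr => k _; congr (_ * _).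
  by apply: eq_bigr => l _; rewrite mulrC.
transitivity (P s x * (- 2^-1 * (q s s x * Kt s x + ftr (fmul (tX s x) (tX s x))
  + partial s (Kt s) x + log_vol s x * Kt s x) + 2^-1 ^+ 2 *
   (ftr (fmul (tX s x) (tX s x)) + ftr (fmul (tX s x) (tX s x))))); last by field.
have sumHD (F G : T -> T -> R) : \sum_j \sum_k tH x j k * (F j k + G j k) =
   \sum_j \sum_k tH x j k * F j k + \sum_j \sum_k tH x j k * G j k.
  rewrite -big_split; apply: eq_bigr => j _; rewrite -big_split.
  by apply: eq_bigr => k _; rewrite mulrDr.
have sumHZ l (F : T -> T -> R) : \sum_j \sum_k tH x j k * (l * F j k) =
   l * (\sum_j \sum_k tH x j k * F j k).
  rewrite mulr_sumr; apply: eq_bigr => j _; rewrite mulr_sumr.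
  by apply: eq_bigr => k _; rewrite mulrCA.
by rewrite sumHZ sumHD !sumHZ !sumHD !sumHZ S1 S2 S3 S4 S5.
Qed.

(** The inverse metric is diagonal on the base, so only these entries are traced. The base
    derivatives with [w != s] follow from [dq], the one with [w = s] is a difference of equal terms,
    and the torus directions enter through the derivative of [Kt s] and the trace of [X_s ^ 2]. *)
Lemma ricci_ss s y : V y -> let x := base y in
  ricci g (inl s) (inl s) y =
  \sum_(w | w != s)
    (2^-1 * P w x / P s x * (q w w x * q w s x - 2 * b w x * q w s x)
     + 2^-1 * (q s w x ^+ 2 - 2 * b s x * q s w x)
     + 2^-1 * log_vol w x * P w x * q w s x / P s x
     - 2^-1 ^+ 2 * q s w x ^+ 2 + 2^-1 * q w s x ^+ 2 * P w x / P s x)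
  - 2^-1 * partial s (Kt s) x - 2^-1 * log_vol s x * q s s x
  - 2^-1 ^+ 2 * q s s x ^+ 2 - 2^-1 ^+ 2 * ftr (fmul (tX s x) (tX s x)).
Proof.
move=> Vy x.
have Px u : P u x != 0 by exact: P_neq0.
rewrite /ricci [X in _ + X](_ : _ =
  \sum_e (\sum_c toric_chr c c e x) * toric_chr e (inl s) (inl s) x
   - \sum_c \sum_e toric_chr c (inl s) e x * toric_chr e (inl s) c x); last first.
  under eq_bigr do under eq_bigr do rewrite !toric_christoffel //.
  under eq_bigr do rewrite sumrB.
  rewrite sumrB exchange_big; congr (_ - _); apply: eq_bigr => e _.
  by rewrite mulr_suml.
have -> : \sum_e (\sum_c toric_chr c c e x) * toric_chr e (inl s) (inl s) x =
  - 2^-1 * log_vol s x * q s s x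
  + \sum_(w | w != s) 2^-1 * log_vol w x * P w x * q w s x / P s x.
  rewrite big_sumType /= [X in _ + X]big1 ?addr0 => [|l _]; last by rewrite mulr0.
  under eq_bigr do rewrite chr_tracel //.
  rewrite (bigD1 s) //= eqxx /=; congr (_ + _); first by field; rewrite Px.
  by apply: eq_bigr => w ws; rewrite (negPf ws) /=; field; rewrite Px.
have -> : \sum_c \sum_e toric_chr c (inl s) e x * toric_chr e (inl s) c x =
  2^-1 ^+ 2 * q s s x ^+ 2 + \sum_(w | w != s)
     (2^-1 ^+ 2 * q s w x ^+ 2 - 2^-1 * q w s x ^+ 2 * P w x / P s x)
  + 2^-1 ^+ 2 * ftr (fmul (tX s x) (tX s x)).
  rewrite big_sumType /=; congr (_ + _); last first.
    rewrite /ftr mulr_sumr; apply: eq_bigr => j _.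
    rewrite big_sumType /= big1 ?add0r => [|v _]; last by rewrite mulr0.
    by rewrite mulr_sumr; apply: eq_bigr => k _; ring.
  rewrite (bigD1 s) //= big_sumType /= [X in _ + X + _]big1 ?addr0 => [|l _]; last by rewrite mul0r.
  rewrite (bigD1 s) //= -addrA; congr (_ + _); first by rewrite eqxx /=; field; rewrite Px.
  rewrite -big_split; apply: eq_bigr => w ws /=.
  have sw : (s == w) = false by rewrite eq_sym (negPf ws).
  rewrite big_sumType /= [X in _ + (_ + X) = _]big1 ?addr0 => [|l _]; last by rewrite mul0r.
  rewrite (bigD1 s) //= (bigD1 w) //= big1 => [|v /andP[vs vw]].
    by rewrite !eqxx (negPf ws) sw /=; field; rewrite !Px.
  have wv : (w == v) = false by rewrite eq_sym (negPf vw).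
  have sv : (s == v) = false by rewrite eq_sym (negPf vs).
  by rewrite wv (negPf ws) sv /=; ring.
have -> : \sum_c (partial c (christoffel g c (inl s) (inl s)) y
                  - partial (inl s) (christoffel g c (inl s) c) y) =
  \sum_(w | w != s)
    (2^-1 * P w x / P s x * (q w w x * q w s x - 2 * b w x * q w s x)
     + 2^-1 * (q s w x ^+ 2 - 2 * b s x * q s w x))
  - 2^-1 * partial s (Kt s) x.
  rewrite big_sumType; congr (_ + _); last first.
    rewrite -trace_dX // mulr_sumr -sumrN; apply: eq_bigr => j _.
    rewrite partial_chrr // partial_chrl // sub0r; congr (- _).
    apply: is_partialE; apply: is_partial_eq.
      by apply: is_partialM; [exact: is_partial_cst|exact/pdiffP/tX_diff].
    by rewrite mul0r add0r.
  under eq_bigr do rewrite !partial_chrl //.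
  rewrite -/x (bigD1 s) //= subrr add0r; apply: eq_bigr => w ws.
  have sw : (s == w) = false by rewrite eq_sym (negPf ws).
  rewrite -[in RHS](opprK (2^-1 * (q s w x ^+ 2 - _))); congr (_ - _).
    apply: is_partialE.
    apply: (@is_partial_ext _ _ _ (fun x => 2^-1 * (P w x * q w s x / P s x))) => [z|].
      by rewrite /= (negPf ws) eqxx /=; ring.
    apply: is_partial_eq.
      apply: is_partialM; first exact: is_partial_cst.
      apply: is_partialM; last exact: is_partialV (Px s) (dP w s Vy).
      by apply: is_partialM; [exact: dP|exact: dq].
    by rewrite -/x /=; field; rewrite Px.
  apply: is_partialE.
  apply: (@is_partial_ext _ _ _ (fun x => - 2^-1 * q s w x)) => [z|].
    by rewrite /= (negPf ws) eqxx sw /=; ring.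
  apply: is_partial_eq.
    apply: is_partialM; first exact: is_partial_cst.
    by apply: dq => //; rewrite sw.
  by rewrite -/x /=; ring.
set S1 := \sum_(w | _) (2^-1 * P w x / P s x * _ + _).
set S2 := \sum_(w | _) (2^-1 * log_vol w x * P w x * q w s x / P s x).
set S3 := \sum_(w | _) (2^-1 ^+ 2 * q s w x ^+ 2 - _).
rewrite [X in _ = X - _ - _ - _ - _](_ : _ = S1 + S2 - S3).
  move: (partial _ _ _) (log_vol s x) (ftr _) S1 S2 S3 => a c e S1 S2 S3.
  by ring.
rewrite /S1 /S2 /S3 -big_split -sumrB; apply: eq_bigr => w _ /=.
move: (log_vol w x) => lw; ring.
Qed.

(** After multiplication by [P_s] the squares of the off-diagonal [q] cancel between the base part
    and the trace of [frame_dG s] squared. What remains off the diagonal is, once the two summation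
    indices are exchanged, a multiple of [\sum_(w | w != s) q s w], which is
    [q s s - Kt s - 4 * b s]. *)
Theorem toric_scalar_curvature y : V y -> let x := base y in
  scalar_curvature g y =
  - \sum_s P s x * (partial s (Kt s) x + Kt s x ^+ 2 + 2 * b s x * Kt s x).
Proof.
move=> Vy x; have Px u : P u x != 0 by exact: P_neq0.
have -> : scalar_curvature g y = \sum_s P s x * ricci g (inl s) (inl s) y +
    \sum_j \sum_k tH x j k * ricci g (inr j) (inr k) y.
  rewrite /scalar_curvature; under eq_bigr do under eq_bigr do rewrite toric_inverse //.
  rewrite big_sumType; congr (_ + _); apply: eq_bigr => s _; rewrite big_sumType /=.
    rewrite [X in _ + X]big1 ?addr0 => [|l _]; last by rewrite mul0r.
    under eq_bigr do rewrite -mulrA.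
    by rewrite (sum_delta s (fun u => P s x * ricci g (inl s) (inl u) y)).
  by rewrite big1 ?add0r // => u _; rewrite mul0r.
rewrite sum_ricci_tt // -/x.
pose lv s := log_vol s x.
(* [C1 s w] is carried by [P_s] but arises in the Ricci entry of [w]; it therefore appears
   transposed in [R1] and is moved back by the exchange in [R2]. *)
pose C1 s w := P s x * (2^-1 * (q s s x * q s w x - 2 * b s x * q s w x)
  + 2^-1 * lv s * q s w x).
pose C2 s w := - (P s x * b s x * q s w x).
have R1 s : P s x * ricci g (inl s) (inl s) y =
  \sum_(w | w != s) (C1 w s + 2^-1 * P w x * q w s x ^+ 2 - 2^-1 * q w s x ^+ 2 * P w x + C2 s w)
  + P s x * (- 2^-1 * partial s (Kt s) x - 2^-1 * lv s * q s s x
  - 2^-1 ^+ 2 * q s s x ^+ 2 - 2^-1 ^+ 2 * (q s s x - 4 * b s x) ^+ 2).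
  rewrite ricci_ss // -/x tr_tX2 // tr_frame_dG2 // -/(lv s).
  set F := \sum_(w | _) _; set H := \sum_(u | _) _.
  transitivity (P s x * F - 2^-1 ^+ 2 * P s x * H
    + P s x * (- 2^-1 * partial s (Kt s) x - 2^-1 * lv s * q s s x
     - 2^-1 ^+ 2 * q s s x ^+ 2 - 2^-1 ^+ 2 * (q s s x - 4 * b s x) ^+ 2)).
    by move: (partial _ _ _) F H => dK F H; ring.
  congr (_ + _); rewrite /F /H !mulr_sumr -sumrB; apply: eq_bigr => w _.
  by rewrite /C1 /C2 -/(lv w); move: (lv w) => l; field; rewrite Px.
have R2 : \sum_s P s x * ricci g (inl s) (inl s) y = \sum_s
   (\sum_(w | w != s) (C1 s w + C2 s w)
  + P s x * (- 2^-1 * partial s (Kt s) x - 2^-1 * lv s * q s s x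
  - 2^-1 ^+ 2 * q s s x ^+ 2 - 2^-1 ^+ 2 * (q s s x - 4 * b s x) ^+ 2)).
  under eq_bigr do rewrite R1.
  rewrite big_split [RHS]big_split; congr (_ + _) => /=.
  transitivity (\sum_s \sum_(w | w != s) (C1 w s + C2 s w)).
    apply: eq_bigr => s _; apply: eq_bigr => w _.
    by move: (C1 _ _) (C2 _ _) => c1 c2; ring.
  have split2 (F G : S -> S -> R) : \sum_s \sum_(w | w != s) (F s w + G s w) =
      \sum_s \sum_(w | w != s) F s w + \sum_s \sum_(w | w != s) G s w.
    by rewrite -big_split; apply: eq_bigr => s _; rewrite -big_split.
  rewrite (split2 (fun s w => C1 w s) C2) (split2 C1 C2); congr (_ + _).
  rewrite (exchange_big_dep xpredT) //=; apply: eq_bigr => s _.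
  by apply: eq_bigl => w; rewrite eq_sym.
rewrite R2 -big_split -sumrN; apply: eq_bigr => s _ /=.
rewrite (_ : \sum_(w | w != s) _ = P s x * (2^-1 * q s s x - 2 * b s x + 2^-1 * lv s)
   * \sum_(w | w != s) q s w x); last first.
  by rewrite mulr_sumr; apply: eq_bigr => w _; rewrite /C1 /C2; move: (lv s) => l; field.
rewrite -[log_vol s x]/(lv s).
have -> : lv s = Kt s x - q s s x + 2 * b s x.
  by rewrite /lv /log_vol /Kt; move: (\sum_(u | _) _) => Q; field.
have -> : \sum_(w | w != s) q s w x = q s s x - Kt s x - 4 * b s x.
  by rewrite /Kt; move: (\sum_(u | _) _) => Q; ring.
by move: (partial _ _ _) (Kt s x) => dK k; field.
Qed.

(** * Killing potentials *)

(** The gradient has the components [P_s * \sum_j k_j D_sj] on the base, and [J] acts on them by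
    [N / P] up to sign; since [N] inverts [D], the rotated field has the constant torus components
    [k]. *)
Lemma toric_killing_potential (J : (S + T)%type -> (S + T)%type -> ((S + T)%type -> R) -> R)
    (F : ((S + T)%type -> R) -> R) (f : (S -> R) -> R) (k : T -> R) :
  (forall s u y, V y -> J (inl s) (inl u) y = 0) ->
  (forall i s y, V y -> J (inr i) (inl s) y = - N i s (base y) / P s (base y)) ->
  (forall y, V y -> F y = f (base y)) ->
  (forall s x, U x -> partial s f x = \sum_j k j * D s j x) ->
  killing_potential [set y | V y] g J F.
Proof.
move=> J0 J1 Ff df; rewrite /killing_potential.
set X := complex_rotate J _.
have gradl s y : V y -> gradient g F (inl s) y = P s (base y) * \sum_j k j * D s j (base y).
  move=> Vy; rewrite /gradient; under eq_bigr do rewrite toric_inverse //.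
  rewrite big_sumType /= [X in _ + X]big1 ?addr0 => [|l _]; last by rewrite mul0r.
  under eq_bigr do rewrite -mulrA.
  rewrite (sum_delta s (fun u => P s (base y) * partial (inl u) F y)).
  by rewrite (partial_onl s Vy Ff) df.
have gradr j y : V y -> gradient g F (inr j) y = 0.
  move=> Vy; rewrite /gradient; under eq_bigr do rewrite toric_inverse //.
  rewrite big_sumType /= !big1 ?addr0 // => [l _|s _]; last by rewrite mul0r.
  by rewrite (partial_onr l Vy Ff) mulr0.
pose kk (c : (S + T)%type) : R := if c is inr i then k i else 0.
have Xk c y : V y -> X c y = kk c.
  move=> Vy; rewrite /X /complex_rotate big_sumType /=.
  rewrite [X in _ + X]big1 ?addr0 => [|j _]; last by rewrite gradr // mulr0.
  case: c => [s|i] /=; first by rewrite big1 ?oppr0 // => u _; rewrite J0 // mul0r.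
  transitivity (\sum_s \sum_j k j * (N i s (base y) * D s j (base y))).
    rewrite -sumrN; apply: eq_bigr => s _; rewrite J1 // gradl //.
    rewrite mulNr mulNr opprK mulrA mulfVK ?P_neq0 // mulr_sumr.
    by apply: eq_bigr => j _; rewrite mulrCA.
  rewrite exchange_big -[RHS](sum_delta i); apply: eq_bigr => j _.
  by rewrite -mulr_sumr ND // mulrC.
move=> y Vy a c; rewrite /lie_derivative big1 // => e _.
have dX a' : partial a' (X e) y = 0.
  case: a' => [s|i]; last by rewrite (@partial_onr _ (fun=> kk e)) // => z; exact: Xk.
  rewrite (@partial_onl _ (fun=> kk e)) // => [|z]; last exact: Xk.
  exact/is_partialE/is_partial_cst.
rewrite !dX !mulr0 !addr0 Xk // toric_dmetric //.
by case: e {dX} => [s|i]; rewrite /= ?mul0r ?mulr0.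
Qed.

End OrthogonalToric.

(** * Multi-affine functions and tensors *)

Section Multiaffine.
Context {R : realType} {C : finType}.
Implicit Types (F G : (C -> R) -> R) (x : C -> R).
Local Notation upd := (@dfwith C (fun=> R)).

(** An algebraic form of the partial derivative, exact on multi-affine functions: identities between
    derivatives become identities between values at [0] and [1]. *)
Definition slope c F x : R := F (upd x c 1) - F (upd x c 0).

Definition multiaffine F : Prop :=
  forall c x z, F (upd x c z) = F (upd x c 0) + z * slope c F x.

Lemma upd_upd x c z w : upd (upd x c z) c w = upd x c w.
Proof.
apply/funext => a; have [->|ac] := eqVneq c a; first by rewrite !dfwithin.
by rewrite !(dfwithout _ _ ac).
Qed.

Lemma upd_comm x c a z w : c != a -> upd (upd x c z) a w = upd (upd x a w) c z.
Proof.
move=> ca; apply/funext => e.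
have [<-|ce] := eqVneq c e.
  by rewrite dfwithin dfwithout ?dfwithin // eq_sym.
have [<-|ae] := eqVneq a e; first by rewrite dfwithin dfwithout ?dfwithin.
by rewrite (dfwithout _ _ ae) !(dfwithout _ _ ce) (dfwithout _ _ ae).
Qed.

Lemma slope_upd c F x z : slope c F (upd x c z) = slope c F x.
Proof. by rewrite /slope !upd_upd. Qed.

Lemma slopeC c a F x : c != a -> slope c (slope a F) x = slope a (slope c F) x.
Proof. by move=> ca; rewrite /slope !(upd_comm x _ _ ca); ring. Qed.

Lemma slopeD c F G x : slope c (fun y => F y + G y) x = slope c F x + slope c G x.
Proof. by rewrite /slope; ring. Qed.

Lemma slope_indep c F : (forall x z, F (upd x c z) = F x) -> slope c F = fun=> 0.
Proof. by move=> H; apply/funext => x; rewrite /slope !H subrr. Qed.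

Lemma slope0 c : slope c (fun=> 0) = fun=> 0.
Proof. exact: slope_indep. Qed.

Lemma multiaffine_slope c F : multiaffine F -> multiaffine (slope c F).
Proof.
move=> mF a x z; have [<-|ca] := eqVneq c a.
  by rewrite /slope !upd_upd subrr mulr0 addr0.
rewrite eq_sym in ca; rewrite /slope !(upd_comm x _ _ ca).
by rewrite (mF a (upd x c 1) z) (mF a (upd x c 0) z) /slope; ring.
Qed.

Lemma multiaffine_is_partial c F x : multiaffine F -> is_partial c F x (slope c F x).
Proof.
move=> mF.
have H : is_partial c (fun y => F (upd x c 0) + y c * slope c F x) x (slope c F x).
  apply: is_partial_eq.
    apply: is_partialD; first exact: is_partial_cst.
    apply: is_partialM; last exact: is_partial_cst.
    exact: (@is_partial_coord _ _ _ id x 1 (is_derive_id _ _)).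
  by rewrite mulr0 addr0 mul1r add0r.
apply: is_partial_near H; near=> z.
by rewrite mF dfwithin.
Unshelve. all: by end_near. Qed.

Lemma multiaffineD F G : multiaffine F -> multiaffine G ->
  multiaffine (fun x => F x + G x).
Proof. by move=> mF mG c x z; rewrite slopeD mF mG; ring. Qed.

Lemma multiaffineMr F (a : R) : multiaffine F -> multiaffine (fun x => F x * a).
Proof. by move=> mF c x z; rewrite mF /slope; ring. Qed.

Lemma multiaffine_sum (J : Type) (s : seq J) (F : J -> (C -> R) -> R) :
  (forall j, multiaffine (F j)) -> multiaffine (fun x => \sum_(j <- s) F j x).
Proof.
move=> mF; elim: s => [|j s IH].
  by move=> c x z; rewrite /slope !big_nil subrr mulr0 addr0.
have -> : (fun x => \sum_(j <- j :: s) F j x) = fun x => F j x + \sum_(j <- s) F j x.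
  by apply/funext => y; rewrite big_cons.
exact: multiaffineD.
Qed.

Lemma multiaffine_prod (h : C -> R -> R) :
  (forall c z, h c z = h c 0 + z * (h c 1 - h c 0)) ->
  multiaffine (fun x => \prod_c h c (x c)).
Proof.
move=> Hh c x z; rewrite /slope.
have E w : \prod_a h a (upd x c w a) = h c w * \prod_(a | a != c) h a (x a).
  rewrite (bigD1 c) //= dfwithin; congr (_ * _).
  by apply: eq_bigr => a ac; rewrite dfwithout // eq_sym.
by rewrite !E Hh; ring.
Qed.

End Multiaffine.

(** * Pairings with product tensors, symmetric tensors *)

Section TensorPairing.
Context {R : realType} {T : finType}.
Implicit Types (v : T -> 'rV[R]_2) (S : tensors R T).

Lemma tensor_pairing_linear v : linear (tensor_pairing v : tensors R T -> R^o).
Proof.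
move=> a S S'; rewrite /tensor_pairing scaler_sumr -big_split.
apply: eq_bigr => sigma _; rewrite !ffunE /= /GRing.scale /=; ring.
Qed.

HB.instance Definition _ v :=
  GRing.isLinear.Build R (tensors R T) R^o _ (tensor_pairing v) (tensor_pairing_linear v).

Lemma tensor_pairing_decomposable v (w : T -> 'rV[R]_2) :
  tensor_pairing v (decomposable w) = \prod_t \sum_j v t 0 j * w t 0 j.
Proof.
rewrite (bigA_distr_bigA (fun t j => v t 0 j * w t 0 j)).
by apply: eq_bigr => sigma _; rewrite ffunE -big_split.
Qed.

Lemma sum_vec2 (a b a' b' : R) :
  \sum_j vec2 a b 0 j * vec2 a' b' 0 j = a * a' + b * b'.
Proof. by rewrite big_ord_recl big_ord1 !mxE /=. Qed.

End TensorPairing.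

Section SymTensors.
Context {R : realType} {p : nat}.
Implicit Types (S : tensors R 'I_p).

Lemma sym_tensorsP S : reflect (forall s, permute_factors s S = S) (S \in sym_tensors R p).
Proof.
apply: (iffP subv_bigcapP) => [H s|H s _].
  by have := H s isT; rewrite -memvE => /fixedSpaceP; rewrite lfunE.
rewrite -memvE; apply/fixedSpaceP; rewrite lfunE. exact: H.
Qed.

Lemma decomposable_sym (w : 'rV[R]_2) : decomposable (fun _ : 'I_p => w) \in sym_tensors R p.
Proof.
apply/sym_tensorsP => s; apply/ffunP => sigma; rewrite !ffunE.
rewrite [RHS](reindex_inj (@perm_inj _ s)).
by apply: eq_bigr => r _; rewrite ffunE.
Qed.

(* The derivative of the [p]-th power of [w] in the direction [v]. *)
Definition polarized (w v : 'rV[R]_2) : tensors R 'I_p :=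
  \sum_r decomposable (fun t => if t == r then v else w).

Lemma polarized_sym w v : polarized w v \in sym_tensors R p.
Proof.
apply/sym_tensorsP => s; rewrite /polarized linear_sum.
rewrite [RHS](reindex_inj (@perm_inj _ s)).
apply: eq_bigr => r _; apply/ffunP => sigma; rewrite !ffunE.
rewrite [RHS](reindex_inj (@perm_inj _ s)).
by apply: eq_bigr => t _; rewrite ffunE (inj_eq perm_inj).
Qed.

Lemma tensor_pairing_perm (v : 'I_p -> 'rV[R]_2) S (s : 'S_p) : S \in sym_tensors R p ->
  tensor_pairing (v \o s) S = tensor_pairing v S.
Proof.
move=> /sym_tensorsP symS; rewrite /tensor_pairing.
pose h (sigma : {ffun 'I_p -> 'I_2}) : {ffun 'I_p -> 'I_2} := [ffun r => sigma (s r)].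
have hinj : injective h.
  move=> f f' /ffunP e; apply/ffunP => r.
  by have := e (s^-1%g r); rewrite !ffunE permKV.
rewrite (reindex_inj hinj); apply: eq_bigr => sigma _; congr (_ * _).
  rewrite [RHS](reindex_inj (@perm_inj _ s)).
  by apply: eq_bigr => r _; rewrite ffunE.
by rewrite -[in RHS](symS s) ffunE.
Qed.

End SymTensors.

(** * The functions [mu alpha] and the generators of the factorization space *)

Section Mu.
Context {R : realType} {n : nat} (d : 'I_n.+3 -> nat) (pi1 pi2 : R).
Local Notation tensor := (tensors R (slot d)).
Local Notation L z := (pi1 + pi2 * z).
Local Notation h := (factorization_space d pi1 pi2).
Implicit Types (x : slot d -> R) (alpha : tensor) (s u : slot d).

Lemma big_slot (V : Type) (idx : V) (op : Monoid.com_law idx) (i : 'I_n.+3)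
    (F : slot d -> V) :
  \big[op/idx]_(s | tag s == i) F s = \big[op/idx]_(r < d i) F (Slot r).
Proof.
have := sig_big_dep (op := op) (pred1 i) (fun i => xpredT) (fun i (r : 'I_(d i)) => F (Slot r)).
rewrite big_pred1_eq => ->; apply: eq_big => [s|[j r] _] //.
by rewrite andbT.
Qed.

Lemma mu_linear x : linear (fun alpha : tensor => mu alpha x : R^o).
Proof. exact: tensor_pairing_linear. Qed.

Lemma muD alpha alpha' x : mu (alpha + alpha') x = mu alpha x + mu alpha' x.
Proof. by have := mu_linear x 1 alpha alpha'; rewrite !scale1r. Qed.

Lemma muZ (a : R) alpha x : mu (a *: alpha) x = a * mu alpha x.
Proof.
rewrite /mu /tensor_pairing mulr_sumr; apply: eq_bigr => sigma _.
by rewrite ffunE mulrCA.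
Qed.

Lemma mu0 x : mu (0 : tensor) x = 0.
Proof. by rewrite -(scale0r (0 : tensor)) muZ mul0r. Qed.

Lemma mu_sum (J : Type) (r : seq J) (Q : pred J) (F : J -> tensor) x :
  mu (\sum_(j <- r | Q j) F j) x = \sum_(j <- r | Q j) mu (F j) x.
Proof.
by apply: (big_morph (fun alpha => mu alpha x)) => [a b|]; [exact: muD|exact: mu0].
Qed.

Lemma multiaffine_mu alpha : multiaffine (mu alpha).
Proof.
apply: multiaffine_sum => sigma; apply: multiaffineMr.
apply: (multiaffine_prod (h := fun s z => vec2 1 z 0 (sigma s))) => s z.
by rewrite !mxE; case: ifP => _; ring.
Qed.

Lemma mu_decomposable (w : slot d -> 'rV[R]_2) x :
  mu (decomposable w) x = \prod_s (w s 0 0 + x s * w s 0 1).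
Proof.
rewrite /mu tensor_pairing_decomposable; apply: eq_bigr => s _.
rewrite big_ord_recl big_ord1 !mxE /= mul1r; congr (_ + _ * w _ _ _).
exact: val_inj.
Qed.

Lemma prod_Gamma i x :
  \prod_(s | tag s != i) (\sum_j vec2 1 (x s) 0 j * Gamma pi1 pi2 i s 0 j)
  = cfactor pi1 pi2 i x.
Proof.
rewrite /cfactor /Gamma; case: (eqVneq i ord_max) => [->|_] /=; last first.
  by rewrite big1 // => s _; rewrite sum_vec2; ring.
rewrite -(big_slot _ ord0 (fun s => L (x s))) (bigID (fun s => tag s == ord0)) /=.
rewrite [X in _ * X]big1 ?mulr1 => [|s /andP[_ /negPf ->]]; last by rewrite sum_vec2; ring.
rewrite (eq_bigl (fun s => tag s == ord0)) => [|s]; last first.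
  by case: eqP => [->|]; rewrite ?andbF.
by apply: eq_bigr => s ->; rewrite sum_vec2; ring.
Qed.

Lemma mu_ins i (S : tensors R 'I_(d i)) x :
  mu (ins pi1 pi2 S) x =
  cfactor pi1 pi2 i x * tensor_pairing (fun r => vec2 1 (x (Slot r))) S.
Proof.
rewrite -prod_Gamma /mu {1}/tensor_pairing.
(* [S] is expanded in unit tensors. Inserting the one at [tau] gives a product tensor with the
   factor [W tau s] in the slot [s], so the sum over [sigma] splits into a product over the
   slots. *)
pose W (tau : {ffun 'I_(d i) -> 'I_2}) s (j : 'I_2) : R :=
  if tag s == i then untag 0 (fun r => (j == tau r)%:R) s else Gamma pi1 pi2 i s 0 j.
transitivity (\sum_tau S tau * \sum_(sigma : {ffun slot d -> 'I_2})
   \prod_s (vec2 1 (x s) 0 (sigma s) * W tau s (sigma s))).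
  under [RHS]eq_bigr do rewrite mulr_sumr.
  rewrite exchange_big; apply: eq_bigr => sigma _ /=.
  under [RHS]eq_bigr do rewrite big_split /= mulrCA.
  rewrite -mulr_sumr; congr (_ * _); rewrite ffunE.
  have WE tau : \prod_s W tau s (sigma s) = ([ffun r => sigma (Slot r)] == tau)%:R *
      \prod_(s | tag s != i) Gamma pi1 pi2 i s 0 (sigma s).
    rewrite (bigID (fun s => tag s == i)) /=; congr (_ * _); last first.
      by apply: eq_bigr => s /negPf si; rewrite /W si.
    rewrite (big_slot _ i (fun s => W tau s (sigma s))).
    rewrite (eq_bigr (fun r => (sigma (Slot r) == tau r)%:R)) => [|r _]; last first.
      by rewrite /W eqxx (@untagE _ _ _ _ i _ (Slot r) erefl).
    case: eqP => [<-|ne]; first by rewrite big1 // => r _; rewrite ffunE eqxx.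
    have [r /eqP nr] : exists r, sigma (Slot r) <> tau r.
      apply: contrapT => /forallNP H; apply: ne; apply/ffunP => r.
      by rewrite ffunE; apply: contrapT; exact: H.
    by rewrite (bigD1 r) //= (negPf nr) mul0r.
  under [RHS]eq_bigr do rewrite WE mulrCA.
  by rewrite (sum_delta [ffun r => sigma (Slot r)] (fun tau => S tau * _)).
rewrite [X in _ * X]/tensor_pairing mulr_sumr; apply: eq_bigr => tau _.
rewrite -(bigA_distr_bigA (fun s j => vec2 1 (x s) 0 j * W tau s j)).
rewrite (bigID (fun s => tag s == i)) /= [RHS]mulrA [RHS]mulrC; congr (_ * _).
rewrite mulrC; congr (_ * _).
  by apply: eq_bigr => s /negPf si; rewrite /W si.
rewrite (big_slot _ i (fun s => \sum_j vec2 1 (x s) 0 j * W tau s j)).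
apply: eq_bigr => r _; rewrite -[RHS](sum_delta (tau r) (fun j => vec2 1 (x (Slot r)) 0 j)).
by apply: eq_bigr => j _; rewrite mulrC /W eqxx (@untagE _ _ _ _ i _ (Slot r) erefl) eq_sym.
Qed.

Lemma ins_factorization i (S : tensors R 'I_(d i)) : S \in sym_tensors R (d i) ->
  ins pi1 pi2 S \in h.
Proof.
move=> symS; apply: (subvP (sumv_sup i (P := xpredT) _ (subvv _))) => //.
by apply/memv_imgP; exists S => //; rewrite lfunE.
Qed.

Lemma factorization_ind (Q : tensor -> Prop) :
  Q 0 -> (forall a b, Q a -> Q b -> Q (a + b)) ->
  (forall i (S : tensors R 'I_(d i)), S \in sym_tensors R (d i) -> Q (ins pi1 pi2 S)) ->
  forall alpha, alpha \in h -> Q alpha.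
Proof.
move=> Q0 QD Qi alpha /memv_sumP[v vh ->]; apply: big_ind => // i _.
by have /memv_imgP[S SS ->] := vh i isT; rewrite lfunE; exact: Qi.
Qed.

End Mu.

(** * Second derivatives of the functions [mu alpha] *)

Section SecondOrder.
Context {R : realType} {n : nat} (d : 'I_n.+3 -> nat) (pi1 pi2 : R).
Local Notation tensor := (tensors R (slot d)).
Local Notation upd := (@dfwith (slot d) (fun=> R)).
Local Notation L z := (pi1 + pi2 * z).
Local Notation h := (factorization_space d pi1 pi2).
Implicit Types (x : slot d -> R) (alpha : tensor) (s u : slot d).

Lemma cfactor_max x : cfactor pi1 pi2 ord_max x = \prod_(s : slot d | tag s == ord0) L (x s).
Proof. by rewrite /cfactor eqxx -(big_slot _ ord0 (fun s => L (x s))). Qed.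

Lemma cfactor_other i x : i != ord_max -> cfactor pi1 pi2 i x = 1.
Proof. by rewrite /cfactor => /negPf ->. Qed.

Lemma tag_tperm s u v : tag s = tag u -> tag (tperm s u v) = tag v.
Proof. by move=> su; case: tpermP => [->|->|]. Qed.

Lemma cfactor_tperm i s u x : tag s = tag u ->
  cfactor pi1 pi2 i (x \o tperm s u) = cfactor pi1 pi2 i x.
Proof.
move=> su; case: (eqVneq i ord_max) => [->|ni]; last by rewrite !cfactor_other.
rewrite !cfactor_max [RHS](reindex_inj (@perm_inj _ (tperm s u))) /=.
by apply: eq_bigl => v; rewrite tag_tperm.
Qed.

(** Each summand of the space pairs a symmetric tensor with coordinates of one group, and [cfactor]
    is symmetric in the first group, so exchanging two coordinates of a group changes nothing. *)
Lemma mu_tperm alpha s u x : alpha \in h -> tag s = tag u ->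
  mu alpha (x \o tperm s u) = mu alpha x.
Proof.
move=> + su; move: alpha.
apply: factorization_ind => [|a b ea eb|i S symS]; first by rewrite !mu0.
  by rewrite !muD ea eb.
rewrite !mu_ins cfactor_tperm //; congr (_ * _).
case: s u su => j r [j' r'] /= jj'; move: r'; rewrite -{j'}jj' => r'.
have [ji|ji] := eqVneq j i.
  move: r r'; rewrite ji => r r'.
  rewrite -[RHS](tensor_pairing_perm _ (tperm r r') symS); congr tensor_pairing.
  apply/funext => t /=; congr (vec2 1 (x _)).
  rewrite -/(Slot r) -/(Slot r'); case: (tpermP r r' t) => [->|->|].
  - exact: tpermL.
  - exact: tpermR.
  - move=> /eqP tr /eqP tr'; rewrite tpermD // eq_Tagged eq_sym; [exact: tr|exact: tr'].
congr tensor_pairing; apply/funext => t /=; congr (vec2 1 (x _)).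
by rewrite tpermD // -tag_eqE /tag_eq /= (negPf ji).
Qed.

(* The logarithmic derivative of [Delta s * cfactor (tag s)] along [x u]. *)
Definition lam u s x : R :=
  if u == s then \sum_(v | (tag v == tag s) && (v != s)) (x s - x v)^-1
  else if tag u == tag s then (x u - x s)^-1
  else if (tag u == ord0) && (tag s == ord_max) then pi2 / L (x u) else 0.

Definition regular x : Prop :=
  (forall s, Delta s x != 0) /\ (forall i, cfactor pi1 pi2 i x != 0).

Lemma regular_neq x s u : regular x -> s != u -> tag s = tag u -> x s - x u != 0.
Proof.
move=> [Dx _] su tsu; apply: contraNneq (Dx s) => e.
by rewrite /Delta (bigD1 u) /= ?e ?mul0r // tsu eqxx eq_sym.
Qed.

Lemma regular_L x u : regular x -> tag u = ord0 -> L (x u) != 0.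
Proof.
move=> [_ /(_ ord_max)] + tu; rewrite cfactor_max.
by apply: contraNneq => e; rewrite (bigD1 u) /= ?e ?mul0r // tu.
Qed.

(** In the two coordinates the function is [p + q (x_s + x_u) + r x_s x_u]. Its slopes are
    [q + r x_u] and [q + r x_s], and their difference quotient is the mixed slope [r]. *)
Lemma symmetric_slope2 (F : (slot d -> R) -> R) s u x : multiaffine F -> s != u ->
  (forall y, F (y \o tperm s u) = F y) -> x s - x u != 0 ->
  slope s (slope u F) x = (x s - x u)^-1 * slope u F x + (x u - x s)^-1 * slope s F x.
Proof.
move=> mF su symF xsu; have us : u != s by rewrite eq_sym.
pose A p r := F (upd (upd x s p) u r).
have symA p r : A p r = A r p.
  rewrite /A -symF; congr F; apply/funext => v /=; case: tpermP => [->|->|/eqP vs /eqP vu].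
  - by rewrite dfwithin [RHS]dfwithout // dfwithin.
  - by rewrite dfwithout // !dfwithin.
  - by rewrite !dfwithout // eq_sym.
have A2 p r : A p r = A p 0 + r * (A p 1 - A p 0) by rewrite {1}/A mF.
have A1 p r : A p r = A 0 r + p * (A 1 r - A 0 r).
  by rewrite /A !(upd_comm x _ _ su) mF.
have Fu r : F (upd x u r) = A (x s) r by rewrite /A upd_id.
have Fs p : F (upd x s p) = A p (x u) by rewrite /A (upd_comm x _ _ su) upd_id.
rewrite {1}/slope /slope !Fu !Fs -/(A 1 1) -/(A 1 0) -/(A 0 1) -/(A 0 0).
rewrite (A1 (x s) 1) (A1 (x s) 0) (A2 1 (x u)) (A2 0 (x u)) (symA 0 1).
have xus : x u - x s != 0 by rewrite -opprB oppr_eq0.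
by field; rewrite xsu xus.
Qed.

Lemma mu_ins_indep i (S : tensors R 'I_(d i)) s x z :
  tag s != i -> ~~ ((i == ord_max) && (tag s == ord0)) ->
  mu (ins pi1 pi2 S) (upd x s z) = mu (ins pi1 pi2 S) x.
Proof.
move=> si nsi; rewrite !mu_ins; congr (_ * _).
  case: (eqVneq i ord_max) nsi => [->|ni _]; last by rewrite !cfactor_other.
  rewrite !cfactor_max /= => s0; apply: eq_bigr => v /eqP v0.
  by rewrite dfwithout //; apply: contraNneq s0 => ->; rewrite v0.
congr tensor_pairing; apply/funext => r; rewrite dfwithout //.
by apply: contraNneq si => ->.
Qed.

(** The coefficients [lam] do not depend on [alpha], so by linearity the generators [ins S] suffice.
    Inside a group the identity is the symmetry above; between the first and the last group it comes
    from the factor [cfactor] of the last summand; for other pairs both coefficients and the mixed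
    slope vanish. *)
Lemma mu_slope2 alpha s u x : alpha \in h -> regular x -> s != u ->
  slope s (slope u (mu alpha)) x =
  lam s u x * slope u (mu alpha) x + lam u s x * slope s (mu alpha) x.
Proof.
move=> ah rx su; have us : u != s by rewrite eq_sym.
have [tsu|tsu] := eqVneq (tag s) (tag u).
  rewrite /lam (negPf su) (negPf us) tsu eqxx.
  apply: symmetric_slope2 => //; [exact: multiaffine_mu| |exact: regular_neq].
  by move=> y; exact: mu_tperm.
have tus : tag u != tag s by rewrite eq_sym.
rewrite /lam (negPf su) (negPf us) (negPf tsu) (negPf tus).
move: alpha ah; apply: factorization_ind => [|a b ea eb|i S symS].
- have -> : mu (0 : tensor) = fun=> 0 by apply/funext => y; exact: mu0.
  by rewrite !slope0 !mulr0 addr0.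
- have -> : mu (a + b) = fun y => mu a y + mu b y by apply/funext => y; exact: muD.
  have -> : slope u (fun y => mu a y + mu b y) = fun y => slope u (mu a) y + slope u (mu b) y.
    by apply/funext => y; exact: slopeD.
  rewrite (slopeD s (slope u (mu a)) (slope u (mu b))) ea eb.
  by rewrite (slopeD s (mu a) (mu b)) /=; ring.
pose F := mu (ins pi1 pi2 S); rewrite -/F.
have indep v : tag v != i -> ~~ ((i == ord_max) && (tag v == ord0)) -> slope v F = fun=> 0.
  by move=> vi nvi; apply: slope_indep => y z; exact: mu_ins_indep.
(* For the last summand and [v] in the first group, the function is [L (x v)] times a function free
   of [x v]; differentiating along [v] multiplies by [pi2 / L (x v)]. *)
have mixed v w y : tag v = ord0 -> tag w = ord_max -> i = ord_max -> regular y ->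
    slope w (slope v F) y = pi2 / L (y v) * slope w F y.
  move=> v0 wm im ry.
  have vw : v != w by apply: contra_eq_neq v0 => ->; rewrite wm.
  have Lv : L (y v) != 0 by exact: regular_L.
  have Fv y' z : y' v = y v -> F (upd y' v z) = L z / L (y v) * F y'.
    move=> yv; rewrite /F !mu_ins mulrA; congr (_ * _); last first.
      congr tensor_pairing; apply/funext => r; rewrite dfwithout //.
      apply/eqP => vr; have : i = ord0 by rewrite -v0 vr.
      by rewrite im.
    move: (S) => S'; rewrite im !cfactor_max (bigD1 v) ?v0 //= dfwithin.
    rewrite [in RHS](bigD1 v) ?v0 //= yv mulrA mulfVK //; congr (_ * _).
    by apply: eq_bigr => t /andP[_ tv]; rewrite dfwithout // eq_sym.
  rewrite slopeC 1?eq_sym // {1}/slope.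
  have Fw z : slope w F (upd y v z) = L z / L (y v) * slope w F y.
    by rewrite /slope !(upd_comm y _ _ vw) !Fv ?dfwithout 1?eq_sym //; ring.
  by rewrite !Fw; field.
have [/andP[s0 um]|nsu] := boolP ((tag s == ord0) && (tag u == ord_max)).
  have -> : (tag u == ord0) && (tag s == ord_max) = false by rewrite (eqP um).
  have [im|im] := eqVneq i ord_max.
    by rewrite slopeC // (mixed s u) //; [ring|exact/eqP|exact/eqP].
  have u0 : slope u F = fun=> 0 by apply: indep; [rewrite (eqP um) eq_sym|rewrite (negPf im)].
  by rewrite u0 slope0; ring.
have [/andP[u0 sm]|nus] := boolP ((tag u == ord0) && (tag s == ord_max)).
  have [im|im] := eqVneq i ord_max.
    by rewrite (mixed u s) //; [ring|exact/eqP|exact/eqP].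
  have s0 : slope s F = fun=> 0 by apply: indep; [rewrite (eqP sm) eq_sym|rewrite (negPf im)].
  by rewrite slopeC // s0 slope0; ring.
rewrite !mul0r addr0.
(* For the remaining pairs of groups a generator depends on at most one of the two coordinates. *)
suff [->|Fs] : slope u F = (fun=> 0) \/ slope s F = fun=> 0.
- by rewrite slope0.
- by rewrite slopeC // Fs slope0.
have [ui|ui] := eqVneq (tag u) i; last first.
  have [/andP[im u0]|iu] := boolP ((i == ord_max) && (tag u == ord0)); last by left; exact: indep.
  right; apply: indep.
    by apply: contra nus => /eqP ->; rewrite u0 im.
  by rewrite negb_and -(eqP u0) tsu orbT.
right; apply: indep; first by rewrite -ui.
by apply: contra nsu => /andP[im ->]; rewrite ui im.
Qed.

End SecondOrder.

(** * Logarithmic derivatives of products and of the weights *)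

(** Derivatives are given as [l * f] and not as quotients, so the factors may vanish. *)
Lemma is_partial_logprod (R : realType) (C : finType) (J : Type) (s : seq J) (Q : pred J)
    (c : C) (f : J -> (C -> R) -> R) y (l : J -> R) :
  (forall j, Q j -> is_partial c (f j) y (l j * f j y)) ->
  is_partial c (fun x => \prod_(j <- s | Q j) f j x) y
    ((\sum_(j <- s | Q j) l j) * \prod_(j <- s | Q j) f j y).
Proof.
move=> H; elim: s => [|j s IH].
  rewrite !big_nil mul0r.
  by apply: is_partial_ext (is_partial_cst c 1 y) => x; rewrite big_nil.
rewrite !big_cons; case: ifP => [Qj|nQj].
  apply: (@is_partial_ext _ _ _ (fun x => f j x * \prod_(j <- s | Q j) f j x)).
    by move=> x; rewrite big_cons Qj.
  by apply: is_partial_eq (is_partialM (H j Qj) IH) _; ring.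
by apply: is_partial_ext IH => x; rewrite big_cons nQj.
Qed.

Lemma pdiff_prod (R : realType) (C : finType) (J : Type) (s : seq J)
    (c : C) (f : J -> (C -> R) -> R) y :
  (forall j, pdiff c (f j) y) -> pdiff c (fun x => \prod_(j <- s) f j x) y.
Proof.
move=> H; elim: s => [|j s IH].
  by apply: pdiff_ext (pdiff_cst c 1 y) => x; rewrite big_nil.
by apply: pdiff_ext (pdiffM (H j) IH) => x; rewrite big_cons.
Qed.

Lemma is_partial_proj (R : realType) (C : finType) (c a : C) (y : C -> R) :
  is_partial c (fun x => x a) y (c == a)%:R.
Proof.
have [<-|ca] := eqVneq c a; first exact: (@is_partial_coord _ _ _ id y 1 (is_derive_id _ _)).
by apply: (@is_partial_other _ _ _ _ id); rewrite eq_sym.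
Qed.

Section LogDerivatives.
Context {R : realType} {n : nat} (d : 'I_n.+3 -> nat) (pi1 pi2 : R).
Local Notation L z := (pi1 + pi2 * z).
Local Notation lam := (lam pi1 pi2).
Local Notation regular := (regular pi1 pi2).
Implicit Types (x : slot d -> R) (s u w : slot d).

Definition weight s x : R := Delta s x * cfactor pi1 pi2 (tag s) x.

Lemma weight_neq0 s x : regular x -> weight s x != 0.
Proof. by move=> [D0 c0]; rewrite mulf_neq0. Qed.

Lemma is_partial_L w u x : is_partial w (fun x => L (x u)) x (pi2 * (w == u)%:R).
Proof.
apply: is_partial_eq.
  apply: is_partialD; first exact: is_partial_cst.
  by apply: is_partialM; [exact: is_partial_cst|exact: is_partial_proj].
by rewrite mul0r !add0r.
Qed.

Lemma is_partial_cfactor u s x : regular x ->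
  is_partial u (cfactor pi1 pi2 (tag s)) x
    ((if (tag u == ord0) && (tag s == ord_max) then pi2 / L (x u) else 0)
     * cfactor pi1 pi2 (tag s) x).
Proof.
move=> rx; have [->|sm] := eqVneq (tag s) ord_max; last first.
  rewrite andbF mul0r; apply: is_partial_ext (is_partial_cst u 1 x) => y.
  exact: cfactor_other.
rewrite andbT; apply: is_partial_ext (@cfactor_max _ _ _ _ _) _; rewrite cfactor_max.
apply: is_partial_eq.
  apply: (@is_partial_logprod _ _ _ _ _ _ _ _
    (fun v => if u == v then pi2 / L (x u) else 0)) => v v0.
  apply: is_partial_eq (is_partial_L _ _ _) _.
  case: eqP => [->|_] /=; last by rewrite mulr0 mul0r.
  by rewrite mulr1 mulfVK // regular_L //; apply/eqP.
congr (_ * _); rewrite -big_mkcondr /=.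
case: ifP => u0; last first.
  by rewrite big_pred0 // => v; apply/negP => /andP[v0 /eqP uv]; rewrite uv v0 in u0.
rewrite (big_pred1 u) // => v; rewrite andbC.
by apply/andP/eqP => [[/eqP]|->].
Qed.

Lemma is_partial_Delta u s x : regular x ->
  is_partial u (Delta s) x
    ((if u == s then \sum_(v | (tag v == tag s) && (v != s)) (x s - x v)^-1
      else if tag u == tag s then (x u - x s)^-1 else 0) * Delta s x).
Proof.
move=> rx; apply: is_partial_eq.
  apply: (@is_partial_logprod _ _ _ _ _ _ _ _ (fun v =>
    if u == s then (x s - x v)^-1 else if u == v then - (x s - x v)^-1 else 0)).
  move=> v /andP[/eqP tv vs].
  have xsv : x s - x v != 0 by apply: regular_neq rx _ _; [rewrite eq_sym|rewrite tv].
  apply: is_partial_eq (is_partialB (is_partial_proj _ _ _) (is_partial_proj _ _ _)) _.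
  have [->|us] := eqVneq u s.
    by rewrite eq_sym (negPf vs) subr0 mulVf.
  by case: (eqVneq u v) => _; rewrite sub0r ?mulNr ?mulVf // oppr0 mul0r.
congr (_ * _); case: (eqVneq u s) => [_|us] //.
rewrite -big_mkcondr /=; case: ifP => us'; last first.
  rewrite big_pred0 // => v; apply/negP => /andP[/andP[vs _] /eqP uv].
  by rewrite uv vs in us'.
rewrite (big_pred1 u) => [|v]; first by rewrite -invrN opprB.
rewrite andbC; apply/andP/eqP => [[/eqP]|->] //.
by split=> //; rewrite us' us.
Qed.

Lemma is_partial_weight u s x : regular x ->
  is_partial u (weight s) x (lam u s x * weight s x).
Proof.
move=> rx; apply: is_partial_eq.
  exact: is_partialM (is_partial_Delta u s rx) (is_partial_cfactor u s rx).
rewrite -mulrA [X in _ + X]mulrCA -mulrDl -/(weight s x); congr (_ * _).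
rewrite /lam; case: (eqVneq u s) => [->|us].
  by case: andP => [[/eqP -> //]|_]; rewrite addr0.
case: (eqVneq (tag u) (tag s)) => [->|_]; last by rewrite add0r.
by case: andP => [[/eqP -> //]|_]; rewrite addr0.
Qed.

(** As a function of [x u], [lam u s] is zero or the logarithmic derivative [a / (a x + c)] of an
    affine function, whence [y' = - y ^ 2]. *)
Lemma is_partial_lam u s x : regular x -> u != s ->
  is_partial u (lam u s) x (- lam u s x ^+ 2).
Proof.
move=> rx us; have su : s != u by rewrite eq_sym.
have lamE y : lam u s y = if tag u == tag s then (y u - y s)^-1
  else if (tag u == ord0) && (tag s == ord_max) then pi2 / L (y u) else 0.
  by rewrite /lam (negPf us).
rewrite lamE; apply: is_partial_ext lamE _.
case: eqP => tus.
  have xus : x u - x s != 0 by apply: (regular_neq rx).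
  apply: is_partial_eq.
    exact: is_partialV xus (is_partialB (is_partial_proj _ _ _) (is_partial_proj _ _ _)).
  by rewrite eqxx (negPf us) /=; field.
case: andP => [[/eqP u0 _]|_]; last first.
  by apply: is_partial_eq (is_partial_cst _ _ _) _; ring.
have Lu : L (x u) != 0 by exact: regular_L.
apply: is_partial_eq.
  exact: is_partialM (is_partial_cst _ _ _) (is_partialV Lu (is_partial_L _ _ _)).
by rewrite eqxx /=; field.
Qed.

Lemma pdiff_lam w u s x : regular x -> pdiff w (lam u s) x.
Proof.
move=> rx; have pV v v' : v != v' -> tag v = tag v' -> pdiff w (fun y => (y v - y v')^-1) x.
  move=> vv' tvv'; apply: pdiffV; first by apply: (regular_neq rx).
  by apply: pdiffB; apply: is_partial_pdiff (is_partial_proj _ _ _).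
rewrite /lam; case: (eqVneq u s) => [_|us].
  by apply: pdiff_sum => v /andP[/eqP ts vs]; apply: pV; [rewrite eq_sym|rewrite ts].
case: eqP => tus; first exact: pV.
case: andP => [[/eqP u0 _]|_]; last exact: pdiff_cst.
apply: pdiffM; first exact: pdiff_cst.
by apply: pdiffV; [exact: regular_L|exact: is_partial_pdiff (is_partial_L _ _ _)].
Qed.

End LogDerivatives.

(** * The separable geometry *)

Section Geometry.
Context {R : realType} {n : nat} (d : 'I_n.+3 -> nat) (pi1 pi2 : R).
Variables (beta : tensors R (slot d)) (e : (order_of d).-tuple (tensors R (slot d)))
  (I : slot d -> set R) (A : slot d -> R -> R).
Hypothesis geometry : separable_geometry pi1 pi2 beta e I A.
Local Notation tensor := (tensors R (slot d)).
Local Notation upd := (@dfwith (slot d) (fun=> R)).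
Local Notation h := (factorization_space d pi1 pi2).
Local Notation regular := (regular pi1 pi2).
Local Notation lam := (lam pi1 pi2).
Local Notation weight := (weight pi1 pi2).
Local Notation m := (order_of d).
Implicit Types (x : slot d -> R) (s u w : slot d) (alpha : tensor).

Lemma box_open x s : box I x -> \forall z \near x s, box I (upd x s z).
Proof.
case: geometry => _ oI _ _ _ Ix.
have [oIs _] := oI s.
have : nbhs (x s) (I s) by apply: open_nbhs_nbhs; split=> //; exact: Ix.
by apply: filterS => z Iz u; case: dfwithP.
Qed.

Lemma box_regular x : box I x -> regular x.
Proof. by case: geometry => _ _ _ H _ /H[]. Qed.

Lemma mu_beta_neq0 x : box I x -> mu beta x != 0.
Proof. by case: geometry => _ _ _ H _ /H[]. Qed.

Lemma A_neq0 s x : box I x -> A s (x s) != 0.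
Proof. by case: geometry => _ _ H _ _ Ix; apply: (H s).2; exact: Ix. Qed.

Lemma is_derive_A s x : box I x -> is_derive (x s) 1 (A s) (derive1 (A s) (x s)).
Proof.
case: geometry => _ _ H _ _ Ix; have [sm _] := H s.
by rewrite derive1E; apply: derivableP; exact: (sm 0%N _ (Ix s)).
Qed.

Lemma is_derive_dA s x : box I x ->
  is_derive (x s) 1 (derive1 (A s)) (derive1 (derive1 (A s)) (x s)).
Proof.
case: geometry => _ _ H _ _ Ix; have [sm _] := H s.
by rewrite [in X in is_derive _ _ _ X]derive1E; apply: derivableP; exact: (sm 1%N _ (Ix s)).
Qed.

Lemma beta_in : beta \in h.
Proof. by case: geometry => b _ _ _ _; apply: (basis_mem b); rewrite inE eqxx. Qed.

Lemma e_in j : tnth e j \in h.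
Proof.
case: geometry => b _ _ _ _; apply: (basis_mem b).
by rewrite inE mem_tnth orbT.
Qed.

Lemma basis_expansion alpha : alpha \in h ->
  alpha = coord [tuple of beta :: e] ord0 alpha *: beta
    + \sum_j mod_coord beta e j alpha *: tnth e j.
Proof.
case: geometry => b _ _ _ _ ah.
rewrite {1}(@coord_basis _ _ _ _ [tuple of beta :: e] _ b ah) big_ord_recl.
by congr (_ + _); apply: eq_bigr => j _; rewrite /= (tnth_nth 0).
Qed.

Definition dlog_beta s x : R := slope s (mu beta) x / mu beta x.

(* The component of the differential of [mu alpha / mu beta] along [s]. *)
Definition dratio alpha s x : R :=
  (slope s (mu alpha) x * mu beta x - mu alpha x * slope s (mu beta) x) / mu beta x ^+ 2.

Definition dlog_profile u s x : R :=
  (if u == s then derive1 (A s) (x s) / A s (x s) else 0) + dlog_beta u x - lam u s x.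

Lemma is_partial_mu alpha s x : is_partial s (mu alpha) x (slope s (mu alpha) x).
Proof. by apply: multiaffine_is_partial; exact: multiaffine_mu. Qed.

Lemma is_partial_slope_mu alpha s u x :
  is_partial s (slope u (mu alpha)) x (slope s (slope u (mu alpha)) x).
Proof. by apply: multiaffine_is_partial; apply: multiaffine_slope; exact: multiaffine_mu. Qed.

Lemma slope_slope alpha s x : slope s (slope s (mu alpha)) x = 0.
Proof. by rewrite {1}/slope !slope_upd subrr. Qed.

Lemma is_partial_ratio alpha s x : mu beta x != 0 ->
  is_partial s (mu_normalized beta alpha) x (dratio alpha s x).
Proof.
move=> b0; apply: is_partial_eq.
  exact: is_partialM (is_partial_mu _ _ _) (is_partialV b0 (is_partial_mu _ _ _)).
by rewrite /dratio; field.
Qed.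

Lemma dmuE s j x : box I x -> dmu beta e s j x = dratio (tnth e j) s x.
Proof. by move=> Ix; apply/is_partialE/is_partial_ratio/mu_beta_neq0. Qed.

Lemma dratioD alpha alpha' s x : dratio (alpha + alpha') s x = dratio alpha s x + dratio alpha' s x.
Proof. by rewrite /dratio /slope !muD; ring. Qed.

Lemma dratioZ a alpha s x : dratio (a *: alpha) s x = a * dratio alpha s x.
Proof. by rewrite /dratio /slope !muZ; ring. Qed.

Lemma dratio_beta s x : dratio beta s x = 0.
Proof. by rewrite /dratio; ring. Qed.

Lemma dratio_sum (J : Type) (r : seq J) (F : J -> tensor) s x :
  dratio (\sum_(j <- r) F j) s x = \sum_(j <- r) dratio (F j) s x.
Proof.
apply: (big_morph (fun alpha => dratio alpha s x)) => [a b|]; first exact: dratioD.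
by rewrite -(scale0r (0 : tensor)) dratioZ mul0r.
Qed.

Lemma dratio_expansion alpha s x : box I x -> alpha \in h ->
  dratio alpha s x = \sum_j mod_coord beta e j alpha * dmu beta e s j x.
Proof.
move=> Ix ah; rewrite {1}(basis_expansion ah) dratioD dratioZ dratio_beta mulr0 add0r.
by rewrite dratio_sum; apply: eq_bigr => j _; rewrite dratioZ dmuE.
Qed.

Lemma is_partial_dlog_beta s x : box I x ->
  is_partial s (dlog_beta s) x (- dlog_beta s x ^+ 2).
Proof.
move=> Ix; have b0 := mu_beta_neq0 Ix; apply: is_partial_eq.
  exact: is_partialM (is_partial_slope_mu _ _ _ _) (is_partialV b0 (is_partial_mu _ _ _)).
by rewrite slope_slope /dlog_beta; field.
Qed.

Lemma pdiff_dlog_beta s u x : box I x -> pdiff s (dlog_beta u) x.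
Proof.
move=> Ix; have b0 := mu_beta_neq0 Ix; apply: pdiffM.
  exact: is_partial_pdiff (is_partial_slope_mu _ _ _ _).
by apply: pdiffV => //; exact: is_partial_pdiff (is_partial_mu _ _ _).
Qed.

Lemma pdiff_dlogA s u x : box I x -> pdiff s (fun x => derive1 (A u) (x u) / A u (x u)) x.
Proof.
move=> Ix; have [->|us] := eqVneq u s; last first.
  by exists 0; apply: (@is_partial_other _ _ s u (fun z => derive1 (A u) z / A u z)).
apply: pdiffM; first exact: is_partial_pdiff (is_partial_coord (is_derive_dA s Ix)).
apply: pdiffV; first exact: A_neq0.
exact: is_partial_pdiff (is_partial_coord (is_derive_A s Ix)).
Qed.

Lemma profileE s x : profile pi1 pi2 A beta s x = A s (x s) * mu beta x / weight s x.
Proof. by []. Qed.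

Lemma profile_neq0 s x : box I x -> profile pi1 pi2 A beta s x != 0.
Proof.
move=> Ix; have w0 := weight_neq0 s (box_regular Ix).
by rewrite profileE mulf_neq0 ?invr_eq0 // mulf_neq0 ?A_neq0 ?mu_beta_neq0.
Qed.

Lemma is_partial_profile u s x : box I x ->
  is_partial u (profile pi1 pi2 A beta s) x
    (dlog_profile u s x * profile pi1 pi2 A beta s x).
Proof.
move=> Ix; have b0 := mu_beta_neq0 Ix; have A0 := A_neq0 s Ix.
have rx := box_regular Ix; have w0 := weight_neq0 s rx.
have dA : is_partial u (fun x => A s (x s)) x (if u == s then derive1 (A s) (x s) else 0).
  have [->|us] := eqVneq u s; first exact: is_partial_coord (is_derive_A s Ix).
  by apply: is_partial_other; rewrite eq_sym.
apply: is_partial_eq.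
  apply: is_partialM (is_partialV w0 (is_partial_weight u s rx)).
  exact: is_partialM dA (is_partial_mu _ _ _).
rewrite profileE /dlog_profile /dlog_beta.
by case: eqP => _; field; rewrite ?A0 ?b0 ?w0.
Qed.

(** Off the diagonal [q = b - lam], and [- b ^ 2 + lam ^ 2] equals [q ^ 2 - 2 b q]. *)
Lemma is_partial_dlog_profile s u x : box I x -> s != u ->
  is_partial s (dlog_profile s u) x
    (dlog_profile s u x ^+ 2 - 2 * dlog_beta s x * dlog_profile s u x).
Proof.
move=> Ix su; have E y : dlog_profile s u y = dlog_beta s y - lam s u y.
  by rewrite /dlog_profile (negPf su) add0r.
rewrite E; apply: is_partial_ext E _.
apply: is_partial_eq.
  exact: is_partialB (is_partial_dlog_beta s Ix) (is_partial_lam (box_regular Ix) su).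
by ring.
Qed.

Lemma pdiff_dlog_profile w u s x : box I x -> pdiff w (dlog_profile u s) x.
Proof.
move=> Ix; apply: pdiffB; last exact: pdiff_lam (box_regular Ix).
apply: pdiffD; last exact: pdiff_dlog_beta.
by case: eqP => _; [exact: pdiff_dlogA|exact: pdiff_cst].
Qed.

(** The system is closed because pure second slopes vanish and the mixed ones of [alpha] and [beta]
    obey [mu_slope2] with the same coefficients. *)
Lemma is_partial_dratio alpha s u x : box I x -> alpha \in h ->
  is_partial s (dratio alpha u) x
    (\sum_v frame_conn dlog_profile dlog_beta s u v x * dratio alpha v x).
Proof.
move=> Ix ah; have b0 := mu_beta_neq0 Ix; have rx := box_regular Ix.
apply: is_partial_eq.
  apply: is_partialM; last first.
    apply: is_partialV; first by rewrite expf_neq0.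
    exact: is_partialM (is_partial_mu _ _ _) (is_partial_mu _ _ _).
  apply: is_partialB.
    exact: is_partialM (is_partial_slope_mu _ _ _ _) (is_partial_mu _ _ _).
  exact: is_partialM (is_partial_mu _ _ _) (is_partial_slope_mu _ _ _ _).
have [->|us] := eqVneq u s.
  rewrite (bigD1 s) //= big1 => [|v vs]; last by rewrite /frame_conn eqxx (negPf vs) mul0r.
  by rewrite /frame_conn eqxx !slope_slope /dlog_beta /dratio; field.
have su : s != u by rewrite eq_sym.
rewrite (bigD1 s) //= (bigD1 u) //= big1 => [|v /andP[vs vu]]; last first.
  by rewrite /frame_conn (negPf us) (negPf vs) (negPf vu) mul0r.
rewrite /frame_conn (negPf us) !eqxx (mu_slope2 ah rx su) (mu_slope2 beta_in rx su).
rewrite /dlog_profile (negPf us) (negPf su) /dlog_beta /dratio.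
by field.
Qed.

Lemma mu_psi u z x : mu (psi pi1 pi2 u z) x =
  cfactor pi1 pi2 (tag u) x * \prod_(v | tag v == tag u) (z - x v).
Proof.
rewrite /psi mu_ins tensor_pairing_decomposable (big_slot _ (tag u) (fun v => z - x v)).
by congr (_ * _); apply: eq_bigr => r _; rewrite sum_vec2; ring.
Qed.

(** With the argument frozen at [x u], the function of [psi] vanishes at every point having the same
    coordinate [u]; its derivative therefore survives only along [u], where the remaining factors
    form [weight u]. *)
Lemma dratio_psi u s x : box I x ->
  dratio (psi pi1 pi2 u (x u)) s x = (s == u)%:R * - (weight u x / mu beta x).
Proof.
move=> Ix; have b0 := mu_beta_neq0 Ix; rewrite /dratio.
have psi0 y : y u = x u -> mu (psi pi1 pi2 u (x u)) y = 0.
  by move=> yu; rewrite mu_psi (bigD1 u) //= yu subrr mul0r mulr0.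
rewrite (psi0 x erefl) mul0r subr0.
have [->|su] := eqVneq s u; last first.
  by rewrite /slope !psi0 ?dfwithout // subrr /=; ring.
have cf z : cfactor pi1 pi2 (tag u) (upd x u z) = cfactor pi1 pi2 (tag u) x.
  have [um|um] := eqVneq (tag u) ord_max; last by rewrite !cfactor_other.
  rewrite um !cfactor_max; apply: eq_bigr => v /eqP v0.
  rewrite dfwithout //; apply/eqP => uv; have : tag u = ord0 by rewrite uv.
  by rewrite um.
have E z : mu (psi pi1 pi2 u (x u)) (upd x u z) = (x u - z) * weight u x.
  rewrite mu_psi cf (bigD1 u) //= dfwithin /weight (_ : \prod_(v | _) _ = Delta u x).
    by ring.
  by apply: eq_bigr => v /andP[_ vu]; rewrite dfwithout // eq_sym.
by rewrite /slope !E /=; field.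
Qed.

Lemma psi_in u z : psi pi1 pi2 u z \in h.
Proof. by apply: ins_factorization; exact: decomposable_sym. Qed.

(* Since [<d/dx_s mu_beta, psi_u(x_u)>] vanishes for [s != u], the [psi_u(x_u)]
   form, up to scaling, the basis of [h / <beta>] dual to the frame. *)
Definition dmu_inv (j : 'I_m) u x : R :=
  - mod_coord beta e j (psi pi1 pi2 u (x u)) * mu beta x / weight u x.

Lemma dmu_dmu_inv s u x : box I x ->
  \sum_j dmu beta e s j x * dmu_inv j u x = (s == u)%:R.
Proof.
move=> Ix; have b0 := mu_beta_neq0 Ix; have w0 := weight_neq0 u (box_regular Ix).
transitivity (- (mu beta x / weight u x) * dratio (psi pi1 pi2 u (x u)) s x).
  rewrite (dratio_expansion _ Ix (psi_in _ _)) mulr_sumr.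
  by apply: eq_bigr => j _; rewrite /dmu_inv; ring.
by rewrite dratio_psi //; field; rewrite b0 w0.
Qed.

Lemma card_slot : #|slot d| = m.
Proof.
rewrite -sum1_card /order_of.
rewrite (eq_bigr (fun i => \sum_(r < d i) 1)%N) => [|i _]; last by rewrite sum1_card card_ord.
by rewrite (sig_big_dep (op := addn) xpredT (fun i => xpredT) (fun i (r : 'I_(d i)) => 1%N)).
Qed.

Lemma dmu_inv_dmu j k x : box I x -> \sum_s dmu_inv j s x * dmu beta e s k x = (j == k)%:R.
Proof.
move=> Ix; apply: (@fmul_1C _ _ _ (fun s j => dmu beta e s j x) (fun j s => dmu_inv j s x)).
  by rewrite card_slot card_ord.
by move=> s u; exact: dmu_dmu_inv.
Qed.

Lemma pdiff_dmu_inv s j u x : box I x -> pdiff s (dmu_inv j u) x.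
Proof.
move=> Ix; have w0 := weight_neq0 u (box_regular Ix).
apply: pdiffM; last first.
  by apply: pdiffV => //; exact: is_partial_pdiff (is_partial_weight _ _ (box_regular Ix)).
apply: pdiffM; last exact: is_partial_pdiff (is_partial_mu _ _ _).
apply: pdiffN.
(* [coord] is linear on all tensors, so [psi] can be expanded in unit tensors although these need
   not lie in [h]; the coefficients are polynomial in [y u]. *)
pose unit_tensor (sigma : {ffun slot d -> 'I_2}) : tensor :=
  [ffun sigma' => (sigma == sigma')%:R].
pose K (sigma : {ffun slot d -> 'I_2}) : R :=
  (\prod_(v : slot d | tag v != tag u) Gamma pi1 pi2 (tag u) v 0 (sigma v))
  * mod_coord beta e j (unit_tensor sigma).
have E y : mod_coord beta e j (psi pi1 pi2 u (y u)) = \sum_(sigma : {ffun slot d -> 'I_2})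
    (\prod_(r < d (tag u)) vec2 (y u) (-1) 0 (sigma (Slot r))) * K sigma.
  have {1}-> : psi pi1 pi2 u (y u) = \sum_sigma psi pi1 pi2 u (y u) sigma *: unit_tensor sigma.
    apply/ffunP => tau; rewrite sum_ffunE.
    under eq_bigr do rewrite !ffunE.
    rewrite -[LHS](sum_delta tau); apply: eq_bigr => sigma _.
    by rewrite eq_sym mulrC !ffunE.
  rewrite /mod_coord linear_sum; apply: eq_bigr => sigma _.
  rewrite linearZ /= !ffunE /K /mod_coord mulrA.
  by do 2![congr (_ * _)]; apply: eq_bigr => r _; rewrite ffunE.
apply: pdiff_ext E _; apply: pdiff_sum => sigma _.
apply: pdiffM; last exact: pdiff_cst.
apply: pdiff_prod => r; apply: (@pdiff_ext _ _ _
  (fun y => if sigma (Slot r) == ord0 then y u else -1)) => [y|].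
  by rewrite mxE.
by case: eqP => _; [exact: is_partial_pdiff (is_partial_proj _ _ _)|exact: pdiff_cst].
Qed.

Lemma is_partial_dmu s u j x : box I x ->
  is_partial s (dmu beta e u j) x
    (\sum_v frame_conn dlog_profile dlog_beta s u v x * dmu beta e v j x).
Proof.
move=> Ix; apply: is_partial_near; last first.
  apply: is_partial_eq (is_partial_dratio s u Ix (e_in j)) _.
  by apply: eq_bigr => v _; rewrite dmuE.
by apply: filterS (box_open s Ix) => z Iz; rewrite dmuE.
Qed.

End Geometry.

(** * Scalar curvature and extremality *)

Section Criterion.
Context {R : realType} {n : nat} (d : 'I_n.+3 -> nat) (pi1 pi2 : R).
Variables (beta : tensors R (slot d)) (e : (order_of d).-tuple (tensors R (slot d)))
  (I : slot d -> set R) (A : slot d -> R -> R).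
Hypothesis geometry : separable_geometry pi1 pi2 beta e I A.
Local Notation tensor := (tensors R (slot d)).
Local Notation L z := (pi1 + pi2 * z).
Local Notation h := (factorization_space d pi1 pi2).
Local Notation weight := (weight pi1 pi2).
Local Notation m := (order_of d).
Local Notation P := (profile pi1 pi2 A beta).
Local Notation b := (dlog_beta beta).
Local Notation Kt := (trace_dG (dlog_profile pi1 pi2 beta A) b).
Implicit Types (x : slot d -> R) (s u w : slot d) (alpha : tensor).

Definition dlog_twist s x : R :=
  if tag s == ord0 then (d ord_max)%:R * (pi2 / L (x s)) else 0.

(** In [q s s - \sum_(u | u != s) q s u - 4 b_s] the terms [1 / (x_s - x_u)] of the own group
    cancel, [b_s] is counted [1 - (m - 1) - 4] times, and the slots of the last group leave the
    twist when [s] is in the first group. *)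
Lemma trace_dGE s x :
  Kt s x = derive1 (A s) (x s) / A s (x s) - (m%:R + 2) * b s x + dlog_twist s x.
Proof.
rewrite /trace_dG.
pose l1 u := if tag u == tag s then (x s - x u)^-1 else 0.
pose l2 u := if tag u == ord_max then (if tag s == ord0 then pi2 / L (x s) else 0) else 0.
have lamE u : u != s -> dlog_profile pi1 pi2 beta A s u x = b s x - l1 u - l2 u.
  move=> us; rewrite /dlog_profile /lam /l1 /l2 [s == u]eq_sym (negPf us) [tag s == tag u]eq_sym.
  case: eqP => [->|_].
    by case: eqP => [->|_]; rewrite ?eqxx /=; ring.
  by case: eqP; case: eqP => _ _ /=; ring.
rewrite (eq_bigr _ lamE) !sumrB sumr_const.
have -> : #|[pred u | u != s]| = m.-1.
  by rewrite -(card_slot d) -(cardC1 s); apply: eq_card.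
have -> : \sum_(u | u != s) l1 u = lam pi1 pi2 s s x.
  rewrite /lam eqxx -big_mkcondr; apply: eq_bigl => u; exact: andbC.
have -> : \sum_(u | u != s) l2 u = dlog_twist s x.
  rewrite /dlog_twist /l2; case: (eqVneq (tag s) ord0) => s0; last first.
    by rewrite big1 // => u _; case: ifP.
  rewrite -big_mkcondr /= (eq_bigl (fun u => tag u == ord_max)); last first.
    move=> u; apply: andb_idl => /eqP um; apply/eqP => us.
    by have := um; rewrite us s0.
  by rewrite (big_slot _ ord_max (fun=> pi2 / L (x s))) sumr_const card_ord mulr_natl.
have m_gt0 : (0 < m)%N by rewrite -(card_slot d); apply/card_gt0P; exists s.
have -> : m%:R = m.-1%:R + 1 :> R by rewrite -[in LHS](prednK m_gt0) -addn1 natrD.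
rewrite -mulr_natr /dlog_profile eqxx.
by move: (lam _ _ _ _ _) (derive1 (A s) (x s) / A s (x s)) => l c; ring.
Qed.

Lemma separable_scalar_curvature y : box I (xpart y) -> let x := xpart y in
  scalar_curvature (g_metric pi1 pi2 A beta e) y =
  - \sum_s P s x * (partial s (Kt s) x + Kt s x ^+ 2 + 2 * b s x * Kt s x).
Proof.
move=> Iy x.
apply: (@toric_scalar_curvature _ _ _ (box I) P (dmu beta e) (dmu_inv pi1 pi2 beta e)
  (dlog_profile pi1 pi2 beta A) b) => //.
- exact: (box_open geometry).
- by move=> s x' Ix; exact: (profile_neq0 geometry).
- by move=> s u x' Ix; exact: (is_partial_profile geometry).
- by move=> s u x' Ix su; exact: (is_partial_dlog_profile geometry).
- by move=> s u v x' Ix; exact: (pdiff_dlog_profile geometry).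
- by move=> s x' Ix; exact: (pdiff_dlog_beta geometry).
- by move=> s u j x' Ix; exact: (is_partial_dmu geometry).
- by move=> s j u x' Ix; exact: (pdiff_dmu_inv geometry).
- by move=> s u x' Ix; exact: (dmu_dmu_inv geometry).
- by move=> j k x' Ix; exact: (dmu_inv_dmu geometry).
Qed.

Lemma extremal_criterion alpha : alpha \in h ->
  (forall x, box I x ->
     \sum_s P s x * (partial s (Kt s) x + Kt s x ^+ 2 + 2 * b s x * Kt s x)
     = mu_normalized beta alpha x) ->
  extremal (chart_domain I) (g_metric pi1 pi2 A beta e) (J_complex pi1 pi2 A beta e).
Proof.
move=> ah Ha.
refine (@toric_killing_potential R (slot d) 'I_m (box I) P (dmu beta e)
  (dmu_inv pi1 pi2 beta e) (dlog_profile pi1 pi2 beta A) b _ _ _ _ _ _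
  (J_complex pi1 pi2 A beta e) (scalar_curvature (g_metric pi1 pi2 A beta e))
  (* The scalar curvature is minus the sum over the coordinates, hence the sign. *)
  (mu_normalized beta (- alpha)) (fun j => mod_coord beta e j (- alpha)) _ _ _ _) => //.
- exact: (box_open geometry).
- by move=> s x' Ix; exact: (profile_neq0 geometry).
- by move=> s u x' Ix; exact: (is_partial_profile geometry).
- by move=> s u j x' Ix; exact: (is_partial_dmu geometry).
- by move=> s u x' Ix; exact: (dmu_dmu_inv geometry).
- by move=> j k x' Ix; exact: (dmu_inv_dmu geometry).
- move=> i s y Iy; rewrite /= profileE /dmu_inv -/(xpart y).
  have w0 := weight_neq0 s (box_regular geometry Iy).
  have b0 := mu_beta_neq0 geometry Iy; have A0 := A_neq0 geometry s Iy.
  by field; rewrite w0 b0 A0.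
- move=> y Iy; rewrite separable_scalar_curvature // Ha // /mu_normalized.
  by rewrite -(scaleN1r alpha) muZ mulN1r mulNr.
- move=> s x Ix; rewrite (is_partialE (is_partial_ratio _ _ (mu_beta_neq0 geometry Ix))).
  by rewrite (dratio_expansion geometry) // rpredN.
Qed.

End Criterion.

(** * The curvature contribution of a single coordinate *)

Lemma is_partialX (R : realType) (C : finType) (c : C) (f : (C -> R) -> R) y l k :
  is_partial c f y (l * f y) -> is_partial c (fun x => f x ^+ k) y (k%:R * l * f y ^+ k).
Proof.
move=> H; elim: k => [|k IH].
  by rewrite !mul0r; apply: is_partial_ext (is_partial_cst c 1 y) => x; rewrite expr0.
apply: (@is_partial_ext _ _ _ (fun x => f x * f x ^+ k)) => [x|]; first exact: exprS.
by apply: is_partial_eq (is_partialM H IH) _; rewrite exprS -[k.+1]addn1 natrD; ring.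
Qed.

Lemma second_antiderivativeP (R : realType) (J : set R) (F G : R -> R) z :
  second_antiderivative J F G -> J z ->
  is_derive z 1 G (derive1 G z) /\ is_derive z 1 (derive1 G) (F z).
Proof.
move=> H /H[dG ddG <-]; split; first by rewrite derive1E; exact: derivableP.
by rewrite [in X in is_derive _ _ _ X]derive1E; exact: derivableP.
Qed.

Section LocalTerms.
Context {R : realType} {n : nat} (d : 'I_n.+3 -> nat) (pi1 pi2 : R).
Variables (beta : tensors R (slot d)) (e : (order_of d).-tuple (tensors R (slot d)))
  (I : slot d -> set R) (A : slot d -> R -> R).
Hypothesis geometry : separable_geometry pi1 pi2 beta e I A.
Hypothesis d_gt0 : forall i, (0 < d i)%N.
Local Notation L z := (pi1 + pi2 * z).
Local Notation weight := (weight pi1 pi2).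
Local Notation m := (order_of d).
Local Notation P := (profile pi1 pi2 A beta).
Local Notation b := (dlog_beta beta).
Local Notation Kt := (trace_dG (dlog_profile pi1 pi2 beta A) b).
Implicit Types (x : slot d -> R) (s u w : slot d).

Definition curvature_term s x : R :=
  P s x * (partial s (Kt s) x + Kt s x ^+ 2 + 2 * b s x * Kt s x).

(** A single affine [E] serves all three cases: [1], [L] and [a + b z]. *)
Variables (t ea eb : R).
Local Notation E z := (ea + eb * z).
Hypothesis mu_betaE : forall x, mu beta x = t * \prod_(s : slot d | tag s == ord0) E (x s).

Lemma E_neq0 s x : box I x -> tag s = ord0 -> E (x s) != 0.
Proof.
move=> Ix s0; apply: contraNneq (mu_beta_neq0 geometry Ix) => e0.
by rewrite mu_betaE (bigD1 s) /= ?s0 // e0 mul0r mulr0.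
Qed.

Lemma dlog_beta0 s x : box I x -> tag s = ord0 -> b s x = eb / E (x s).
Proof.
move=> Ix s0; have b0 := mu_beta_neq0 geometry Ix; have E0 := E_neq0 Ix s0.
have H : is_partial s (mu beta) x (eb / E (x s) * mu beta x).
  apply: is_partial_ext mu_betaE _; apply: is_partial_eq.
    apply: is_partialM; first exact: is_partial_cst.
    apply: (@is_partial_logprod _ _ _ _ _ _ _ _
      (fun v => if s == v then eb / E (x s) else 0)) => v v0.
    apply: is_partial_eq (is_partial_L _ _ _ _ _) _.
    by case: eqP => [<-|_] /=; rewrite ?mulr1 ?mulfVK // mulr0 mul0r.
  rewrite -big_mkcondr /= [\sum_(v | _) _](big_pred1 s); first by rewrite mu_betaE /=; ring.
  by move=> v; rewrite andbC; apply/andP/eqP => [[/eqP]|->] //; rewrite s0.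
rewrite /dlog_beta -(is_partialE (is_partial_mu beta s x)) (is_partialE H).
by rewrite mulfK.
Qed.

Lemma dlog_beta_other s x : tag s != ord0 -> b s x = 0.
Proof.
move=> s0; rewrite /dlog_beta slope_indep ?mul0r // => y z.
rewrite !mu_betaE; congr (_ * _); apply: eq_bigr => v v0; rewrite dfwithout //.
by apply: contraNneq s0 => ->.
Qed.

(** Here [b_s = 0] and [K_s = A' / A], so [K' + K ^ 2] is [A'' / A] and [A] cancels against the
    profile. *)
Lemma curvature_term_other s x (Y : {poly R}) : box I x -> tag s != ord0 ->
  second_antiderivative (I s) (fun z => Y.[z]) (A s) ->
  curvature_term s x = mu beta x / weight s x * Y.[x s].
Proof.
move=> Ix s0 dA; have A0 := A_neq0 geometry s Ix.
have [dA1 dA2] := second_antiderivativeP dA (Ix s).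
have KE y : box I y -> Kt s y = derive1 (A s) (y s) / A s (y s).
  move=> Iy; rewrite trace_dGE dlog_beta_other //.
  by rewrite /dlog_twist (negPf s0); ring.
have -> : curvature_term s x = P s x *
    (Y.[x s] / A s (x s) - (derive1 (A s) (x s) / A s (x s)) ^+ 2 + Kt s x ^+ 2).
  rewrite /curvature_term dlog_beta_other // mulr0 mul0r addr0; congr (_ * (_ + _)).
  apply: is_partialE.
  apply: (@is_partial_near _ _ _ (fun y => derive1 (A s) (y s) / A s (y s))).
    by apply: filterS (box_open geometry s Ix) => z Iz; exact: KE.
  apply: is_partial_eq.
    apply: is_partialM; first exact: is_partial_coord dA2.
    by apply: is_partialV; [exact: A0|exact: is_partial_coord dA1].
  by rewrite /=; move: (derive1 (A s) (x s)) => a; field.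
rewrite KE // profileE subrK; have w0 := weight_neq0 s (box_regular geometry Ix).
by field; rewrite A0 w0.
Qed.

(** The powers in the formula for [A s] are those for which [K_s = G' / G - b_s]: [A' / A] supplies
    [(m + 1) b_s] against the [(m + 2) b_s] of [trace_dGE], and the power of [L] cancels the twist.
    As [b' = - b ^ 2], the expression [K' + K ^ 2 + 2 b K] collapses to [G'' / G]. *)
Lemma curvature_term_first s x (Y : {poly R}) (G : R -> R) : box I x -> tag s = ord0 ->
  second_antiderivative (I s)
    (fun z => Y.[z] * (L z ^+ (d ord_max).-1 / E z ^+ (m + 3))) G ->
  (forall z, I s z -> A s z = E z ^+ (m + 1) / L z ^+ d ord_max * G z) ->
  curvature_term s x = mu beta x / weight s x * (Y.[x s] / (E (x s) ^+ 2 * L (x s))).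
Proof.
move=> Ix s0 dG AE.
have L0 y : box I y -> L (y s) != 0.
  by move=> Iy; apply: regular_L s0; exact: (box_regular geometry Iy).
have G0 y : box I y -> G (y s) != 0.
  move=> Iy; apply: contraNneq (A_neq0 geometry s Iy) => G0.
  by rewrite AE ?G0 ?mulr0 //; exact: Iy.
have KE y : box I y -> Kt s y = derive1 G (y s) / G (y s) - eb / E (y s).
  move=> Iy; have [dG1 _] := second_antiderivativeP dG (Iy s).
  have Ly := L0 y Iy; have Ey := E_neq0 Iy s0; have Gy := G0 y Iy.
  have dEy : is_partial s (fun y => E (y s)) y (eb / E (y s) * E (y s)).
    by apply: is_partial_eq (is_partial_L _ _ _ _ _) _; rewrite eqxx /=; field.
  have dLy : is_partial s (fun y => L (y s)) y (pi2 / L (y s) * L (y s)).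
    by apply: is_partial_eq (is_partial_L _ _ _ _ _) _; rewrite eqxx /=; field.
  have dAy : derive1 (A s) (y s) = A s (y s) *
     ((m%:R + 1) * (eb / E (y s)) - (d ord_max)%:R * (pi2 / L (y s))
      + derive1 G (y s) / G (y s)).
    rewrite -(is_partialE (is_partial_coord (is_derive_A geometry s Iy))).
    apply: is_partialE.
    apply: (@is_partial_near _ _ _
      (fun y => E (y s) ^+ (m + 1) / L (y s) ^+ d ord_max * G (y s))).
      by apply: filterS (box_open geometry s Iy) => z Iz; rewrite AE //; exact: Iz.
    apply: is_partial_eq.
      apply: is_partialM (is_partial_coord dG1).
      apply: is_partialM; first exact: is_partialX dEy.
      by apply: is_partialV (is_partialX _ dLy); rewrite expf_neq0.
    rewrite AE ?natrD; last exact: Iy.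
    have Lk : L (y s) ^+ d ord_max != 0 by rewrite expf_neq0.
    move: (L (y s) ^+ d ord_max) (E (y s) ^+ (m + 1)) Lk => l k Lk /=.
    by move: (derive1 G (y s)) => g; field; rewrite Ly Lk Gy Ey.
  have Ay := A_neq0 geometry s Iy.
  rewrite trace_dGE dAy dlog_beta0 // /dlog_twist s0 eqxx.
  move: (derive1 G (y s)) (A s (y s)) Ay => g a Ay.
  by field; rewrite Ly Ey Gy Ay.
have [dG1 dG2] := second_antiderivativeP dG (Ix s).
have Lx := L0 x Ix; have Ex := E_neq0 Ix s0; have Gx := G0 x Ix.
set F := Y.[x s] * _ in dG2.
have DK : partial s (Kt s) x =
    F / G (x s) - (derive1 G (x s) / G (x s)) ^+ 2 + (eb / E (x s)) ^+ 2.
  apply: is_partialE.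
  apply: (@is_partial_near _ _ _ (fun y => derive1 G (y s) / G (y s) - eb * (E (y s))^-1)).
    by apply: filterS (box_open geometry s Ix) => z Iz; exact: KE.
  apply: is_partial_eq.
    apply: is_partialB.
      apply: is_partialM; first exact: is_partial_coord dG2.
      by apply: is_partialV; [exact: Gx|exact: is_partial_coord dG1].
    apply: is_partialM; first exact: is_partial_cst.
    by apply: is_partialV; [exact: Ex|exact: is_partial_L].
  rewrite eqxx /=; generalize (derive1 G (x s)) F => g f.
  by field; rewrite Gx Ex.
rewrite /curvature_term DK KE // dlog_beta0 // profileE.
have w0 := weight_neq0 s (box_regular geometry Ix).
rewrite AE; last exact: Ix.
transitivity (E (x s) ^+ (m + 1) / L (x s) ^+ d ord_max * mu beta x / weight s x * F).
  move: (L (x s) ^+ d ord_max)^-1 (E (x s) ^+ (m + 1)) => l k.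
  generalize (derive1 G (x s)) F => g f; field; by rewrite w0 Gx Ex.
rewrite /F !exprD expr1.
(* Positivity makes [(d ord_max).-1] a true predecessor, so exactly one factor [L] is left in the
   denominator. *)
have [k ->] : exists k, d ord_max = k.+1 by exists (d ord_max).-1; rewrite prednK.
rewrite exprS /=.
have Lk : L (x s) ^+ k != 0 by rewrite expf_neq0.
have Ek : E (x s) ^+ m != 0 by rewrite expf_neq0.
move: (L (x s) ^+ k) (E (x s) ^+ m) Lk Ek => l r Lk Ek.
by field; rewrite ?Lk ?Ek ?Lx ?Ex ?w0.
Qed.

End LocalTerms.

(** * Divided differences *)

Section DividedDifferences.
Variables (K : fieldType) (T : finType) (Q : pred T) (x : T -> K).
Hypothesis x_inj : {in Q &, injective x}.
Implicit Types (p : {poly K}) (rho : K).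

Definition node s : K := \prod_(v | Q v && (v != s)) (x s - x v).
Definition nodal : {poly K} := \prod_(v | Q v) ('X - (x v)%:P).
Definition nodal_without s : {poly K} := \prod_(v | Q v && (v != s)) ('X - (x v)%:P).

Lemma node_neq0 s : Q s -> node s != 0.
Proof.
move=> Qs; apply/prodf_neq0 => v /andP[Qv vs]; rewrite subr_eq0.
by apply: contraNneq vs => e; rewrite (x_inj Qs Qv e).
Qed.

Lemma prodXsubC_enum (P : pred T) :
  \prod_(v | P v) ('X - (x v)%:P) = \prod_(v <- enum P) ('X - (x v)%:P).
Proof. by rewrite big_enum. Qed.

Lemma size_nodal : size nodal = #|Q|.+1.
Proof. by rewrite /nodal prodXsubC_enum size_prod_XsubC -cardE. Qed.

Lemma size_nodal_without s : Q s -> size (nodal_without s) = #|Q|.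
Proof.
move=> Qs; rewrite /nodal_without prodXsubC_enum size_prod_XsubC -cardE.
rewrite (cardD1 s Q) unfold_in Qs add1n; congr _.+1.
by apply: eq_card => v; rewrite !inE unfold_in andbC.
Qed.

Lemma monic_nodal_without s : nodal_without s \is monic.
Proof. by rewrite /nodal_without prodXsubC_enum monic_prod_XsubC. Qed.

Lemma horner_nodal rho : nodal.[rho] = \prod_(v | Q v) (rho - x v).
Proof. by rewrite horner_prod; apply: eq_bigr => v _; rewrite hornerXsubC. Qed.

Lemma horner_nodal_without s rho :
  (nodal_without s).[rho] = \prod_(v | Q v && (v != s)) (rho - x v).
Proof. by rewrite horner_prod; apply: eq_bigr => v _; rewrite hornerXsubC. Qed.

Lemma nodal_root s : Q s -> nodal.[x s] = 0.
Proof. by move=> Qs; rewrite horner_nodal (bigD1 s) //= subrr mul0r. Qed.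

(** Lagrange's formula: the difference of the two sides has degree below the number of nodes and
    vanishes at all of them. *)
Lemma interpolation p : (size p <= #|Q|)%N ->
  p = \sum_(s | Q s) (p.[x s] / node s) *: nodal_without s.
Proof.
move=> sp; apply/eqP; rewrite -subr_eq0; apply/eqP.
apply: (@roots_geq_poly_eq0 _ _ [seq x s | s <- enum Q]).
- apply/allP => z /mapP[s]; rewrite mem_enum => Qs ->.
  rewrite rootE hornerD hornerN horner_sum (bigD1 s) //= big1 => [|u /andP[Qu us]].
    rewrite hornerZ horner_nodal_without -/(node s) mulfVK ?node_neq0 //.
    by rewrite addr0 subrr.
  rewrite hornerZ horner_nodal_without (bigD1 s) /= ?subrr ?mul0r ?mulr0 //.
  by rewrite eq_sym us andbT.
- rewrite map_inj_in_uniq ?enum_uniq // => s u.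
  by rewrite !mem_enum; exact: x_inj.
- rewrite size_map -cardE (leq_trans (size_polyD _ _)) // geq_max sp size_polyN.
  apply: (leq_trans (size_sum _ _ _)); apply/bigmax_leqP => s Qs.
  by rewrite (leq_trans (size_scale_leq _ _)) // size_nodal_without.
Qed.

(** Compare top coefficients in the Lagrange formula, whose basis polynomials are monic. *)
Lemma divided_difference p : (size p <= #|Q|)%N ->
  \sum_(s | Q s) p.[x s] / node s = p`_(#|Q|.-1).
Proof.
move=> sp; rewrite {2}(interpolation sp) coef_sum; apply: eq_bigr => s Qs.
rewrite coefZ; have := monic_nodal_without s.
by rewrite monicE lead_coefE size_nodal_without // => /eqP ->; rewrite mulr1.
Qed.

(** Subtracting the top coefficient times [nodal] changes no value at the nodes and lowers the
    degree; the sum of the nodes is minus the second coefficient of [nodal]. *)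
Lemma divided_difference_succ p : (0 < #|Q|)%N -> (size p <= #|Q|.+1)%N ->
  \sum_(s | Q s) p.[x s] / node s = p`_(#|Q|.-1) + p`_#|Q| * \sum_(s | Q s) x s.
Proof.
move=> Q0 sp; pose p' := p - p`_#|Q| *: nodal.
have nQ : nodal`_#|Q| = 1.
  have : nodal \is monic by rewrite /nodal prodXsubC_enum monic_prod_XsubC.
  by rewrite monicE lead_coefE size_nodal => /eqP.
have sp' : (size p' <= #|Q|)%N.
  apply/leq_sizeP => j; rewrite leq_eqVlt => /orP[/eqP <-|lt].
    by rewrite /p' coefB coefZ nQ mulr1 subrr.
  rewrite /p' coefB coefZ [p`_j]nth_default ?(leq_trans sp) //.
  by rewrite [nodal`_j]nth_default ?size_nodal // mulr0 subrr.
transitivity (\sum_(s | Q s) p'.[x s] / node s).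
  apply: eq_bigr => s Qs; congr (_ / _).
  by rewrite /p' hornerD hornerN hornerZ nodal_root // mulr0 subr0.
rewrite divided_difference // /p' coefB coefZ; congr (_ + _).
rewrite -mulrN; congr (_ * _); apply/eqP; rewrite eqr_oppLR; apply/eqP.
have := @coefPn_prod_XsubC K [seq x s | s <- enum Q].
rewrite size_map -cardE -lt0n => /(_ Q0).
by rewrite !big_map -prodXsubC_enum big_enum => ->.
Qed.

Lemma horner_division p rho k : (size p <= k.+1)%N ->
  exists q : {poly K}, [/\ p = q * ('X - rho%:P) + (p.[rho])%:P, (size q <= k)%N &
    (0 < k)%N -> q`_k.-1 = p`_k].
Proof.
move=> sp.
have /factor_theorem[q Eq] : root (p - (p.[rho])%:P) rho.
  by rewrite rootE hornerD hornerN hornerC subrr.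
have pE : p = q * ('X - rho%:P) + (p.[rho])%:P by rewrite -Eq subrK.
have sq : (size q <= k)%N.
  have [->|q0] := eqVneq q 0; first by rewrite size_poly0.
  have : (size (q * ('X - rho%:P))%R <= k.+1)%N.
    rewrite -Eq (leq_trans (size_polyD _ _)) // geq_max sp size_polyN.
    exact: leq_trans (size_polyC_leq1 _) _.
  by rewrite size_mul ?polyXsubC_eq0 // size_XsubC addn2.
exists q; split=> // k0; rewrite -[k in RHS](prednK k0) [in RHS]pE.
rewrite coefD coefC /= addr0 mulrBr coefB coefMX /= coefMC.
by rewrite (prednK k0) [q`_k]nth_default // mul0r subr0.
Qed.

Variable rho : K.
Hypothesis rho_neq : forall s, Q s -> rho - x s != 0.
Hypothesis Q_gt0 : (0 < #|Q|)%N.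

Let nodal_rho : nodal.[rho] != 0.
Proof. by rewrite horner_nodal; apply/prodf_neq0. Qed.

(** At the nodes the quotient takes the values [nodal(rho) / (rho - x)], so a pole at [rho] can be
    traded for a polynomial of admissible degree. *)
Lemma nodal_quotient : exists q : {poly K},
  [/\ nodal = q * ('X - rho%:P) + (nodal.[rho])%:P, (size q <= #|Q|)%N,
      q`_(#|Q|.-1) = 1 & forall s, Q s -> q.[x s] = nodal.[rho] / (rho - x s)].
Proof.
have [q [Eq sq lq]] := @horner_division nodal rho #|Q| (eq_leq size_nodal).
exists q; split=> // [|s Qs].
  rewrite lq //; have : nodal \is monic by rewrite /nodal prodXsubC_enum monic_prod_XsubC.
  by rewrite monicE lead_coefE size_nodal => /eqP.
have := nodal_root Qs; rewrite {1}Eq hornerD hornerM hornerXsubC hornerC.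
move=> /eqP; rewrite addrC addr_eq0 -mulrN opprB => /eqP ->.
by rewrite mulfK ?rho_neq.
Qed.

Lemma divided_difference_inv :
  \sum_(s | Q s) ((rho - x s) * node s)^-1 = (nodal.[rho])^-1.
Proof.
have [q [_ sq lq qx]] := nodal_quotient.
have := divided_difference sq; rewrite lq => H.
rewrite -[RHS]mulr1 -H mulr_sumr; apply: eq_bigr => s Qs.
by rewrite qx // invfM !mulrA mulVf // mul1r.
Qed.

Lemma horner_deriv_nodal :
  nodal^`().[rho] = nodal.[rho] * \sum_(s | Q s) (rho - x s)^-1.
Proof.
rewrite /nodal; elim: (index_enum T) => [|s r IH].
  by rewrite !big_nil derivC horner0 mulr0.
rewrite !big_cons; case: ifP => // Qs.
rewrite derivM derivXsubC mul1r hornerD !hornerM hornerXsubC IH.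
by have := rho_neq Qs; move: (\sum_(_ <- r | _) _) => a ?; field.
Qed.

(** Evaluate the Lagrange formula of the quotient at [rho]: the quotient takes there the value of
    the derivative of [nodal], and each basis polynomial brings one more factor
    [1 / (rho - x s)]. *)
Lemma divided_difference_inv2 :
  \sum_(s | Q s) ((rho - x s) ^+ 2 * node s)^-1 =
  (nodal.[rho])^-1 * \sum_(s | Q s) (rho - x s)^-1.
Proof.
have [q [Eq sq lq qx]] := nodal_quotient.
have nw s : Q s -> (nodal_without s).[rho] = nodal.[rho] / (rho - x s).
  move=> Qs; rewrite horner_nodal_without horner_nodal (bigD1 s Qs) /=.
  by rewrite mulrC mulKf // rho_neq.
have q1 : q.[rho] = nodal.[rho] * \sum_(s | Q s) (rho - x s)^-1.
  have := congr1 (fun p => p^`().[rho]) Eq.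
  rewrite derivD derivM derivC derivXsubC mulr1 addr0 hornerD hornerM hornerXsubC.
  by rewrite subrr mulr0 add0r => <-; exact: horner_deriv_nodal.
have := congr1 (fun p => p.[rho]) (interpolation sq).
rewrite /= q1 horner_sum [X in _ = X -> _](eq_bigr (fun s => nodal.[rho] ^+ 2 * ((rho - x s) ^+ 2 * node s)^-1)).
  rewrite -mulr_sumr => H; apply: (mulfI (expf_neq0 2 nodal_rho)); rewrite -H.
  by rewrite expr2 mulrA mulfK.
move=> s Qs; rewrite hornerZ nw // qx //; field.
by rewrite rho_neq // node_neq0.
Qed.

End DividedDifferences.

(** * Divided differences with affine denominators *)

Section AffineDividedDifferences.
Variables (K : fieldType) (T : finType) (Q : pred T).
Implicit Types (p : {poly K}) (x : T -> K).
Local Notation node := (node Q).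

Lemma affine_rho (l0 l1 z : K) : l1 != 0 -> l0 + l1 * z = - l1 * (- l0 / l1 - z).
Proof. by move=> l10; field. Qed.

Lemma prod_affine x (l0 l1 : K) : l1 != 0 ->
  \prod_(s | Q s) (l0 + l1 * x s) = (- l1) ^+ #|Q| * (nodal Q x).[- l0 / l1].
Proof.
move=> l10; rewrite horner_nodal -prodr_const -big_split /=.
by apply: eq_bigr => s _; exact: affine_rho.
Qed.

Lemma divided_difference_affine x (l0 l1 : K) : {in Q &, injective x} -> (0 < #|Q|)%N ->
  l1 != 0 -> (forall s, Q s -> l0 + l1 * x s != 0) ->
  \sum_(s | Q s) ((l0 + l1 * x s) * node x s)^-1 =
  (- l1) ^+ #|Q|.-1 / \prod_(s | Q s) (l0 + l1 * x s).
Proof.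
move=> xi Q0 l10 lx; have nl : - l1 != 0 by rewrite oppr_eq0.
have rx s : Q s -> - l0 / l1 - x s != 0.
  by move=> /lx; rewrite affine_rho // mulf_eq0 negb_or => /andP[].
have lS : (- l1) ^+ #|Q| = - l1 * (- l1) ^+ #|Q|.-1 by rewrite -exprS prednK.
rewrite prod_affine // lS.
rewrite (eq_bigr (fun s => (- l1)^-1 * ((- l0 / l1 - x s) * node x s)^-1)) => [|s Qs]; last first.
  by rewrite affine_rho // -mulrA invfM.
rewrite -mulr_sumr divided_difference_inv //.
set F := _.[_]; have F0 : F != 0 by rewrite /F horner_nodal; apply/prodf_neq0.
have lN : (- l1) ^+ #|Q|.-1 != 0 by rewrite expf_neq0.
by move: (_ ^+ _.-1) F lN F0 => l F lN F0; field; rewrite ?lN ?F0 ?nl ?l10.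
Qed.

Lemma divided_difference_affine2 x (l0 l1 : K) : {in Q &, injective x} -> (0 < #|Q|)%N ->
  l1 != 0 -> (forall s, Q s -> l0 + l1 * x s != 0) ->
  \sum_(s | Q s) ((l0 + l1 * x s) ^+ 2 * node x s)^-1 =
  (- l1) ^+ #|Q|.-1 / (\prod_(s | Q s) (l0 + l1 * x s))
  * \sum_(s | Q s) (l0 + l1 * x s)^-1.
Proof.
move=> xi Q0 l10 lx; have nl : - l1 != 0 by rewrite oppr_eq0.
have rx s : Q s -> - l0 / l1 - x s != 0.
  by move=> /lx; rewrite affine_rho // mulf_eq0 negb_or => /andP[].
have lS : (- l1) ^+ #|Q| = - l1 * (- l1) ^+ #|Q|.-1 by rewrite -exprS prednK.
rewrite prod_affine // lS.
rewrite (eq_bigr (fun s => (- l1)^-1 ^+ 2 * ((- l0 / l1 - x s) ^+ 2 * node x s)^-1)) => [|s Qs]; last first.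
  by rewrite affine_rho // exprMn -mulrA invfM exprVn.
rewrite [X in _ = _ * X](eq_bigr (fun s => (- l1)^-1 * (- l0 / l1 - x s)^-1)) => [|s Qs]; last first.
  by rewrite affine_rho // invfM.
rewrite -!mulr_sumr divided_difference_inv2 //.
set S := \sum_(s | _) _; set F := _.[_].
have F0 : F != 0 by rewrite /F horner_nodal; apply/prodf_neq0.
have lN : (- l1) ^+ #|Q|.-1 != 0 by rewrite expf_neq0.
by move: (_ ^+ _.-1) S F lN F0 => l S F lN F0; field; rewrite ?lN ?F0 ?nl ?l10.
Qed.

Lemma affine_division p (l0 l1 : K) k : l1 != 0 -> (size p <= k.+2)%N ->
  exists q : {poly K}, [/\ forall z, p.[z] = q.[z] * (l0 + l1 * z) + p.[- l0 / l1],
    (size q <= k.+1)%N & q`_k = p`_k.+1 / l1].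
Proof.
move=> l10 sp; have [q [Eq sq lq]] := horner_division (- l0 / l1) sp.
exists (l1^-1 *: q); split.
- move=> z; rewrite {1}Eq hornerD hornerM hornerXsubC hornerC hornerZ affine_rho //.
  by field.
- exact: leq_trans (size_scale_leq _ _) sq.
- by rewrite coefZ mulrC lq.
Qed.

(** [c] and [c'] are quantified before the nodes because they become coefficients of the tensor
    [alpha]; they are the top coefficients of the quotient of [p] by the affine function. The last
    term is the pole that the last group has to cancel. *)
Lemma sum_affine1 p (l0 l1 : K) : l1 != 0 -> (0 < #|Q|)%N -> (size p <= #|Q|.+2)%N ->
  exists c c' : K, forall x, {in Q &, injective x} ->
  (forall s, Q s -> l0 + l1 * x s != 0) ->
  \sum_(s | Q s) p.[x s] / ((l0 + l1 * x s) * node x s) =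
  c + c' * (\sum_(s | Q s) x s)
  + p.[- l0 / l1] * (- l1) ^+ #|Q|.-1 / \prod_(s | Q s) (l0 + l1 * x s).
Proof.
move=> l10 Q0 sp; have [q [Eq sq _]] := affine_division l0 l10 sp.
exists (q`_#|Q|.-1), q`_#|Q| => x xi lx.
rewrite -(divided_difference_succ xi) // -mulrA -divided_difference_affine //.
rewrite mulr_sumr -big_split; apply: eq_bigr => s Qs.
rewrite [in LHS]Eq /=; have := node_neq0 xi Qs; have := lx s Qs => ? ?.
by field; apply/andP.
Qed.

(** The root of [p] lowers the triple pole to a double one. Two further divisions leave a polynomial
    part, which gives the first constant, a simple and a double pole. *)
Lemma sum_affine3 p (l0 l1 : K) : l1 != 0 -> (0 < #|Q|)%N -> (size p <= #|Q|.+3)%N ->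
  p.[- l0 / l1] = 0 ->
  exists c c' : K, forall x, {in Q &, injective x} ->
  (forall s, Q s -> l0 + l1 * x s != 0) ->
  \sum_(s | Q s) p.[x s] / ((l0 + l1 * x s) ^+ 2 * (l0 + l1 * x s) * node x s) =
  p`_#|Q|.+2 / l1 ^+ 3
  + (c + c' * \sum_(s | Q s) (l0 + l1 * x s)^-1) / \prod_(s | Q s) (l0 + l1 * x s).
Proof.
move=> l10 Q0 sp p0.
have [q1 [E1 s1 c1]] := affine_division l0 l10 sp.
have [q2 [E2 s2 c2]] := affine_division l0 l10 s1.
(* The third division takes [k] to be [#|Q|.-1], so that the size bound on [q3] is exactly the one
   for plain divided differences. *)
have [q3 [E3 s3 c3]] : exists q : {poly K}, [/\ forall z,
    q2.[z] = q.[z] * (l0 + l1 * z) + q2.[- l0 / l1],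
    (size q <= #|Q|)%N & q`_#|Q|.-1 = q2`_#|Q| / l1].
  by move: s2; rewrite -{1 2 4}(prednK Q0) => s2; exact: affine_division.
exists (q2.[- l0 / l1] * (- l1) ^+ #|Q|.-1), (q1.[- l0 / l1] * (- l1) ^+ #|Q|.-1) => x xi lx.
transitivity (\sum_(s | Q s) q3.[x s] / node x s
   + q2.[- l0 / l1] * \sum_(s | Q s) ((l0 + l1 * x s) * node x s)^-1
   + q1.[- l0 / l1] * \sum_(s | Q s) ((l0 + l1 * x s) ^+ 2 * node x s)^-1).
  rewrite !mulr_sumr -!big_split; apply: eq_bigr => s Qs /=.
  rewrite E1 p0 addr0 E2 E3; have := node_neq0 xi Qs; have := lx s Qs => ? ?.
  move: (q1.[_]) (q2.[_]) => a b.
  by field; apply/andP.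
rewrite (divided_difference xi) // divided_difference_affine // divided_difference_affine2 //.
rewrite c3 c2 c1; have P0 : \prod_(s | Q s) (l0 + l1 * x s) != 0 by apply/prodf_neq0.
move: (\sum_(s | Q s) _) (\prod_(s | Q s) _) P0 (_ ^+ _.-1) q1.[_] q2.[_] => S F F0 l a b.
by field; rewrite ?l10 ?F0.
Qed.

(** Partial fractions of [p / (E ^ 2 L)]: a polynomial part, a double pole at the root of [E] and a
    simple pole at the root of [L], whose residue involves the nonzero value of [E] at the root of
    [L]. *)
Lemma sum_affine21 p (l0 l1 e0 e1 : K) : l1 != 0 -> e1 != 0 -> e0 - e1 * l0 / l1 != 0 ->
  (0 < #|Q|)%N -> (size p <= #|Q|.+3)%N ->
  exists c c' : K, forall x, {in Q &, injective x} ->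
  (forall s, Q s -> l0 + l1 * x s != 0) -> (forall s, Q s -> e0 + e1 * x s != 0) ->
  \sum_(s | Q s) p.[x s] / ((e0 + e1 * x s) ^+ 2 * (l0 + l1 * x s) * node x s) =
  p`_#|Q|.+2 / (l1 * e1 ^+ 2)
  + (c + c' * \sum_(s | Q s) (e0 + e1 * x s)^-1) / \prod_(s | Q s) (e0 + e1 * x s)
  + p.[- l0 / l1] / (e0 - e1 * l0 / l1) ^+ 2 * (- l1) ^+ #|Q|.-1
    / \prod_(s | Q s) (l0 + l1 * x s).
Proof.
move=> l10 e10 k0 Q0 sp.
have [q1 [E1 s1 c1]] := affine_division l0 l10 sp.
have [q2 [E2 s2 c2]] := affine_division e0 e10 s1.
have [q3 [E3 s3 c3]] : exists q : {poly K}, [/\ forall z,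
    q2.[z] = q.[z] * (e0 + e1 * z) + q2.[- e0 / e1],
    (size q <= #|Q|)%N & q`_#|Q|.-1 = q2`_#|Q| / e1].
  by move: s2; rewrite -{1 2 4}(prednK Q0) => s2; exact: affine_division.
set r := p.[- l0 / l1]; set k := e0 - e1 * l0 / l1.
(* From [E = (e1 / l1) L + k] one has [1 / (E L) = (1 / L - (e1 / l1) / E) / k]. Applied twice to
   [r / (E ^ 2 L)], this gives the corrections to the coefficients of [1 / E ^ 2] and [1 / E]. *)
pose a2 := q1.[- e0 / e1] - r * (e1 / l1) / k.
pose a1 := q2.[- e0 / e1] - r * (e1 / l1) / k ^+ 2.
exists (a1 * (- e1) ^+ #|Q|.-1), (a2 * (- e1) ^+ #|Q|.-1) => x xi lx ex.
transitivity (\sum_(s | Q s) q3.[x s] / node x s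
   + a1 * \sum_(s | Q s) ((e0 + e1 * x s) * node x s)^-1
   + a2 * \sum_(s | Q s) ((e0 + e1 * x s) ^+ 2 * node x s)^-1
   + r / k ^+ 2 * \sum_(s | Q s) ((l0 + l1 * x s) * node x s)^-1).
  rewrite !mulr_sumr -!big_split; apply: eq_bigr => s Qs /=.
  rewrite E1 -/r E2 E3; have nx := node_neq0 xi Qs; have l_x := lx s Qs; have e_x := ex s Qs.
  have k1 : e0 * l1 - e1 * l0 != 0.
    apply: contraNneq k0 => e.
    have -> : e0 - e1 * l0 / l1 = (e0 * l1 - e1 * l0) / l1 by field.
    by rewrite e mul0r.
  rewrite /a1 /a2 /k; move: (q3.[_]) (q2.[_]) (q1.[_]) => z b a.
  by field; rewrite nx l_x l10 k1 e_x.
rewrite (divided_difference xi) // !divided_difference_affine // divided_difference_affine2 //.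
rewrite c3 c2 c1; have P0 : \prod_(s | Q s) (e0 + e1 * x s) != 0 by apply/prodf_neq0.
have P1 : \prod_(s | Q s) (l0 + l1 * x s) != 0 by apply/prodf_neq0.
move: (\sum_(s | Q s) _) (\prod_(s | Q s) (e0 + _)) (\prod_(s | Q s) (l0 + _)) P0 P1.
move=> S F F' F0 F'0; move: ((- l1) ^+ _) ((- e1) ^+ _) a1 a2 => l l' a b.
by field; rewrite ?l10 ?e10 ?F0 ?F'0 ?k0.
Qed.

End AffineDividedDifferences.

(** * The three cases *)

Section Assembly.
Context {R : realType} {n : nat} (d : 'I_n.+3 -> nat) (pi1 pi2 : R).
Hypothesis d_gt0 : forall i, (0 < d i)%N.
Local Notation L z := (pi1 + pi2 * z).
Local Notation h := (factorization_space d pi1 pi2).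
Local Notation group i := (fun v : slot d => tag v == i).
Local Notation gsum i F := (\sum_(s : slot d | tag s == i) F s).
Implicit Types (x : slot d -> R) (s u w : slot d).

Lemma card_group i : #|group i| = d i.
Proof. by rewrite -sum1_card (big_slot _ i (fun=> 1%N)) sum1_card card_ord. Qed.

Lemma Delta_node i s x : tag s == i -> Delta s x = node (group i) x s.
Proof. by move=> /eqP <-. Qed.

Lemma regular_inj i x : regular pi1 pi2 x -> {in group i &, injective x}.
Proof.
move=> rx s u /eqP si /eqP ui e; apply/eqP; apply: contraT => su.
have := @regular_neq _ _ _ _ _ x s u rx su; rewrite si ui e subrr eqxx.
by move=> /(_ erefl).
Qed.

Lemma mu_group_power i (a b : R) x : i != ord_max ->
  mu (ins pi1 pi2 (decomposable (fun _ : 'I_(d i) => vec2 a b))) x =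
  \prod_(s | tag s == i) (a + b * x s).
Proof.
move=> im; rewrite mu_ins cfactor_other // mul1r tensor_pairing_decomposable.
rewrite (big_slot _ i (fun s => a + b * x s)); apply: eq_bigr => r _.
by rewrite sum_vec2; ring.
Qed.

Lemma mu_polarized i (a b a' b' : R) x : i != ord_max ->
  mu (ins pi1 pi2 (polarized (vec2 a b) (vec2 a' b') : tensors R 'I_(d i))) x =
  \sum_(s | tag s == i) (a' + b' * x s) * \prod_(v | (tag v == i) && (v != s)) (a + b * x v).
Proof.
move=> im; rewrite mu_ins cfactor_other // mul1r /polarized linear_sum.
rewrite (big_slot _ i (fun s => (a' + b' * x s) *
  \prod_(v | (tag v == i) && (v != s)) (a + b * x v))).
apply: eq_bigr => r _ /=; rewrite tensor_pairing_decomposable.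
rewrite (bigD1 r) //= eqxx sum_vec2; congr (_ * _); first by ring.
rewrite big_mkcondr (big_slot _ i (fun v => if v != Slot r then a + b * x v else 1)).
rewrite [RHS](bigD1 r) //= eqxx mul1r; apply: eq_bigr => t tr.
by rewrite eq_Tagged /= tr (negPf tr) sum_vec2; ring.
Qed.

(** The derivative at zero in [z] of the product of the factors [a + z + b x_s]. It realises the
    term with the sum of inverses that double poles leave behind. *)
Lemma mu_polarized_inv i (a b : R) x : i != ord_max ->
  (forall s, tag s == i -> a + b * x s != 0) ->
  mu (ins pi1 pi2 (polarized (vec2 a b) (vec2 1 0) : tensors R 'I_(d i))) x =
  (\prod_(s | tag s == i) (a + b * x s)) * gsum i (fun s => (a + b * x s)^-1).
Proof.
move=> im nz; rewrite mu_polarized // mulr_sumr; apply: eq_bigr => s si.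
by rewrite mul0r addr0 mul1r [in RHS](bigD1 s si) /= mulrC mulKf // nz.
Qed.

Lemma mu_polarized_sum i x : i != ord_max ->
  mu (ins pi1 pi2 (polarized (vec2 1 0) (vec2 0 1) : tensors R 'I_(d i))) x =
  gsum i (fun s => x s).
Proof.
move=> im; rewrite mu_polarized //; apply: eq_bigr => s _.
by rewrite big1 => [|v _]; rewrite ?mul0r; ring.
Qed.

Lemma mu_first_power (a b : R) x :
  mu (decomposable (fun s : slot d => if tag s == ord0 then vec2 a b else vec2 1 0)) x =
  \prod_(s : slot d | tag s == ord0) (a + b * x s).
Proof.
rewrite mu_decomposable (bigID (group ord0)) /= [X in _ * X]big1 => [|s /negPf ->].
  by rewrite mulr1; apply: eq_bigr => s ->; rewrite !mxE /=; ring.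
by rewrite !mxE /=; ring.
Qed.

Variables (beta : tensors R (slot d)) (e : (order_of d).-tuple (tensors R (slot d)))
  (I : slot d -> set R) (A : slot d -> R -> R).
Hypothesis geometry : separable_geometry pi1 pi2 beta e I A.
Variables (t ea eb : R) (Upsilon : 'I_n.+3 -> {poly R}).
Local Notation E z := (ea + eb * z).
Hypothesis mu_betaE : forall x, mu beta x = t * \prod_(s : slot d | tag s == ord0) E (x s).
Hypothesis A_first : forall q : 'I_(d ord0), exists G : R -> R,
  second_antiderivative (I (Slot q)) (fun z => (Upsilon ord0).[z] *
    (L z ^+ (d ord_max).-1 / E z ^+ (order_of d + 3))) G /\
  (forall z, I (Slot q) z ->
     A (Slot q) z = E z ^+ (order_of d + 1) / L z ^+ d ord_max * G z).
Hypothesis A_other : forall p, p != ord0 -> forall q : 'I_(d p),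
  second_antiderivative (I (Slot q)) (fun z => (Upsilon p).[z]) (A (Slot q)).

(** Minus the scalar curvature divided by [mu beta]. *)
Definition extremal_sum x : R :=
  gsum ord0 (fun s => (Upsilon ord0).[x s] / (E (x s) ^+ 2 * L (x s) * node (group ord0) x s))
  + \sum_(i | (i != ord0) && (i != ord_max))
      gsum i (fun s => (Upsilon i).[x s] / node (group i) x s)
  + gsum ord_max (fun s => (Upsilon ord_max).[x s] / node (group ord_max) x s)
    / \prod_(s : slot d | tag s == ord0) L (x s).

Lemma sum_curvature_term x : box I x ->
  \sum_s curvature_term pi1 pi2 beta A s x = mu beta x * extremal_sum x.
Proof.
move=> Ix; rewrite (partition_big tag xpredT) //= (bigD1 ord0) //= (bigD1 ord_max) //=.
rewrite [X in _ + X]addrC addrA /extremal_sum !mulrDr !mulr_sumr; congr (_ + _ + _).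
- apply: eq_bigr => s s0; case: s s0 => i q /= /eqP i0; move: q; rewrite i0 => q.
  have [G [dG AG]] := A_first q; rewrite -/(Slot q).
  rewrite (curvature_term_first geometry d_gt0 mu_betaE Ix _ dG AG) //.
  rewrite /weight cfactor_other // mulr1 (@Delta_node ord0) //.
  by rewrite !invfM; ring.
- apply: eq_bigr => i /andP[i0 im]; rewrite mulr_sumr; apply: eq_bigr => s /eqP si.
  case: s si => j q /= ji; move: q; rewrite ji => q; rewrite -/(Slot q).
  rewrite (curvature_term_other geometry mu_betaE Ix _ (@A_other i i0 q)) //.
  rewrite /weight cfactor_other // mulr1 (@Delta_node i) //.
  by rewrite mulrAC mulrA.
- rewrite mulr_suml mulr_sumr; apply: eq_bigr => s /eqP sm.
  case: s sm => j q /= jm; move: q; rewrite jm => q; rewrite -/(Slot q).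
  rewrite (curvature_term_other geometry mu_betaE Ix _ (@A_other ord_max isT q)) //.
  rewrite /weight cfactor_max (@Delta_node ord_max) // invfM.
  by ring.
Qed.

(** One factor [mu beta] comes from the curvature terms, the other from the normalisation of the
    potential. *)
Lemma extremal_from_sum alpha : alpha \in h ->
  (forall x, box I x -> mu alpha x = mu beta x ^+ 2 * extremal_sum x) ->
  extremal (chart_domain I) (g_metric pi1 pi2 A beta e) (J_complex pi1 pi2 A beta e).
Proof.
move=> ah Ha; apply: (extremal_criterion geometry ah) => x Ix.
have b0 := mu_beta_neq0 geometry Ix.
rewrite -[LHS]/(\sum_s curvature_term pi1 pi2 beta A s x) sum_curvature_term //.
by rewrite /mu_normalized Ha //; field.
Qed.

(** With the degree bounds of cases 2 and 3, each group other than the first contributes only its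
    top coefficient. *)
Lemma extremal_sumE x : box I x ->
  (forall p, p != ord0 -> (size (Upsilon p) <= (d p).-1.+1)%N) ->
  extremal_sum x =
  gsum ord0 (fun s => (Upsilon ord0).[x s] / (E (x s) ^+ 2 * L (x s) * node (group ord0) x s))
  + \sum_(i | (i != ord0) && (i != ord_max)) (Upsilon i)`_(d i).-1
  + (Upsilon ord_max)`_(d ord_max).-1 / \prod_(s : slot d | tag s == ord0) L (x s).
Proof.
move=> Ix sY.
have groupE i : i != ord0 -> gsum i (fun s => (Upsilon i).[x s] / node (group i) x s)
    = (Upsilon i)`_(d i).-1.
  move=> i0; rewrite divided_difference ?card_group //.
    exact: regular_inj (box_regular geometry Ix).
  by apply: leq_trans (sY i i0) _; rewrite prednK.
rewrite /extremal_sum groupE //; congr (_ + _ + _).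
by apply: eq_bigr => i /andP[i0 _]; exact: groupE.
Qed.

End Assembly.

Lemma second_antiderivative_eq (R : realType) (J : set R) (F F' G : R -> R) :
  (forall z, J z -> F z = F' z) ->
  second_antiderivative J F G -> second_antiderivative J F' G.
Proof. by move=> FF' H z Jz; rewrite -FF' //; exact: H. Qed.

Theorem proposition4p5p1 (R : realType) (n : nat) (d : 'I_n.+3 -> nat)
  (d_gt0 : forall i, (0 < d i)%N)
  (pi1 pi2 : R) (pi2_neq0 : pi2 != 0)
  (beta : tensors R (slot d)) (e : (order_of d).-tuple (tensors R (slot d)))
  (I : slot d -> set R) (A : slot d -> R -> R)
  (geometry : separable_geometry pi1 pi2 beta e I A)
  (Upsilon : 'I_n.+3 -> {poly R}) :
  let m := order_of d in
  let d1 := d ord0 in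
  let dk := d ord_max in
  let L := fun z : R => pi1 + pi2 * z in
  [\/ (* case 1 *)
      [/\ beta \in <[decomposable (fun _ : slot d => vec2 1 0)]>%VS,
          (forall q : 'I_(d ord0), exists G : R -> R,
             second_antiderivative (I (Slot q))
               (fun z => (Upsilon ord0).[z] * L z ^+ dk.-1) G /\
             (forall z, I (Slot q) z -> A (Slot q) z = (L z ^+ dk)^-1 * G z)),
          (forall p, p != ord0 -> forall q : 'I_(d p),
             second_antiderivative (I (Slot q))
               (fun z => (Upsilon p).[z]) (A (Slot q))),
          [/\ (size (Upsilon ord0) <= (d1 + 1).+1)%N,
              (forall p, p != ord0 -> p != ord_max ->
                 (size (Upsilon p) <= (d p).+1)%N)
            & (size (Upsilon ord_max) <= dk.-1.+1)%N]
        & (Upsilon ord_max)`_(dk.-1)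
            = - (- pi2) ^+ d1.-1 * (Upsilon ord0).[- pi1 / pi2]],
      (* case 2 *)
      [/\ beta \in <[decomposable (fun s : slot d =>
             if tag s == ord0 then vec2 pi1 pi2 else vec2 1 0)]>%VS,
          (forall q : 'I_(d ord0), exists G : R -> R,
             second_antiderivative (I (Slot q))
               (fun z => (Upsilon ord0).[z] * L z ^ (- m%:Z + dk%:Z - 4)) G /\
             (forall z, I (Slot q) z ->
                A (Slot q) z = L z ^ (m%:Z + 1 - dk%:Z) * G z)),
          (forall p, p != ord0 -> forall q : 'I_(d p),
             second_antiderivative (I (Slot q))
               (fun z => (Upsilon p).[z]) (A (Slot q))),
          (size (Upsilon ord0) <= (d1 + 2).+1)%N /\
          (forall p, p != ord0 -> (size (Upsilon p) <= (d p).-1.+1)%N)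
        & (Upsilon ord0).[- pi1 / pi2] = 0 /\
          (Upsilon ord0)`_(d1 + 2) / pi2 ^+ 3
            + \sum_(i | (i != ord0) && (i != ord_max)) (Upsilon i)`_((d i).-1)
            = 0]
    | (* case 3 *)
      exists a b : R,
      [/\ [/\ beta \in <[decomposable (fun s : slot d =>
                 if tag s == ord0 then vec2 a b else vec2 1 0)]>%VS,
              b != 0
            & <[vec2 a b]>%VS != <[vec2 pi1 pi2]>%VS],
          (forall q : 'I_(d ord0), exists G : R -> R,
             second_antiderivative (I (Slot q))
               (fun z => (Upsilon ord0).[z]
                  * (L z ^+ dk.-1 / (a + b * z) ^+ (m + 3))) G /\
             (forall z, I (Slot q) z ->
                A (Slot q) z = (a + b * z) ^+ (m + 1) / L z ^+ dk * G z)),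
          (forall p, p != ord0 -> forall q : 'I_(d p),
             second_antiderivative (I (Slot q))
               (fun z => (Upsilon p).[z]) (A (Slot q))),
          (size (Upsilon ord0) <= (d1 + 2).+1)%N /\
          (forall p, p != ord0 -> (size (Upsilon p) <= (d p).-1.+1)%N)
        & (Upsilon ord_max)`_(dk.-1) * (a - b * pi1 / pi2) ^+ 2
            = - (- pi2) ^+ d1.-1 * (Upsilon ord0).[- pi1 / pi2] /\
          (Upsilon ord0)`_(d1 + 2) / (pi2 * b ^+ 2)
            + \sum_(i | (i != ord0) && (i != ord_max)) (Upsilon i)`_((d i).-1)
            = 0]] ->
  extremal (chart_domain I) (g_metric pi1 pi2 A beta e)
    (J_complex pi1 pi2 A beta e).
Proof.
move=> m d1 dk L.
(* On an empty chart the claim is vacuous. Otherwise [x0] supplies the other coordinates when a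
   number of one interval has to be completed to a point of the box, as in [L0]. *)
have [[x0 Ix0]|no] := pselect (exists x, box I x); last first.
  by move=> _ y Iy; case: no; exists (xpart y).
have Q0 (i : 'I_n.+3) : (0 < #|(fun v : slot d => tag v == i)|)%N by rewrite card_group.
have inj x i (Ix : box I x) := @regular_inj _ _ _ pi1 pi2 i x (box_regular geometry Ix).
have Lx x s (Ix : box I x) (s0 : tag s == ord0) : pi1 + pi2 * x s != 0.
  by apply: (regular_L (box_regular geometry Ix)); exact/eqP.
have L0 (q : 'I_(d ord0)) z : I (Slot q) z -> L z != 0.
  move=> Iz; have Iu : box I (@dfwith _ (fun=> R) x0 (Slot q) z) by move=> u; case: dfwithP.
  by have := Lx _ (Slot q) Iu (eqxx _); rewrite dfwithin.
have dk0 : (0 < dk)%N := d_gt0 ord_max.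
have max0 : (ord0 : 'I_n.+3) != ord_max by [].
have line_in (i : 'I_n.+3) (w : 'rV[R]_2) :
    ins pi1 pi2 (decomposable (fun _ : 'I_(d i) => w)) \in factorization_space d pi1 pi2.
  by apply: ins_factorization; exact: decomposable_sym.
have polar_in (i : 'I_n.+3) (w v : 'rV[R]_2) :
    ins pi1 pi2 (polarized w v : tensors R 'I_(d i)) \in factorization_space d pi1 pi2.
  by apply: ins_factorization; exact: polarized_sym.
case=> [[/vlineP[t betaE] A1 A2 [s1 s2 s3] gk]|
        [/vlineP[t betaE] A1 A2 [s1 s2] [U0 sum0]]|
        [a [b [[/vlineP[t betaE] b0 ab] A1 A2 [s1 s2] [gk sum0]]]]].
(* Case 1 is [E = 1], written as the affine function [1 + 0 * z]. *)
- have mbE x : mu beta x = t * \prod_(s : slot d | tag s == ord0) (1 + 0 * x s).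
    rewrite -mu_first_power betaE muZ; congr (_ * mu (decomposable _) x).
    by apply/funext => s; rewrite if_same.
  have [c [c' cE]] := @sum_affine1 _ _ (fun v : slot d => tag v == ord0) (Upsilon ord0)
    pi1 pi2 pi2_neq0 (Q0 ord0) (ltac:(by rewrite card_group; move: s1; rewrite addn1)).
  (* Constants and the coordinate sums of the first and the middle groups are all that remains; they
     are the functions of the power of [(1,0)] and of its polarization towards [(0,1)]. *)
  pose alpha := t ^+ 2 *: (c *: ins pi1 pi2 (decomposable (fun _ : 'I_(d ord0) => vec2 1 0))
    + c' *: ins pi1 pi2 (polarized (vec2 1 0) (vec2 0 1) : tensors R 'I_(d ord0))
    + \sum_(i | (i != ord0) && (i != ord_max))
       ((Upsilon i)`_(d i).-1 *: ins pi1 pi2 (decomposable (fun _ : 'I_(d i) => vec2 1 0))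
        + (Upsilon i)`_(d i) *: ins pi1 pi2 (polarized (vec2 1 0) (vec2 0 1) : tensors R 'I_(d i)))).
  apply: (extremal_from_sum d_gt0 geometry mbE _ A2 (alpha := alpha)).
  + move=> q; have [G [dG AG]] := A1 q; exists G; split.
      apply: second_antiderivative_eq dG => z _.
      by rewrite mul0r addr0 expr1n divr1.
    by move=> z /AG ->; rewrite mul0r addr0 expr1n mul1r.
  + rewrite rpredZ // rpredD ?rpredD ?rpredZ // rpred_sum // => i _.
    by rewrite rpredD ?rpredZ.
  move=> x Ix; rewrite mbE big1 ?mulr1 => [|s _]; last by rewrite mul0r addr0.
  rewrite /alpha muZ !muD !muZ mu_sum; congr (_ * _).
  rewrite mu_group_power // mu_polarized_sum // big1 ?mulr1 => [|s _]; last by rewrite mul0r addr0.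
  rewrite /extremal_sum.
  have PL0 : \prod_(s : slot d | tag s == ord0) (pi1 + pi2 * x s) != 0.
    by apply/prodf_neq0 => s; exact: Lx.
  rewrite [X in _ = X + _ + _](_ : _ = c + c' * (\sum_(s : slot d | tag s == ord0) x s)
     + (Upsilon ord0).[- pi1 / pi2] * (- pi2) ^+ d1.-1
       / \prod_(s : slot d | tag s == ord0) (pi1 + pi2 * x s)); last first.
    rewrite -[d1](card_group d ord0) -cE; [|exact: inj|by move=> s; exact: Lx].
    by apply: eq_bigr => s _; rewrite mul0r addr0 expr1n mul1r.
  rewrite [X in _ = _ + _ + X / _](_ : _ = (Upsilon ord_max)`_dk.-1); last first.
    rewrite divided_difference ?card_group //; first exact: inj.
    by apply: leq_trans s3 _; rewrite prednK.
  (* The condition on the last group cancels the pole left by the first group. *)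
  rewrite gk [X in _ = _ + X + _](_ : _ = \sum_(i | (i != ord0) && (i != ord_max))
       mu ((Upsilon i)`_(d i).-1 *: ins pi1 pi2 (decomposable (fun _ : 'I_(d i) => vec2 1 0))
        + (Upsilon i)`_(d i) *: ins pi1 pi2 (polarized (vec2 1 0) (vec2 0 1) : tensors R 'I_(d i))) x);
    last first.
    apply: eq_bigr => i /andP[i0 im]; rewrite muD !muZ mu_group_power // mu_polarized_sum //.
    rewrite [\prod_(s | _) _]big1 => [|s _]; last by rewrite mul0r addr0.
    by rewrite mulr1 divided_difference_succ ?card_group ?s2 //; exact: inj.
  by field.
- have mbE x : mu beta x = t * \prod_(s : slot d | tag s == ord0) (pi1 + pi2 * x s).
    by rewrite -mu_first_power betaE muZ.
  have [c [c' cE]] := @sum_affine3 _ _ (fun v : slot d => tag v == ord0) (Upsilon ord0)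
    pi1 pi2 pi2_neq0 (Q0 ord0) (ltac:(by rewrite card_group; move: s1; rewrite addn2)) U0.
  (* The last group contributes its coefficient over the product of the [L (x s)], the same shape as
     the term [c], and is therefore added to it. *)
  pose alpha := t ^+ 2 *: ((c + (Upsilon ord_max)`_dk.-1)
       *: ins pi1 pi2 (decomposable (fun _ : 'I_(d ord0) => vec2 pi1 pi2))
    + c' *: ins pi1 pi2 (polarized (vec2 pi1 pi2) (vec2 1 0) : tensors R 'I_(d ord0))).
  apply: (extremal_from_sum d_gt0 geometry mbE _ A2 (alpha := alpha)).
  + move=> q; have [G [dG AG]] := A1 q; exists G; split.
      apply: second_antiderivative_eq dG => z /L0 Lz; rewrite -/(L z) -/m -/dk; congr (_ * _).
      (* Case 2 is [E = L]: the single integer exponent is [(dk - 1) - (m + 3)], and below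
         [(m + 1) - dk]. *)
      rewrite (_ : - m%:Z + dk%:Z - 4 = dk.-1%:Z - (m + 3)%N%:Z); last first.
        by rewrite -[in LHS](prednK dk0) PoszD -addn1 PoszD; ring.
      by rewrite expfzDr // -!exprnP exprnN.
    move=> z Iz; rewrite (AG z Iz); have Lz := L0 q z Iz; congr (_ * _).
    by rewrite (_ : m%:Z + 1 - dk%:Z = (m + 1)%N%:Z - dk%:Z) ?PoszD // expfzDr // -!exprnP exprnN.
  + by rewrite rpredZ // rpredD ?rpredZ.
  move=> x Ix; have PL0 : \prod_(s : slot d | tag s == ord0) (pi1 + pi2 * x s) != 0.
    by apply/prodf_neq0 => s; exact: Lx.
  rewrite mbE /alpha muZ !muD !muZ mu_group_power // mu_polarized_inv //; last by move=> s; exact: Lx.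
  rewrite (extremal_sumE d_gt0 geometry) // cE; [|exact: inj|by move=> s; exact: Lx].
  (* Constant terms would turn into multiples of [mu beta ^+ 2], quadratic in the coordinates of the
     first group; the condition removes them. *)
  move: sum0; rewrite card_group -/d1 addn2 => /eqP; rewrite addr_eq0 => /eqP ->.
  rewrite -/dk; set S1 := \sum_(i | _) (Upsilon i)`_(d i).-1; set S2 := \sum_(s | _) _.
  by field.
- have mbE x : mu beta x = t * \prod_(s : slot d | tag s == ord0) (a + b * x s).
    by rewrite -mu_first_power betaE muZ.
  (* This number is the value of [E] at the root of [L]; if it vanished, [(a, b)] would be [b / pi2]
     times [(pi1, pi2)] and the two lines would agree. *)
  have ab0 : a - b * pi1 / pi2 != 0.
    apply: contraNneq ab => aE; have aE' : a = b / pi2 * pi1.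
      by move/eqP: aE; rewrite subr_eq0 => /eqP ->; ring.
    have c0 : b / pi2 != 0 by rewrite mulf_neq0 ?invr_eq0.
    have -> : vec2 a b = (b / pi2) *: vec2 pi1 pi2.
      by apply/rowP => j; rewrite !mxE; case: ifP => _; rewrite ?aE' // mulfVK.
    rewrite eqEsubv -!memvE memvZ ?memv_line //=.
    by apply/vlineP; exists (b / pi2)^-1; rewrite scalerA mulVf // scale1r.
  have [c [c' cE]] := @sum_affine21 _ _ (fun v : slot d => tag v == ord0) (Upsilon ord0)
    pi1 pi2 a b pi2_neq0 b0 ab0 (Q0 ord0)
    (ltac:(by rewrite card_group; move: s1; rewrite addn2)).
  pose alpha := t ^+ 2 *: (c *: ins pi1 pi2 (decomposable (fun _ : 'I_(d ord0) => vec2 a b))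
    + c' *: ins pi1 pi2 (polarized (vec2 a b) (vec2 1 0) : tensors R 'I_(d ord0))).
  apply: (extremal_from_sum d_gt0 geometry mbE A1 A2 (alpha := alpha)).
    by rewrite rpredZ // rpredD ?rpredZ.
  move=> x Ix; have Ex s (s0 : tag s == ord0) : a + b * x s != 0.
    by apply: (E_neq0 geometry mbE Ix); exact/eqP.
  have PL0 : \prod_(s : slot d | tag s == ord0) (pi1 + pi2 * x s) != 0.
    by apply/prodf_neq0 => s; exact: Lx.
  have PE0 : \prod_(s : slot d | tag s == ord0) (a + b * x s) != 0.
    by apply/prodf_neq0 => s; exact: Ex.
  rewrite mbE /alpha muZ !muD !muZ mu_group_power // mu_polarized_inv //.
  rewrite (extremal_sumE d_gt0 geometry) // cE //; [|exact: inj|by move=> s; exact: Lx].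
  (* Solved for its coefficient, the last group is exactly opposite to the pole at the root of [L]
     in [cE]; the other condition removes the constants as in case 2. *)
  have gkE : (Upsilon ord_max)`_dk.-1 =
      - ((Upsilon ord0).[- pi1 / pi2] / (a - b * pi1 / pi2) ^+ 2 * (- pi2) ^+ d1.-1).
    apply: (mulIf (expf_neq0 2 ab0)); rewrite gk.
    by move: ((- pi2) ^+ _) _.[_] (a - _) ab0 => l u k k0; field.
  move: sum0; rewrite card_group -/d1 -/dk gkE addn2 => /eqP; rewrite addr_eq0 => /eqP ->.
  move: (_.[_] / _ * _) => u.
  set S1 := \sum_(i | _) (Upsilon i)`_(d i).-1; set S2 := \sum_(s | _) _.
  by field; rewrite PL0 PE0.
Qed.
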